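(* Let $k$ be a field of characteristic zero, let $R$ be a finite semi-simple ring, let $\mathcal{A}$ be a small additive category and let $\pi:\mathcal{A}\to\mathbf{P}_R$ be a full, additive and essentially surjective functor. Let $F$, $F'$ and $G$ be three functors from $\mathbf{P}_R$ to $k\text{-}\mathbf{Mod}$, with $F$ contravariant and $F',G$ covariant. Then the graded vector spaces $$\mathrm{Ext}^*_{k[\mathcal{A}]}(\pi^*F',\pi^*G)\quad\text{and}\quad \mathrm{Tor}_*^{k[\mathcal{A}]}(\pi^*F,\pi^*G)$$ vanish in positive degrees.
   Context: $\mathbf{P}_R$ is the category of finitely generated projective right $R$-modules. ''Small'' means that isomorphism classes of objects form a set. $k[\mathcal{A}]\text{-}\mathbf{Mod}$ is the category of all (not necessarily additive) functors $\mathcal{A}\to k\text{-}\mathbf{Mod}$, in which $\mathrm{Ext}^*_{k[\mathcal{A}]}$ is computed. For $H$ contravariant and $K$ covariant, $H\otimes_{k[\mathcal{A}]}K=\int^{x}H(x)\otimes_kK(x)$ (coend) and $\mathrm{Tor}_*^{k[\mathcal{A}]}$ is its left derived functor. $\pi^*F=F\circ\pi$. *)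

(* Defs.v *)
From HB Require Import structures.
From mathcomp Require Import all_boot all_algebra boolp.
From mathcomp Require Import freeg.

Set Implicit Arguments.
Unset Strict Implicit.
Unset Printing Implicit Defensive.

Import GRing.Theory.
Local Open Scope ring_scope.
Local Open Scope quotient_scope.

(** * Modules *)

Lemma linear_ext (S : pzRingType) (U V : lmodType S) (f g : {linear U -> V}) :
  f =1 g -> f = g.
Proof.
move/funext => /= fg; case: f g fg => f cf [g cg] /= fg.
subst g; congr GRing.Linear.Pack.
case: cf cg => [[f1] [f2]] [[g1] [g2]].
by congr GRing.Linear.Class; congr (_ _); apply: Prop_irrelevance.
Qed.

(* [{linear U -> V}] as an abelian group, for modules over any ring. *)
Definition modhom (S : pzRingType) (U V : lmodType S) : Type := {linear U -> V}.

Section ModHom.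
Context (S : pzRingType) (U V : lmodType S).
Local Notation hom := (modhom U V).
Implicit Types f g h : hom.

Definition modhom0 : hom := (\0 : {linear U -> V}).
Definition modhomD f g : hom :=
  ((f : {linear U -> V}) \+ (g : {linear U -> V}) : {linear U -> V}).
Definition modhomN f : hom := (\- (f : {linear U -> V}) : {linear U -> V}).

Lemma modhomDA : associative modhomD.
Proof. by move=> f g h; apply: linear_ext => x /=; rewrite addrA. Qed.
Lemma modhomDC : commutative modhomD.
Proof. by move=> f g; apply: linear_ext => x /=; rewrite addrC. Qed.
Lemma modhom0D : left_id modhom0 modhomD.
Proof. by move=> f; apply: linear_ext => x /=; rewrite add0r. Qed.
Lemma modhomND : left_inverse modhom0 modhomN modhomD.
Proof. by move=> f; apply: linear_ext => x /=; rewrite addNr. Qed.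

HB.instance Definition _ := gen_eqMixin hom.
HB.instance Definition _ := gen_choiceMixin hom.
HB.instance Definition _ :=
  GRing.isZmodule.Build hom modhomDA modhomDC modhom0D modhomND.
End ModHom.

Definition finitely_generated (S : pzRingType) (M : lmodType S) : Prop :=
  exists (n : nat) (e : 'I_n -> M),
    forall x : M, exists c : 'I_n -> S, x = \sum_(i < n) c i *: e i.

Definition projective_module (S : pzRingType) (M : lmodType S) : Prop :=
  forall (X Y : lmodType S) (p : {linear X -> Y}) (f : {linear M -> Y}),
    (forall y, exists x, p x = y) ->
    exists g : {linear M -> X}, forall m, p (g m) = f m.

Definition simple_submodule (S : pzRingType) (M : lmodType S)
    (U : submodClosed M) : Prop :=
  (exists2 x : M, x \in U & x != 0) /\
  forall V : submodClosed M, {subset V <= U} ->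
    (forall x, x \in V -> x = 0) \/ {subset U <= V}.

(* [M] is the sum of its simple submodules. *)
Definition semisimple_module (S : pzRingType) (M : lmodType S) : Prop :=
  forall x : M, exists2 s : seq M, x = \sum_(y <- s) y &
    forall y, y \in s ->
      exists2 U : submodClosed M, simple_submodule U & y \in U.

(* Right [R]-modules are left modules over the converse ring [R^c]. *)
Definition semisimple_ring (R : pzRingType) : Prop :=
  semisimple_module (R^c)^o.

Section LinearKernel.
Context (k : pzRingType) (U V : lmodType k) (f : {linear U -> V}).

Definition lker_pred : {pred U} := fun u => f u == 0.

Lemma lker_submod_closed : submod_closed lker_pred.
Proof.
split=> [|a u v]; rewrite !unfold_in ?linear0 // => /eqP fu /eqP fv.
by rewrite linearP fu fv scaler0 addr0.
Qed.
HB.instance Definition _ :=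
  GRing.isSubmodClosed.Build k U lker_pred lker_submod_closed.

Record lkernel := LKernel { lkernel_val :> U; _ : lkernel_val \in lker_pred }.
HB.instance Definition _ := [isSub for lkernel_val].
HB.instance Definition _ := [Choice of lkernel by <:].
HB.instance Definition _ := [SubChoice_isSubLmodule of lkernel by <:].
End LinearKernel.

Section QuotientModule.
Context (k : pzRingType) (V : lmodType k) (I : submodClosed V).

Definition lquot_pred : {pred V} := I.
HB.instance Definition _ := GRing.isZmodClosed.Build V lquot_pred
  (GRing.submod_closedB (GRing.submodClosedP I)).

Definition lquot : Type := Quotient.quot lquot_pred.
HB.instance Definition _ := GRing.Zmodule.on lquot.

Definition lquot_pi (v : V) : lquot := \pi_(Quotient.quot lquot_pred) v.
Definition lquot_scale (a : k) (q : lquot) : lquot :=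
  lquot_pi (a *: repr (q : Quotient.quot lquot_pred)).

Lemma lquot_piP u v : (lquot_pi u = lquot_pi v) <-> (u - v \in I).
Proof.
rewrite -[u - v \in I]/(u - v \in lquot_pred) Quotient.idealrBE.
by split=> [/eqP|/eqP].
Qed.

Lemma lquot_pi_surj q : exists v, lquot_pi v = q.
Proof. by exists (repr (q : Quotient.quot lquot_pred)); rewrite /lquot_pi reprK. Qed.

Lemma lquot_scale_pi a v : lquot_scale a (lquot_pi v) = lquot_pi (a *: v).
Proof.
apply/lquot_piP; rewrite -scalerBr rpredZ //; apply/lquot_piP.
by rewrite /lquot_pi reprK.
Qed.

Lemma lquot_pi_is_zmod_morphism : zmod_morphism lquot_pi.
Proof. by move=> u v; rewrite /lquot_pi raddfB. Qed.
HB.instance Definition _ :=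
  GRing.isZmodMorphism.Build V lquot lquot_pi lquot_pi_is_zmod_morphism.

Lemma lquot_scaleA a b q : lquot_scale a (lquot_scale b q) = lquot_scale (a * b) q.
Proof. by have [v <-] := lquot_pi_surj q; rewrite !lquot_scale_pi scalerA. Qed.
Lemma lquot_scale1 : left_id 1 lquot_scale.
Proof. by move=> q; have [v <-] := lquot_pi_surj q; rewrite lquot_scale_pi scale1r. Qed.
Lemma lquot_scaleDr : right_distributive lquot_scale +%R.
Proof.
move=> a p q; have [u <-] := lquot_pi_surj p; have [v <-] := lquot_pi_surj q.
by rewrite -raddfD !lquot_scale_pi scalerDr raddfD.
Qed.
Lemma lquot_scaleDl q : {morph lquot_scale^~ q : a b / a + b}.
Proof.
move=> a b; have [v <-] := lquot_pi_surj q.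
by rewrite !lquot_scale_pi scalerDl raddfD.
Qed.
HB.instance Definition _ := GRing.Zmodule_isLmodule.Build k lquot
  lquot_scaleA lquot_scale1 lquot_scaleDr lquot_scaleDl.

Lemma lquot_pi_is_scalable : scalable lquot_pi.
Proof. by move=> a v; rewrite -lquot_scale_pi. Qed.
HB.instance Definition _ :=
  GRing.isScalable.Build k V lquot *:%R lquot_pi lquot_pi_is_scalable.
End QuotientModule.

(** * Preadditive categories *)

Record precat := Precat {
  ob :> Type;
  hom : ob -> ob -> zmodType;
  idm : forall x, hom x x;
  comp : forall x y z, hom y z -> hom x y -> hom x z;
  compA : forall w x y z (h : hom y z) (g : hom x y) (f : hom w x),
    comp h (comp g f) = comp (comp h g) f;
  comp1m : forall x y (f : hom x y), comp (idm y) f = f;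
  compm1 : forall x y (f : hom x y), comp f (idm x) = f;
  compDl : forall x y z (g g' : hom y z) (f : hom x y),
    comp (g + g') f = comp g f + comp g' f;
  compDr : forall x y z (g : hom y z) (f f' : hom x y),
    comp g (f + f') = comp g f + comp g f'
}.
Arguments idm {p} x.

Definition opcat (A : precat) : precat :=
  @Precat A (fun x y => hom y x) (@idm A) (fun x y z g f => comp f g)
    (fun w x y z h g f => esym (compA f g h))
    (fun x y f => compm1 f) (fun x y f => comp1m f)
    (fun x y z g g' f => compDr f g g')
    (fun x y z g f f' => compDl f f' g).

Definition isomorphic (A : precat) (x y : A) : Prop :=
  exists (f : hom x y) (g : hom y x), comp g f = idm x /\ comp f g = idm y.

Definition zero_object (A : precat) (z : A) : Prop := idm z = 0.

Definition biproduct (A : precat) (x y b : A) : Prop :=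
  exists (i1 : hom x b) (i2 : hom y b) (p1 : hom b x) (p2 : hom b y),
    [/\ comp p1 i1 = idm x, comp p2 i2 = idm y,
        comp p2 i1 = 0, comp p1 i2 = 0 &
        comp i1 p1 + comp i2 p2 = idm b].

Definition additive_category (A : precat) : Prop :=
  (exists z : A, zero_object z) /\
  (forall x y : A, exists b : A, biproduct x y b).

(* The isomorphism classes of objects are represented by a type [S] living in
   the universe of the carriers of modules, whereas the objects of [A] (for
   instance those of [projcat R] below) may live in a larger one.  The universe
   of [S] gets pinned below, where direct sums of modules are indexed by [S]. *)
Definition small_category (A : precat) : Prop :=
  exists (S : Type) (r : S -> A), forall x : A, exists s : S, isomorphic (r s) x.

Record functor (A B : precat) := Functor {
  fob :> A -> B;
  fmap : forall x y, hom x y -> hom (fob x) (fob y);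
  fmap_id : forall x, fmap (idm x) = idm (fob x);
  fmap_comp : forall x y z (g : hom y z) (f : hom x y),
    fmap (comp g f) = comp (fmap g) (fmap f)
}.

Definition opfunctor (A B : precat) (F : functor A B) :
    functor (opcat A) (opcat B) :=
  @Functor (opcat A) (opcat B) F (fun x y f => fmap F f)
    (@fmap_id _ _ F) (fun x y z g f => fmap_comp F f g).

Definition additive_functor (A B : precat) (F : functor A B) : Prop :=
  forall x y, {morph @fmap A B F x y : f g / f + g}.

Definition full (A B : precat) (F : functor A B) : Prop :=
  forall (x y : A) (g : hom (F x) (F y)), exists f : hom x y, fmap F f = g.

Definition essentially_surjective (A B : precat) (F : functor A B) : Prop :=
  forall y : B, exists x : A, isomorphic (F x) y.

(* The category P_R of finitely generated projective right [R]-modules. *)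
Record projmod (R : pzRingType) := ProjMod {
  projmod_sort :> lmodType R^c;
  projmod_fg : finitely_generated projmod_sort;
  projmod_proj : projective_module projmod_sort
}.

Section ProjCat.
Context (R : pzRingType).
Implicit Types M N P Q : projmod R.

Definition projcat_id M : modhom M M := (idfun : {linear M -> M}).
Definition projcat_comp M N P (g : modhom N P) (f : modhom M N) : modhom M P :=
  ((g : {linear N -> P}) \o (f : {linear M -> N}) : {linear M -> P}).

Lemma projcat_compA M N P Q (h : modhom P Q) (g : modhom N P) (f : modhom M N) :
  projcat_comp h (projcat_comp g f) = projcat_comp (projcat_comp h g) f.
Proof. exact: linear_ext. Qed.
Lemma projcat_comp1m M N (f : modhom M N) : projcat_comp (projcat_id N) f = f.
Proof. exact: linear_ext. Qed.
Lemma projcat_compm1 M N (f : modhom M N) : projcat_comp f (projcat_id M) = f.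
Proof. exact: linear_ext. Qed.
Lemma projcat_compDl M N P (g g' : modhom N P) (f : modhom M N) :
  projcat_comp (g + g') f = projcat_comp g f + projcat_comp g' f.
Proof. exact: linear_ext. Qed.
Lemma projcat_compDr M N P (g : modhom N P) (f f' : modhom M N) :
  projcat_comp g (f + f') = projcat_comp g f + projcat_comp g f'.
Proof. by apply: linear_ext => x /=; rewrite linearD. Qed.

Definition projcat : precat :=
  Precat projcat_compA projcat_comp1m projcat_compm1
    projcat_compDl projcat_compDr.
End ProjCat.

(** * The category k[A]-Mod of all functors from A to k-Mod *)

Record kfunctor (k : fieldType) (A : precat) := KFunctor {
  kob :> A -> lmodType k;
  kmap : forall x y, hom x y -> {linear kob x -> kob y};
  kmap_id : forall x (v : kob x), kmap (idm x) v = v;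
  kmap_comp : forall x y z (g : hom y z) (f : hom x y) (v : kob x),
    kmap (comp g f) v = kmap g (kmap f v)
}.

Definition pullback (k : fieldType) (A B : precat) (p : functor A B)
    (F : kfunctor k B) : kfunctor k A.
Proof.
refine (@KFunctor k A (fun x => F (p x)) (fun x y f => kmap F (fmap p f)) _ _).
- by move=> x v; rewrite fmap_id kmap_id.
- by move=> x y z g f v; rewrite fmap_comp kmap_comp.
Defined.

Record nattrans (k : fieldType) (A : precat) (F G : kfunctor k A) := NatTrans {
  ncomp :> forall x, {linear F x -> G x};
  natural : forall x y (f : hom x y) (v : F x),
    ncomp y (kmap F f v) = kmap G f (ncomp x v)
}.

Section Resolutions.
Context (k : fieldType) (A : precat).
Implicit Types F G X Y P : kfunctor k A.

(* In a functor category, epimorphisms are the pointwise surjective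
   transformations, and exactness is pointwise. *)
Definition nat_epi X Y (p : nattrans X Y) : Prop :=
  forall a (y : Y a), exists x : X a, p a x = y.

Definition nat_exact F G H (s : nattrans F G) (t : nattrans G H) : Prop :=
  forall a (y : G a), t a y = 0 <-> exists x : F a, s a x = y.

Definition projective_functor P : Prop :=
  forall X Y (p : nattrans X Y) (f : nattrans P Y), nat_epi p ->
    exists g : nattrans P X, forall a (u : P a), p a (g a u) = f a u.

Record projective_resolution F := ProjRes {
  res :> nat -> kfunctor k A;
  res_d : forall n, nattrans (res n.+1) (res n);
  res_aug : nattrans (res 0%N) F;
  res_proj : forall n, projective_functor (res n);
  res_epi : nat_epi res_aug;
  res_exact0 : nat_exact (res_d 0%N) res_aug;
  res_exact : forall n, nat_exact (res_d n.+1) (res_d n)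
}.
End Resolutions.

(** ** Ext *)

Section Ext.
Context (k : fieldType) (A : precat) (F G : kfunctor k A).
Context (P : projective_resolution F).

Definition cocycle (n : nat) (z : nattrans (P n) G) : Prop :=
  forall a (u : P n.+1 a), z a (res_d P n a u) = 0.

Definition coboundary (n : nat) : nattrans (P n) G -> Prop :=
  match n return nattrans (P n) G -> Prop with
  | 0%N => fun z => forall a (u : P 0%N a), z a u = 0
  | m.+1 => fun z => exists y : nattrans (P m) G,
              forall a (u : P m.+1 a), z a u = y a (res_d P m a u)
  end.
End Ext.

(* Ext^n(F, G) = 0, where Ext^n(F, G) is the n-th cohomology group of
   Hom(P_*, G) for a projective resolution P_* of F.  As it does not depend on
   [P], the vanishing is stated for all [P]; such resolutions exist by
   [projective_resolution_exists] below.  The cohomology is not formed as an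
   [lmodType]: natural transformations between functors on a large (but
   essentially small) category live in a universe above that of modules. *)
Definition Ext_vanishes (k : fieldType) (A : precat) (F G : kfunctor k A)
    (n : nat) : Prop :=
  forall (P : projective_resolution F) (z : nattrans (P n) G),
    cocycle z -> coboundary z.

(** ** Tensor product over k[A] and Tor *)

Section Tensor.
Context (k : fieldType) (A : precat) (H : kfunctor k (opcat A)).

(* A dinatural family of linear maps [H x ⊗ K x -> T], given by the
   corresponding bilinear maps. *)
Definition balanced (K : kfunctor k A) (T : lmodType k)
    (b : forall x, H x -> K x -> T) : Prop :=
  (forall x, bilinear_for *:%R *:%R (b x)) /\
  (forall (x y : A) (f : hom x y) (h : H y) (v : K x),
     b x (@kmap k (opcat A) H y x f h) v = b y h (kmap K f v)).

(* The coend of [H x ⊗ K x], i.e. the universal such family. *)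
Record tensor (K : kfunctor k A) := Tensor {
  tensor_sort :> lmodType k;
  tensor_elt : forall x, H x -> K x -> tensor_sort;
  tensor_balanced : balanced tensor_elt;
  tensor_lift : forall (T : lmodType k) (b : forall x, H x -> K x -> T),
    balanced b -> {linear tensor_sort -> T};
  tensor_lift_elt : forall T b (bP : @balanced K T b) x h v,
    tensor_lift bP (@tensor_elt x h v) = b x h v;
  tensor_lift_uniq : forall T b (bP : @balanced K T b)
      (g : {linear tensor_sort -> T}),
    (forall x h v, g (@tensor_elt x h v) = b x h v) -> g =1 tensor_lift bP
}.

Lemma tensor_map_balanced (K L : kfunctor k A) (s : nattrans K L)
    (TL : tensor L) :
  @balanced K TL (fun x h v => tensor_elt TL h (s x v)).
Proof.
have [bl bb] := tensor_balanced TL; split=> [x|x y f h v].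
  split=> [v|h] a u w; first exact: (bl x).1.
  by rewrite linearP; apply: (bl x).2.
by rewrite bb natural.
Qed.

(* H ⊗ s *)
Definition tensor_map (K L : kfunctor k A) (s : nattrans K L)
    (TK : tensor K) (TL : tensor L) : {linear TK -> TL} :=
  tensor_lift TK (tensor_map_balanced s TL).
End Tensor.

Section Tor.
Context (k : fieldType) (A : precat).
Context (H : kfunctor k (opcat A)) (K : kfunctor k A).
Context (P : projective_resolution K) (T : forall n, tensor H (P n)).

Definition tor_d (n : nat) : {linear T n.+1 -> T n} :=
  tensor_map (res_d P n) (T n.+1) (T n).

Definition cycle (n : nat) : T n -> Prop :=
  match n return T n -> Prop with
  | 0%N => fun _ => True
  | m.+1 => fun t => tor_d m t = 0
  end.

Definition boundary (n : nat) (t : T n) : Prop :=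
  exists u : T n.+1, tor_d n u = t.
End Tor.

(* Tor_n(H, K) = 0, where Tor_n(H, K) is the n-th homology group of H ⊗ P_*
   for a projective resolution P_* of K; see [projective_resolution_exists] and
   [tensor_exists] below. *)
Definition Tor_vanishes (k : fieldType) (A : precat)
    (H : kfunctor k (opcat A)) (K : kfunctor k A) (n : nat) : Prop :=
  forall (P : projective_resolution K) (T : forall n, tensor H (P n))
    (t : T n), cycle t -> boundary t.

(** * Existence of projective resolutions and of tensor products *)

Lemma freegZU (k : fieldType) (X : choiceType) (c : k) (x : X) :
  << c *g x >> = c *: << x >> :> {freeg X / k}.
Proof. by apply/eqP/freeg_eqP => y; rewrite coeffZ !coeffU mul1r. Qed.

Section FreeModule.
Context (k : fieldType) (X : choiceType) (M : lmodType k) (f : X -> M).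

Lemma fglift_is_zmod_morphism : zmod_morphism (fglift f : {freeg X / k} -> M).
Proof. exact: lift_is_additive. Qed.
HB.instance Definition _ := GRing.isZmodMorphism.Build {freeg X / k} M
  (fglift f) fglift_is_zmod_morphism.

Lemma fglift_is_scalable : scalable (fglift f : {freeg X / k} -> M).
Proof.
move=> a D; change (fglift f (fgscale a D) = a *: fglift f D).
rewrite -[in RHS](freeg_sumE D) /fgscale !raddf_sum.
by apply: eq_bigr => x _; rewrite /= !liftU scalerA.
Qed.
HB.instance Definition _ := GRing.isScalable.Build k {freeg X / k} M *:%R
  (fglift f) fglift_is_scalable.

Definition flift : {linear {freeg X / k} -> M} := fglift f.

Lemma fliftE x : flift << x >> = f x.
Proof. by rewrite /flift /= liftU scale1r. Qed.
End FreeModule.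

Lemma free_ext (k : fieldType) (X : choiceType) (M : lmodType k)
    (f g : {linear {freeg X / k} -> M}) :
  (forall x, f << x >> = g << x >>) -> f =1 g.
Proof.
move=> fg D; rewrite -(freeg_sumE D) !raddf_sum; apply: eq_bigr => x _.
by rewrite freegZU /= !linearZ_LR /= fg.
Qed.

Section SmallCategory.
Context (k : fieldType) (A : precat) (S : Type) (r : S -> A).
Hypothesis rP : forall x : A, exists s : S, isomorphic (r s) x.

Definition rep (x : A) : S := projT1 (cid (rP x)).
Let rep_iso x : isomorphic (r (rep x)) x := projT2 (cid (rP x)).
Definition from_rep (x : A) : hom (r (rep x)) x := projT1 (cid (rep_iso x)).
Let from_repP x := projT2 (cid (rep_iso x)).
Definition to_rep (x : A) : hom x (r (rep x)) := projT1 (cid (from_repP x)).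

Lemma to_repK x : comp (from_rep x) (to_rep x) = idm x.
Proof. exact: (projT2 (cid (from_repP x))).2. Qed.

(** ** Standard projectives *)

Section Cover.
Context (F : kfunctor k A).

(* The direct sum, over [s : S] and [v : F (r s)], of the functors
   k[A(r s, -)]. *)
Definition cover_gen (y : A) : choiceType :=
  {classic {s : S & (hom (r s) y * F (r s))%type}}.
Definition cover_ob (y : A) : lmodType k := {freeg (cover_gen y) / k}.
Definition cgen y s (f : hom (r s) y) (v : F (r s)) : cover_gen y :=
  existT _ s (f, v).

Definition cover_map x y (f : hom x y) : {linear cover_ob x -> cover_ob y} :=
  flift (fun g : cover_gen x =>
    (<< cgen (comp f (projT2 g).1) (projT2 g).2 >> : cover_ob y)).

Lemma cover_map_id x (u : cover_ob x) : cover_map (idm x) u = u.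
Proof.
apply: (free_ext (f := cover_map (idm x)) (g := idfun)) => -[s [f v]].
by rewrite fliftE /= comp1m.
Qed.

Lemma cover_map_comp x y z (g : hom y z) (f : hom x y) (u : cover_ob x) :
  cover_map (comp g f) u = cover_map g (cover_map f u).
Proof.
apply: (free_ext (f := cover_map (comp g f))
                 (g := cover_map g \o cover_map f)) => -[s [h v]].
by rewrite /= !fliftE /= compA.
Qed.

Definition cover : kfunctor k A := KFunctor cover_map_id cover_map_comp.

Definition cover_aug_comp x : {linear cover x -> F x} :=
  flift (fun g : cover_gen x => kmap F (projT2 g).1 (projT2 g).2).

Lemma cover_aug_natural x y (f : hom x y) (u : cover x) :
  cover_aug_comp y (kmap cover f u) = kmap F f (cover_aug_comp x u).
Proof.
apply: (free_ext (f := cover_aug_comp y \o cover_map f)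
                 (g := kmap F f \o cover_aug_comp x)) => -[s [h v]].
by rewrite /= !fliftE /= kmap_comp.
Qed.

Definition cover_aug : nattrans cover F := NatTrans cover_aug_natural.

Lemma cover_aug_epi : nat_epi cover_aug.
Proof.
move=> x v; exists << cgen (from_rep x) (kmap F (to_rep x) v) >>.
by rewrite /= fliftE /= -kmap_comp to_repK kmap_id.
Qed.

Lemma cover_projective : projective_functor cover.
Proof.
move=> X Y p f pP.
have lft s (v : F (r s)) := cid (pP (r s) (f (r s) << cgen (idm (r s)) v >>)).
pose g x : {linear cover x -> X x} := flift (fun c : cover_gen x =>
  kmap X (projT2 c).1 (projT1 (lft (projT1 c) (projT2 c).2))).
have gN x y (h : hom x y) (u : cover x) : g y (kmap cover h u) = kmap X h (g x u).
  apply: (free_ext (f := g y \o cover_map h)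
                   (g := kmap X h \o g x)) => -[s [h' v]].
  by rewrite /= !fliftE /= kmap_comp.
exists (NatTrans gN) => x u.
apply: (free_ext (f := p x \o g x) (g := f x)) => -[s [h v]].
rewrite /= fliftE /= natural; case: (lft s v) => w /= ->.
by apply: etrans (esym (natural f h _)) _; rewrite /= fliftE /= compm1.
Qed.
End Cover.

Section Syzygy.
Context (F G : kfunctor k A) (p : nattrans F G).

Definition kernel_map x y (f : hom x y) (u : lkernel (p x)) : lkernel (p y).
Proof.
exists (kmap F f (val u)); rewrite unfold_in natural.
by have /eqP -> := valP u; rewrite linear0.
Defined.

Lemma kernel_map_is_linear x y (f : hom x y) : linear (kernel_map f).
Proof. by move=> a u v; apply: val_inj; rewrite /= !linearP. Qed.
HB.instance Definition _ x y (f : hom x y) := GRing.isLinear.Build k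
  (lkernel (p x)) (lkernel (p y)) *:%R (kernel_map f) (kernel_map_is_linear f).

Definition kernel_functor : kfunctor k A.
Proof.
refine (@KFunctor k A (fun x => lkernel (p x))
         (fun x y f => kernel_map f : {linear _ -> _}) _ _).
- by move=> x v; apply: val_inj; rewrite /= kmap_id.
- by move=> x y z g f v; apply: val_inj; rewrite /= kmap_comp.
Defined.

Definition kernel_incl : nattrans kernel_functor F.
Proof. by exists (fun x => (val : {linear lkernel (p x) -> F x})). Defined.

Lemma kernel_inclP x (u : F x) :
  p x u = 0 <-> exists w : kernel_functor x, kernel_incl x w = u.
Proof.
split=> [pu | [w <-]]; last by apply/eqP; apply: (valP w).
have uP : u \in lker_pred (p x) by rewrite unfold_in pu.
by exists (LKernel uP).
Qed.
End Syzygy.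

Definition nat_comp (F G H : kfunctor k A) (t : nattrans G H) (s : nattrans F G) :
  nattrans F H.
Proof.
exists (fun x => t x \o s x : {linear F x -> H x}).
by move=> x y f v /=; rewrite !natural.
Defined.

Definition syzygy (F : kfunctor k A) := kernel_functor (cover_aug F).
Definition syzygy_d (F : kfunctor k A) : nattrans (cover (syzygy F)) (cover F) :=
  nat_comp (kernel_incl (cover_aug F)) (cover_aug (syzygy F)).

Lemma syzygy_d_exact (F G : kfunctor k A) (i : nattrans F G) :
  (forall x, injective (i x)) ->
  nat_exact (syzygy_d F) (nat_comp i (cover_aug F)).
Proof.
move=> iI x y; rewrite (_ : _ = 0 <-> cover_aug F x y = 0); last first.
  by split=> [/= e | /= ->]; [apply: (iI x); rewrite e linear0 | rewrite linear0].
rewrite kernel_inclP; split=> [[w <-] | [u <-]]; last by exists (cover_aug _ x u).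
by have [u <-] := cover_aug_epi w; exists u.
Qed.

Definition standard_resolution (F : kfunctor k A) : projective_resolution F.
Proof.
refine (@ProjRes k A F (fun n => cover (iter n syzygy F))
         (fun n => syzygy_d (iter n syzygy F)) (cover_aug F) _ _ _ _).
- by move=> n; apply: cover_projective.
- exact: cover_aug_epi.
- move=> x y; pose i : nattrans F F :=
    @NatTrans k A F F (fun x => idfun : {linear F x -> F x}) (fun _ _ _ _ => erefl).
  exact: (@syzygy_d_exact F F i (fun _ => @inj_id _) x y).
- by move=> n; apply: syzygy_d_exact => x; apply: val_inj.
Defined.

(** ** Construction of the coend *)

Section Coend.
Context (H : kfunctor k (opcat A)) (K : kfunctor k A).

Definition coend_gen : choiceType :=
  {classic {s : S & (H (r s) * K (r s))%type}}.
Definition coend_free : lmodType k := {freeg coend_gen / k}.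
Definition tgen s (h : H (r s)) (v : K (r s)) : coend_gen := existT _ s (h, v).

(* [balanced], restricted to the representatives [r s]. *)
Definition good (T : lmodType k) (b : forall s, H (r s) -> K (r s) -> T) : Prop :=
  (forall s, bilinear_for *:%R *:%R (b s)) /\
  (forall s t (f : hom (r s) (r t)) (h : H (r t)) (v : K (r s)),
     b s (@kmap k (opcat A) H _ _ f h) v = b t h (kmap K f v)).

Definition glift (T : lmodType k) (b : forall s, H (r s) -> K (r s) -> T) :
    {linear coend_free -> T} :=
  flift (fun g : coend_gen => b (projT1 g) (projT2 g).1 (projT2 g).2).

(* The relations are those satisfied by every balanced family. *)
Definition coend_rel : {pred coend_free} := fun u =>
  `[< forall T b, @good T b -> glift b u = 0 >].

Lemma coend_rel_submod_closed : submod_closed coend_rel.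
Proof.
split=> [|a u v]; rewrite !unfold_in; first by apply/asboolP => *; rewrite linear0.
move=> /asboolP uP /asboolP vP; apply/asboolP => T b bP.
by rewrite linearP (uP _ _ bP) (vP _ _ bP) scaler0 addr0.
Qed.
HB.instance Definition _ := GRing.isSubmodClosed.Build k coend_free
  coend_rel coend_rel_submod_closed.

Definition coend_ob : lmodType k := lquot coend_rel.
Definition selt s (h : H (r s)) (v : K (r s)) : coend_ob :=
  lquot_pi coend_rel << tgen h v >>.

Lemma selt_good : good selt.
Proof.
have pi_eq u v : (forall T b, @good T b -> glift b u = glift b v) ->
    lquot_pi coend_rel u = lquot_pi coend_rel v.
  move=> e; apply/lquot_piP; rewrite unfold_in; apply/asboolP => T b bP.
  by rewrite raddfB /= (e _ _ bP) subrr.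
split=> [s|s t f h v].
  split=> [v|h] a u w; rewrite /selt -linearP; apply: pi_eq => T b [bl _];
  rewrite linearP !fliftE /=; [exact: (bl s).1 | exact: (bl s).2].
by apply: pi_eq => T b [_ bb]; rewrite !fliftE; apply: bb.
Qed.

Lemma good_restr (T : lmodType k) (b : forall x, H x -> K x -> T) :
  balanced b -> good (fun s => b (r s)).
Proof. by move=> [bl bb]; split=> [s|s t f h v]; [apply: bl | apply: bb]. Qed.

Section Lift.
Context (T : lmodType k) (b : forall s, H (r s) -> K (r s) -> T).
Implicit Type bP : good b.

Definition coend_lift_fun (_ : good b) (q : coend_ob) : T :=
  glift b (repr (q : Quotient.quot (lquot_pred coend_rel))).

Lemma coend_lift_pi bP u : coend_lift_fun bP (lquot_pi coend_rel u) = glift b u.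
Proof.
apply/eqP; rewrite -subr_eq0 -raddfB; apply/eqP.
suff : repr (lquot_pi coend_rel u : Quotient.quot (lquot_pred coend_rel)) - u
         \in coend_rel by rewrite unfold_in => /asboolP /(_ _ _ bP).
by apply/lquot_piP; rewrite {1}/lquot_pi reprK.
Qed.

Lemma coend_lift_is_linear bP : linear (coend_lift_fun bP).
Proof.
move=> a p q; have [u <-] := lquot_pi_surj p; have [v <-] := lquot_pi_surj q.
by rewrite -linearP !coend_lift_pi linearP.
Qed.
HB.instance Definition _ bP := GRing.isLinear.Build k coend_ob T *:%R
  (coend_lift_fun bP) (coend_lift_is_linear bP).
End Lift.

Definition coend_elt x (h : H x) (v : K x) : coend_ob :=
  selt (@kmap k (opcat A) H x (r (rep x)) (from_rep x) h) (kmap K (to_rep x) v).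

Lemma coend_elt_balanced : @balanced k A H K coend_ob coend_elt.
Proof.
have [sl sb] := selt_good; split=> [x|x y f h v].
  by split=> [v|h] a u w; rewrite /coend_elt linearP;
    [apply: (sl _).1 | apply: (sl _).2].
pose g := comp (to_rep y) (comp f (from_rep x)).
rewrite /coend_elt.
have -> : @kmap k (opcat A) H _ _ (from_rep x) (@kmap k (opcat A) H _ _ f h)
        = @kmap k (opcat A) H _ _ g (@kmap k (opcat A) H _ _ (from_rep y) h).
  rewrite -!(@kmap_comp k (opcat A) H) /=; congr (kmap H _ _).
  by rewrite /g compA to_repK comp1m.
rewrite sb -!kmap_comp; congr (selt _ (kmap K _ _)).
by rewrite /g -!compA to_repK compm1.
Qed.

Definition standard_tensor : tensor H K.
Proof.
refine (@Tensor k A H K coend_ob coend_elt coend_elt_balanced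
  (fun T b bP => coend_lift_fun (good_restr bP) : {linear coend_ob -> T}) _ _).
- move=> T b [bl bb] x h v /=.
  rewrite coend_lift_pi fliftE /= bb -!kmap_comp.
  by rewrite to_repK kmap_id.
- move=> T b [bl bb] g gP q /=.
  have [u <-] := lquot_pi_surj q; rewrite coend_lift_pi.
  apply: (free_ext (f := g \o lquot_pi coend_rel)) => -[s [h v]].
  rewrite fliftE /= -gP; congr (g _).
  have [sl sb] := selt_good; rewrite /coend_elt sb -!kmap_comp.
  by rewrite to_repK kmap_id.
Defined.
End Coend.
End SmallCategory.

Lemma projective_resolution_exists (k : fieldType) (A : precat) :
  small_category A -> forall F : kfunctor k A, inhabited (projective_resolution F).
Proof. by move=> [S [r rP]] F; exact: inhabits (standard_resolution rP F). Qed.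

Lemma tensor_exists (k : fieldType) (A : precat) :
  small_category A ->
  forall (H : kfunctor k (opcat A)) (K : kfunctor k A), inhabited (tensor H K).
Proof. by move=> [S [r rP]] H K; exact: inhabits (standard_tensor rP H K). Qed.

(* Main.v *)
From HB Require Import structures.
From mathcomp Require Import all_boot all_algebra boolp.
From mathcomp Require classical_sets.
From mathcomp Require Import finmap freeg zify ring.
Require Import Defs.
Import GRing.Theory.

Set Implicit Arguments.
Unset Strict Implicit.
Unset Printing Implicit Defensive.

Local Open Scope ring_scope.

(** Write [B] for the category of finitely generated projective modules over the
    finite semisimple ring.  Its hom groups are finite and killed by some positive
    integer [N], each morphism [f] has a [g] with [f g f = f], and idempotents
    split ([projcat_regular_finite], [projcat_torsion]).

    In characteristic zero these properties make the category of all functors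
    from [B] to vector spaces semisimple, in the sense that pointwise surjective
    and pointwise injective transformations split ([nat_section],
    [nat_retraction]).  This rests on a theorem of Kovacs: in the algebra
    [k[hom u u]] the ideal spanned by the non-invertible endomorphisms has an
    identity element ([cosingular_exists]).  A functor is therefore a direct sum
    of pieces, one for each isomorphism class of objects [u], and a linear map
    given at [u] can be averaged over the automorphisms of [u] and extended to a
    natural transformation between the pieces of [u] ([component]).

    Since [F'] is a quotient of a direct sum of functors [k[hom V x]], it is a
    retract of it; dually [G] is a retract of a product of functors sending [x]
    to the space of all functions from [hom x U] to some [M].  Pulled back along
    [pi], these become [k[H]] and [x |-> Map(T x, M)] for additive functors
    [H = hom V (pi x)] and [T = hom (pi x) U] on the category [A], where [T] is
    [N]-torsion.

    The covariant functor [H] has a simplicial resolution [bar r H n] by direct sums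
    of functors [hom z x] in [A].  Linearized, it is a projective resolution of
    [k[H]] ([bar_resolution]); projectivity holds although infinite direct sums
    are linearized, by a cross effect argument ([induced_lift]).  Cochains on it
    with values in [Map(T x, M)] are the functions from the simplicial abelian
    group [bar r H n T], the tensor product of the resolution with [T] over [A],
    to [M] ([cochain_descent]).  This group is [N]-torsion and [N] is invertible in
    [k], so its linearization is acyclic in positive degrees ([bar_acyclic]), and
    every cocycle of positive degree is a coboundary ([bar_coboundary]).

    Tor is deduced from Ext by duality ([Tor_vanishes_Ext]): homology classes of
    degree [n] are detected by a cocycle with values in the pullback of the functor
    [x |-> Hom(F x, M)], where [M] is the term of degree [n] of the complex that
    computes Tor, modulo boundaries. *)

(** * Linear algebra over a field *)

Definition mklinear (k : pzRingType) (U V : lmodType k) (f : U -> V)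
    (fP : linear f) : {linear U -> V} :=
  HB.pack f (GRing.isLinear.Build k U V *:%R f fP).

Section LinearExtension.
Context (k : fieldType) (U V M : lmodType k).
Context (g : {linear U -> V}) (phi : {linear U -> M}).
Hypothesis kerP : forall u, g u = 0 -> phi u = 0.

(** A partial linear map is encoded by its graph. *)
Let lin_graph (E : classical_sets.set (V * M)) :=
  [/\ forall u, E (g u, phi u),
      forall a p q, E p -> E q -> E (a *: p.1 + q.1, a *: p.2 + q.2) &
      forall m, E (0, m) -> m = 0].

(** The forced values [(g u, phi u)] are added to [E] afterwards, because Zorn's
    lemma for unions also takes the union of the empty chain. *)
Let P (E : classical_sets.set (V * M)) :=
  lin_graph (fun p => E p \/ exists u, p = (g u, phi u)).

(** Zorn's lemma, for graphs of partial linear maps that contain the forced values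
    [g u |-> phi u]. *)
Lemma lin_factor : exists psi : {linear V -> M}, forall u, psi (g u) = phi u.
Proof.
have basic : lin_graph (fun p => exists u, p = (g u, phi u)).
  split=> [u|a p q [u ->] [v ->]|m [u [gu ->]]]; first by exists u.
    by exists (a *: u + v); rewrite !linearP.
  by apply: kerP; rewrite -gu.
have [F FP Ftot|E [[E0 E1 E2] Emax]] := @classical_sets.Zorn_bigcup _ P.
  split=> [u|a p q|m]; first by right; exists u.
  - move=> [[X FX Xp]|[u ->]] [[Y FY Yq]|[v ->]].
    + have [XY|YX] := Ftot _ _ FX FY.
        have [_ l _] := FP _ FY.
        have [|?] := l a p q (or_introl (XY _ Xp)) (or_introl Yq); last by right.
        by left; exists Y.
      have [_ l _] := FP _ FX.
      have [|?] := l a p q (or_introl Xp) (or_introl (YX _ Yq)); last by right.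
      by left; exists X.
    + have [_ l _] := FP _ FX.
      have [||?] := l a p (g v, phi v) (or_introl Xp); [by right; exists v| |by right].
      by left; exists X.
    + have [_ l _] := FP _ FY.
      have [|||?] := l a (g u, phi u) q; [by right; exists u|by left| |by right].
      by left; exists Y.
    + by right; exists (a *: u + v); rewrite !linearP.
  - move=> [[X FX Xm]|[u [gu ->]]]; last by apply: kerP; rewrite -gu.
    by have [_ _ l] := FP _ FX; apply: l; left.
pose E' p := E p \/ exists u, p = (g u, phi u).
have E's a p q : E' p -> E' q -> E' (a *: p.1 + q.1, a *: p.2 + q.2) by apply: E1.
have E'0 : E' (0, 0).
  by have := E0 0; rewrite !linear0.
(* Otherwise the graph extends to the line of [v] by sending [v] to 0. *)
have tot v : exists m, E' (v, m).
  apply: contrapT => nv.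
  pose D := fun p : V * M => exists a q, E' q /\ p = (a *: v + q.1, q.2).
  have ED p : E' p -> D p by move=> Ep; exists 0, p; rewrite scale0r add0r; case: p Ep.
  apply: (Emax D).
    split; first by move=> p Ep; apply: ED; left.
    move=> DE; apply: nv; exists 0; left; apply: DE; exists 1, (0, 0).
    by rewrite scale1r addr0.
  split=> [u|a p q pD qD|m mD].
  - by right; exists u.
  - left; have {}pD : D p by case: pD => // pu; apply: ED; right.
    have {}qD : D q by case: qD => // qu; apply: ED; right.
    move: pD qD => [b [p' [Ep ->]]] [c [q' [Eq ->]]].
    exists (a * b + c), (a *: p'.1 + q'.1, a *: p'.2 + q'.2); split; first exact: E's.
    by rewrite /= scalerDr scalerDl scalerA addrACA.
  - have {mD}[b [[p' m'] [Ep [/esym /= e ->]]]] : D (0, m).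
      by case: mD => // mu; apply: ED; right.
    have [b0|b0] := eqVneq b 0.
      by move: e; rewrite b0 scale0r add0r => p0; apply: E2; rewrite -p0.
    case: nv; exists (- b^-1 *: m').
    have := E's (- b^-1) _ _ Ep E'0; rewrite /= !addr0.
    suff -> : - b^-1 *: p' = v by [].
    move/eqP: e; rewrite addrC addr_eq0 => /eqP ->.
    by rewrite scalerN scaleNr opprK scalerA mulVf // scale1r.
have uniq v m m' : E' (v, m) -> E' (v, m') -> m = m'.
  move=> Em Em'; have /= := E's (-1) _ _ Em Em'.
  by rewrite !scaleN1r addNr => /E2/eqP; rewrite addrC subr_eq0 => /eqP.
pose psi v := projT1 (cid (tot v)).
have psiP v : E' (v, psi v) := projT2 (cid (tot v)).
have psil : linear psi.
  by move=> a u v; apply: (uniq (a *: u + v)) => //; apply: (E's a (u, psi u) (v, psi v)).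
exists (mklinear psil) => u; apply: (uniq (g u)); first exact: psiP.
exact: E0.
Qed.
End LinearExtension.

Lemma lin_retraction (k : fieldType) (U V : lmodType k) (i : {linear U -> V}) :
  injective i -> exists r : {linear V -> U}, forall u, r (i u) = u.
Proof.
move=> iI; apply: (lin_factor (phi := idfun)) => u /= iu.
by apply: iI; rewrite iu linear0.
Qed.

(** Subtract from a preimage its component in the kernel of [p], which is a direct
    summand.  The result does not depend on the preimage. *)
Lemma lin_section (k : fieldType) (U V : lmodType k) (p : {linear U -> V}) :
  (forall v, exists u, p u = v) -> exists s : {linear V -> U}, forall v, p (s v) = v.
Proof.
move=> pS; pose io : {linear lkernel p -> U} := val.
have [r rK] := lin_retraction (i := io) val_inj.
pose q u : U := u - io (r u).
have qp u v : p u = p v -> q u = q v.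
  move=> e; have kuv : u - v \in lker_pred p by rewrite unfold_in linearB e subrr.
  have /(congr1 io) : r (u - v) = LKernel kuv := rK (LKernel kuv).
  rewrite linearB linearB -[RHS]/(u - v) /q => /eqP; rewrite subr_eq => /eqP ->.
  by rewrite opprD opprB addrA [u + (v - u)]addrC subrK.
have pq u : p (q u) = p u.
  by rewrite linearB; have /eqP -> := valP (r u); rewrite subr0.
pose s v := q (projT1 (cid (pS v))).
have sE u v : p u = v -> s v = q u.
  by move=> <-; apply: qp; apply: projT2 (cid (pS (p u))).
have sl : linear s.
  move=> a u v; have [[x <-] [y <-]] := (pS u, pS v).
  rewrite (sE _ _ (erefl (p x))) (sE _ _ (erefl (p y))) -linearP (sE _ _ erefl).
  by rewrite /q (linearP r) (linearP io) scalerBr opprD addrACA.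
exists (mklinear sl) => v /=; have [u <-] := pS v.
by rewrite (sE _ _ erefl) pq.
Qed.

(** * Comparison of projective resolutions *)

Section NatTransOps.
Context (k : fieldType) (A : precat).
Implicit Types F G H : kfunctor k A.

Definition nat_id F : nattrans F F :=
  @NatTrans k A F F (fun x => idfun : {linear F x -> F x}) (fun _ _ _ _ => erefl).

Definition nat_sub F G (s t : nattrans F G) : nattrans F G.
Proof.
exists (fun x => s x \- t x : {linear F x -> G x}) => x y f v /=.
by rewrite !natural linearB.
Defined.

End NatTransOps.

Section ChainMaps.
Context (k : fieldType) (A : precat).
Implicit Types F : kfunctor k A.

(** In degree 0 the augmentation takes the place of the differential. *)
Definition is_cycle F (P : projective_resolution F) n a : P n a -> Prop :=
  match n return P n a -> Prop with
  | 0%N => fun v => res_aug P a v = 0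
  | m.+1 => fun v => res_d P m a v = 0
  end.

Lemma is_cycleP F (P : projective_resolution F) n a (v : P n a) :
  is_cycle v <-> exists w, res_d P n a w = v.
Proof. by case: n v => [|n] v; [apply: res_exact0 | apply: res_exact]. Qed.

(** By exactness the differential from [P n.+1] is an epimorphism onto the kernel
    of the next one, so the projectivity of [X] applies. *)
Lemma lift_cycle F (P : projective_resolution F) n (X : kfunctor k A)
    (f : nattrans X (P n)) :
  projective_functor X -> (forall a u, is_cycle (f a u)) ->
  exists g : nattrans X (P n.+1), forall a u, res_d P n a (g a u) = f a u.
Proof.
move=> XP fc.
have [Y [t tP]] : exists Y, exists t : nattrans (P n) Y,
    forall a (v : P n a), t a v = 0 <-> is_cycle v.
  case: n f fc => [|n] f fc; first by exists F, (res_aug P).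
  by exists (P n), (res_d P n).
have dt a u : t a (res_d P n a u) = 0 by apply/tP/is_cycleP; exists u.
pose K := kernel_functor t.
have toK (Z : kfunctor k A) (h : nattrans Z (P n)) : (forall a u, t a (h a u) = 0) ->
    exists h' : nattrans Z K, forall a u, kernel_incl t a (h' a u) = h a u.
  move=> th.
  have hk a (u : Z a) : h a u \in lker_pred (t a) by rewrite unfold_in th.
  pose h' a u : K a := LKernel (hk a u).
  have h'l a : linear (h' a) by move=> c u v; apply: val_inj; rewrite /= linearP.
  have h'n a b (f0 : hom a b) u : mklinear (h'l b) (kmap Z f0 u)
      = kmap K f0 (mklinear (h'l a) u).
    by apply: val_inj; rewrite /= natural.
  by exists (NatTrans h'n).
have [d' d'E] := toK _ (res_d P n) dt.
have [|f' f'E] := toK _ f; first by move=> a u; apply/tP; apply: fc.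
have [a v|g gE] := XP _ _ d' f'.
  have /tP/is_cycleP [u uv] : t a (kernel_incl t a v) = 0.
    by apply/kernel_inclP; exists v.
  by exists u; apply: val_inj; rewrite -[LHS]/(kernel_incl t a (d' a u)) d'E uv.
by exists g => a u; rewrite -d'E gE f'E.
Qed.

(** [Q] is an invariant that makes the next step possible. *)
Lemma dep_choice (T : nat -> Type) (Q : forall n, T n -> Prop)
    (R : forall n, T n -> T n.+1 -> Prop) (x0 : T 0%N) :
  Q 0%N x0 -> (forall n x, Q n x -> exists y, R n x y /\ Q n.+1 y) ->
  exists f : forall n, T n, f 0%N = x0 /\ forall n, R n (f n) (f n.+1).
Proof.
move=> Q0 step.
pose st n (x : {x : T n | Q n x}) := cid (step n (projT1 x) (projT2 x)).
pose g := fix g n : {x : T n | Q n x} := match n with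
  | 0%N => exist (Q 0%N) x0 Q0
  | m.+1 => exist (Q m.+1) (projT1 (st m (g m))) (projT2 (st m (g m))).2
  end.
exists (fun n => projT1 (g n)); split=> // n /=.
exact: (projT2 (st n (g n))).1.
Qed.

Lemma chain_map F F' (P : projective_resolution F) (R : projective_resolution F')
    (t : nattrans F F') :
  exists s : forall n, nattrans (P n) (R n),
    (forall a u, res_aug R a (s 0%N a u) = t a (res_aug P a u)) /\
    forall n a u, res_d R n a (s n.+1 a u) = s n a (res_d P n a u).
Proof.
have [s0 s0E] := res_proj (nat_comp t (res_aug P)) (@res_epi _ _ _ R).
have dd n a u : is_cycle (res_d P n a u) by apply/is_cycleP; exists u.
pose Q n (s : nattrans (P n) (R n)) := forall a u, is_cycle (s a (res_d P n a u)).
have [|n s sQ|s [s0' sE]] := @dep_choice (fun n => nattrans (P n) (R n)) Q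
  (fun n s s' => forall a u, res_d R n a (s' a u) = s a (res_d P n a u)) s0.
- by move=> a u; rewrite /= s0E /= (dd 0%N a u) linear0.
- have [s' s'E] := lift_cycle (f := nat_comp s (res_d P n)) (@res_proj _ _ _ P n.+1) sQ.
  by exists s'; split=> // a u; rewrite /= s'E /= (dd n.+1 a u) linear0.
by exists s; split=> // a u; rewrite s0' s0E.
Qed.

Lemma chain_homotopy F (P : projective_resolution F)
    (s : forall n, nattrans (P n) (P n)) :
  (forall a u, res_aug P a (s 0%N a u) = res_aug P a u) ->
  (forall n a u, res_d P n a (s n.+1 a u) = s n a (res_d P n a u)) ->
  exists h : forall n, nattrans (P n) (P n.+1), forall n a u,
    res_d P n.+1 a (h n.+1 a u) + h n a (res_d P n a u) = s n.+1 a u - u.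
Proof.
move=> s0 sE.
have dd n a u : is_cycle (res_d P n a u) by apply/is_cycleP; exists u.
have [a u|h0 h0E] := lift_cycle (f := nat_sub (s 0%N) (nat_id _)) (@res_proj _ _ _ P 0%N).
  by rewrite /= linearB /= s0 subrr.
pose Q n (h : nattrans (P n) (P n.+1)) := forall a u,
  res_d P n a (h a (res_d P n a u)) = s n a (res_d P n a u) - res_d P n a u.
have [|n h hQ|h [_ hE]] := @dep_choice (fun n => nattrans (P n) (P n.+1)) Q
  (fun n h h' => forall a u,
     res_d P n.+1 a (h' a u) + h a (res_d P n a u) = s n.+1 a u - u) h0.
- by move=> a u; rewrite h0E.
- pose f := nat_sub (nat_sub (s n.+1) (nat_id _)) (nat_comp h (res_d P n)).
  have [a u|h' h'E] := lift_cycle (f := f) (@res_proj _ _ _ P n.+1).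
    by rewrite /= !linearB /= sE hQ subrr.
  exists h'; split=> a u; first by rewrite h'E /= subrK.
  by rewrite h'E /= (dd n.+1 a u) linear0 subr0.
by exists h.
Qed.

(** Two resolutions are related by chain maps lifting the retraction, and the
    composite endomorphism is homotopic to the identity. *)
Lemma Ext_vanishes_retract F F' G (i : nattrans F F') (r : nattrans F' F)
    (R : projective_resolution F') n :
  (forall a u, r a (i a u) = u) ->
  (forall z : nattrans (R n.+1) G, cocycle z -> coboundary z) ->
  Ext_vanishes F G n.+1.
Proof.
move=> ri Rv P z zc.
have [s [s0 sE]] := chain_map P R i; have [t [t0 tE]] := chain_map R P r.
have [||h hE] := @chain_homotopy F P (fun m => nat_comp (t m) (s m)).
- by move=> a u; rewrite /= t0 s0 ri.
- by move=> m a u; rewrite /= tE sE.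
have [|y yE] := Rv (nat_comp z (t n.+1)).
  by move=> a u; rewrite /= -tE zc.
exists (nat_sub (nat_comp y (s n)) (nat_comp z (h n))) => a u /=.
rewrite -sE -yE /=.
have /= := hE n a u => /eqP; rewrite eq_sym subr_eq => /eqP ->.
by rewrite !linearD /= zc add0r addrAC subrr add0r.
Qed.
End ChainMaps.

(** * Direct sums of abelian groups *)

Notation addmorph f := {morph f : x y / x + y}.

Section Additive.
Context (U V : zmodType) (f : U -> V).
Hypothesis fD : addmorph f.

Lemma addmorph0 : f 0 = 0.
Proof. by apply: (addrI (f 0)); rewrite -fD !addr0. Qed.

Lemma addmorphN x : f (- x) = - f x.
Proof. by apply/eqP; rewrite -addr_eq0 -fD addNr addmorph0. Qed.

Lemma addmorphB x y : f (x - y) = f x - f y.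
Proof. by rewrite fD addmorphN. Qed.

Lemma addmorph_sum (I : Type) (s : seq I) (F : I -> U) :
  f (\sum_(i <- s) F i) = \sum_(i <- s) f (F i).
Proof. exact: (big_morph f fD addmorph0). Qed.
End Additive.

Section AdditiveComposition.
Context (B : precat).

Lemma comp0m (u v w : B) (f : hom u v) : comp (0 : hom v w) f = 0.
Proof. exact: (addmorph0 (fun g g' => compDl g g' f)). Qed.
Lemma compm0 (u v w : B) (f : hom v w) : comp f (0 : hom u v) = 0.
Proof. exact: (addmorph0 (compDr f)). Qed.
Lemma compBl (u v w : B) (g g' : hom v w) (f : hom u v) :
  comp (g - g') f = comp g f - comp g' f.
Proof. exact: (addmorphB (fun g g' => compDl g g' f)). Qed.
Lemma compBr (u v w : B) (g : hom v w) (f f' : hom u v) :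
  comp g (f - f') = comp g f - comp g f'.
Proof. exact: (addmorphB (compDr g)). Qed.
End AdditiveComposition.

(** Both sequences contain the support of [F], and only this part contributes. *)
Lemma big_support (V : zmodType) (I : eqType) (s t : seq I) (F : I -> V) :
  uniq s -> uniq t ->
  (forall i, i \notin s -> F i = 0) -> (forall i, i \notin t -> F i = 0) ->
  \sum_(i <- s) F i = \sum_(i <- t) F i.
Proof.
have half (u v : seq I) : (forall i, i \notin v -> F i = 0) ->
    \sum_(i <- u) F i = \sum_(i <- [seq i <- u | i \in v]) F i.
  by move=> Fv; rewrite big_filter [RHS]big_mkcond; apply: eq_bigr => i _;
    case: ifP => // /negbT /Fv.
move=> su tu Fs Ft; rewrite (half s t Ft) (half t s Fs); apply: perm_big.
by apply: uniq_perm; rewrite ?filter_uniq // => i; rewrite !mem_filter andbC.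
Qed.

Section DirectSum.
Context (I : choiceType) (M : I -> zmodType).

(** The support is only asserted to exist, so that elements with the same values
    are equal. *)
Record dsum := DSum {
  dval :> forall i, M i;
  dfin : exists s : seq I, forall i, i \notin s -> dval i = 0
}.

Lemma dsumP (x y : dsum) : (forall i, x i = y i) -> x = y.
Proof.
case: x y => [x xf] [y yf] /= xy; have e : x = y by apply: functional_extensionality_dep.
by subst y; congr DSum; apply: Prop_irrelevance.
Qed.

Lemma dsum0_fin : exists s : seq I, forall i, i \notin s -> (0 : M i) = 0.
Proof. by exists [::]. Qed.
Lemma dsumD_fin (x y : dsum) :
  exists s : seq I, forall i, i \notin s -> x i + y i = 0.
Proof.
have [[s xs] [t yt]] := (dfin x, dfin y); exists (s ++ t) => i.
by rewrite mem_cat negb_or => /andP[/xs -> /yt ->]; rewrite addr0.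
Qed.
Lemma dsumN_fin (x : dsum) : exists s : seq I, forall i, i \notin s -> - x i = 0.
Proof. by have [s xs] := dfin x; exists s => i /xs ->; rewrite oppr0. Qed.

Definition dsum0 := DSum dsum0_fin.
Definition dsumD x y := DSum (dsumD_fin x y).
Definition dsumN x := DSum (dsumN_fin x).

Lemma dsumDA : associative dsumD.
Proof. by move=> x y z; apply: dsumP => i /=; rewrite addrA. Qed.
Lemma dsumDC : commutative dsumD.
Proof. by move=> x y; apply: dsumP => i /=; rewrite addrC. Qed.
Lemma dsum0D : left_id dsum0 dsumD.
Proof. by move=> x; apply: dsumP => i /=; rewrite add0r. Qed.
Lemma dsumND : left_inverse dsum0 dsumN dsumD.
Proof. by move=> x; apply: dsumP => i /=; rewrite addNr. Qed.

HB.instance Definition _ := gen_eqMixin dsum.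
HB.instance Definition _ := gen_choiceMixin dsum.
HB.instance Definition _ :=
  GRing.isZmodule.Build dsum dsumDA dsumDC dsum0D dsumND.

Lemma dval_sum (J : Type) (s : seq J) (F : J -> dsum) i :
  (\sum_(j <- s) F j) i = \sum_(j <- s) F j i.
Proof. exact: (@addmorph_sum _ _ (fun x : dsum => x i)). Qed.

(** Some finite sequence that contains the support. *)
Definition dsupp (x : dsum) : seq I := undup (projT1 (cid (dfin x))).

Lemma dsupp_uniq x : uniq (dsupp x). Proof. exact: undup_uniq. Qed.
Lemma dsuppP x i : i \notin dsupp x -> x i = 0.
Proof. by rewrite mem_undup; apply: (projT2 (cid (dfin x))). Qed.

Definition dinc_val i (m : M i) j : M j :=
  match pselect (i = j) with
  | left e => eq_rect i (fun j => M j) m j e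
  | right _ => 0
  end.
Lemma dinc_fin i (m : M i) :
  exists s : seq I, forall j, j \notin s -> dinc_val m j = 0.
Proof.
exists [:: i] => j; rewrite inE /dinc_val; case: pselect => // e.
by case/eqP; rewrite e.
Qed.
Definition dinc i (m : M i) : dsum := DSum (dinc_fin m).

Lemma dinc_same i (m : M i) : dinc m i = m.
Proof.
rewrite /= /dinc_val; case: pselect => // e.
by rewrite (Prop_irrelevance e erefl).
Qed.
Lemma dinc_other i j (m : M i) : i <> j -> dinc m j = 0.
Proof. by rewrite /= /dinc_val; case: pselect. Qed.

Lemma dincD i : addmorph (@dinc i).
Proof.
move=> m n; apply: dsumP => j; rewrite -[RHS]/(dinc m j + dinc n j).
have [<-|ij] := pselect (i = j); first by rewrite !dinc_same.
by rewrite !dinc_other // addr0.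
Qed.

Lemma dsumE (s : seq I) (x : dsum) : uniq s -> (forall i, i \notin s -> x i = 0) ->
  x = \sum_(i <- s) dinc (x i).
Proof.
move=> su xs; apply: dsumP => j; rewrite dval_sum.
have [js|js] := boolP (j \in s).
  rewrite (bigD1_seq j) //= -[dinc_val _ _]/(dinc (x j) j) dinc_same big1 ?addr0 //.
  by move=> i /eqP ij; apply: dinc_other.
rewrite xs // big_seq big1 // => i si; apply: dinc_other => ij.
by move: js; rewrite -ij si.
Qed.

Lemma dsum_supp x : x = \sum_(i <- dsupp x) dinc (x i).
Proof. exact: dsumE (dsupp_uniq x) (@dsuppP x). Qed.

Lemma dsum_ext (V : zmodType) (f g : dsum -> V) : addmorph f -> addmorph g ->
  (forall i (m : M i), f (dinc m) = g (dinc m)) -> f =1 g.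
Proof.
move=> fD gD fg x; rewrite (dsum_supp x) !addmorph_sum //.
by apply: eq_bigr => i _; apply: fg.
Qed.

Section Lift.
Context (V : zmodType) (f : forall i, M i -> V).
Hypothesis fD : forall i, addmorph (@f i).

Definition dlift (x : dsum) : V := \sum_(i <- dsupp x) f (x i).

Lemma dlift_seq (s : seq I) (x : dsum) : uniq s -> (forall i, i \notin s -> x i = 0) ->
  dlift x = \sum_(i <- s) f (x i).
Proof.
move=> su xs; apply: big_support => // [|i /dsuppP ->|i /xs ->];
  by rewrite ?dsupp_uniq ?(addmorph0 (@fD _)).
Qed.

Lemma dliftD : addmorph dlift.
Proof.
move=> x y; pose s := undup (dsupp x ++ dsupp y).
have su : uniq s by apply: undup_uniq.
have sP i : i \notin s -> x i = 0 /\ y i = 0.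
  by rewrite mem_undup mem_cat negb_or => /andP[/dsuppP -> /dsuppP ->].
rewrite (@dlift_seq s x) // => [|i /sP[]] //; rewrite (@dlift_seq s y) // => [|i /sP[]] //.
rewrite (@dlift_seq s (x + y)) // => [|i /sP[/= -> ->]]; last by rewrite addr0.
by rewrite -big_split /=; apply: eq_bigr => i _; rewrite -fD.
Qed.

Lemma dlift_inc i (m : M i) : dlift (dinc m) = f m.
Proof.
rewrite (@dlift_seq [:: i]) ?big_seq1 ?dinc_same // => j.
by rewrite inE => /eqP ij; apply: dinc_other => e; apply: ij.
Qed.
End Lift.
End DirectSum.

Lemma dinc_map (I : choiceType) (M N : I -> zmodType) (h : forall i, M i -> N i) i m j :
  (forall i, h i 0 = 0) -> h j (@dinc I M i m j) = @dinc I N i (h i m) j.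
Proof.
move=> h0; have [<-|ij] := pselect (i = j); first by rewrite !dinc_same.
by rewrite !dinc_other.
Qed.

(** * A simplicial resolution of additive functors *)

(** Additive functors to abelian groups. *)
Record addfun (A : precat) := AddFun {
  aob :> A -> zmodType;
  amap : forall x y, hom x y -> aob x -> aob y;
  amapDr : forall x y (f : hom x y), addmorph (@amap x y f);
  amapDl : forall x y (u : aob x), addmorph (fun f : hom x y => amap f u);
  amap_id : forall x (u : aob x), amap (idm x) u = u;
  amap_comp : forall x y z (g : hom y z) (f : hom x y) (u : aob x),
    amap (comp g f) u = amap g (amap f u)
}.

(** The contravariant functor represented by [z]. *)
Definition yo (A : precat) (z : A) : addfun (opcat A).
Proof.
refine (@AddFun (opcat A) (fun x => @hom A x z)
  (fun x y f g => @comp A y x z g f) _ _ _ _).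
- by move=> x y f u v; rewrite compDl.
- by move=> x y u f g; rewrite compDr.
- by move=> x u; rewrite compm1.
- by move=> x y w g f u; rewrite /= compA.
Defined.

Section Comonad.
Context (A : precat) (S : Type) (r : S -> A).
Implicit Types (J : S -> zmodType) (D : addfun (opcat A)).

Definition idx J : choiceType := {classic {s : S & J s}}.
Definition mkidx J s (j : J s) : idx J := existT _ s j.
(** The direct sum over all [s] and [j : J s] of the groups [D (r s)].  For
    [D = yo z] this is the direct sum of the groups [hom (r s) z], a covariant
    functor of [z]; in general it is the tensor product of this functor with [D]
    over [A]. *)
Definition induced J D : zmodType :=
  dsum (fun i : idx J => D (r (projT1 i)) : zmodType).
Definition gen J D s (j : J s) (t : D (r s)) : induced J D :=
  @dinc (idx J) (fun i => D (r (projT1 i)) : zmodType) (mkidx j) t.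

Lemma genD J D s (j : J s) : addmorph (@gen J D s j).
Proof. move=> t u. refine (@dincD _ (fun i : idx J => D (r (projT1 i)) : zmodType) (mkidx j) t u). Qed.

Lemma induced_ext J D (V : zmodType) (f g : induced J D -> V) :
  addmorph f -> addmorph g ->
  (forall s (j : J s) t, f (gen j t) = g (gen j t)) -> f =1 g.
Proof. by move=> fD gD fg; apply: dsum_ext => // -[s j] t; apply: fg. Qed.

Definition ind_lift J D (V : zmodType) (f : forall s, J s -> D (r s) -> V)
    (x : induced J D) : V :=
  dlift (fun (i : idx J) t => f (projT1 i) (projT2 i) t) x.

Lemma ind_liftD J D (V : zmodType) (f : forall s, J s -> D (r s) -> V) :
  (forall s j, addmorph (@f s j)) -> addmorph (@ind_lift J D V f).
Proof. by move=> fD; apply: dliftD => i; apply: fD. Qed.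

Lemma ind_lift_gen J D (V : zmodType) (f : forall s, J s -> D (r s) -> V) s (j : J s) t :
  (forall s j, addmorph (@f s j)) -> ind_lift f (gen j t) = f s j t.
Proof.
by move=> fD; rewrite /ind_lift /gen dlift_inc // => i; apply: fD.
Qed.

Section Act.
Context J D (z : A).

Lemma act_fin (q : induced J (yo z)) (t : D z) :
  exists s : seq (idx J), forall i, i \notin s ->
    @amap _ D z (r (projT1 i)) (q i) t = 0.
Proof.
have [s qs] := dfin q; exists s => i /qs ->.
exact: addmorph0 (amapDl _).
Qed.
(** By the Yoneda lemma an element [t] of [D z] is a transformation from [yo z] to
    [D]; this is the map that it induces.  For [D = yo z'] it is the covariant
    functoriality of [induced J (yo z)] in [z]. *)
Definition act (q : induced J (yo z)) (t : D z) : induced J D :=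
  @DSum (idx J) (fun i => D (r (projT1 i)) : zmodType) _ (act_fin q t).

Lemma actDl t : addmorph (act^~ t).
Proof. by move=> p q; apply: dsumP => i; apply: (amapDl t). Qed.
Lemma actDr q : addmorph (act q).
Proof. by move=> t u; apply: dsumP => i; apply: amapDr. Qed.

Lemma act_gen s (j : J s) (f : hom (r s) z) t :
  act (gen (D := yo z) j f) t = gen j (@amap _ D z (r s) f t).
Proof.
apply: dsumP => i; apply: (dinc_map (N := fun i : idx J => D (r (projT1 i)))
  (h := fun i (g : hom (r (projT1 i)) z) => @amap _ D z (r (projT1 i)) g t)).
by move=> i'; apply: (addmorph0 (amapDl t)).
Qed.
End Act.

Lemma actA J D y z (q : induced J (yo y)) (f : hom y z) (t : D z) :
  act (act (D := yo z) q f) t = act q (@amap _ D z y f t).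
Proof. by apply: dsumP => i /=; rewrite -amap_comp. Qed.

Lemma act1 J z (q : induced J (yo z)) : act (D := yo z) q (idm z) = q.
Proof. by apply: dsumP => i /=; rewrite comp1m. Qed.

Definition ind_map J J' (g : forall s, J s -> J' s) D : induced J D -> induced J' D :=
  ind_lift (fun s j t => gen (g s j) t).

Lemma ind_map_gen J J' (g : forall s, J s -> J' s) D s (j : J s) t :
  ind_map g (gen (D := D) j t) = gen (g s j) t.
Proof. by apply: ind_lift_gen => *; apply: genD. Qed.

Lemma ind_mapD J J' (g : forall s, J s -> J' s) D : addmorph (@ind_map J J' g D).
Proof. by apply: ind_liftD => *; apply: genD. Qed.

Lemma ind_map_act J J' (g : forall s, J s -> J' s) D z (q : induced J (yo z)) (t : D z) :
  ind_map g (act q t) = act (ind_map g q) t.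
Proof.
apply: (induced_ext (f := fun q => ind_map g (act q t)) (g := fun q => act (ind_map g q) t)).
- by move=> p p'; rewrite actDl ind_mapD.
- by move=> p p'; rewrite ind_mapD actDl.
- by move=> s j f; rewrite act_gen !ind_map_gen act_gen.
Qed.

Lemma ind_map_comp J J' J'' (g : forall s, J s -> J' s) (g' : forall s, J' s -> J'' s)
    D (x : induced J D) :
  ind_map g' (ind_map g x) = ind_map (fun s j => g' s (g s j)) x.
Proof.
apply: (induced_ext (f := fun x => ind_map g' (ind_map g x)) 
  (g := @ind_map J J'' (fun s j => g' s (g s j)) D)).
- by move=> p p'; rewrite !ind_mapD.
- exact: ind_mapD.
- by move=> s j f; rewrite !ind_map_gen.
Qed.

Lemma eq_ind_map J J' (g g' : forall s, J s -> J' s) D (x : induced J D) :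
  (forall s j, g s j = g' s j) -> ind_map g x = ind_map g' x.
Proof.
move=> gg; apply: (induced_ext (f := @ind_map J J' g D)
  (g := @ind_map J J' g' D)); try exact: ind_mapD.
by move=> s j f; rewrite !ind_map_gen gg.
Qed.

Lemma ind_map_id J D (x : induced J D) : ind_map (fun s j => j) x = x.
Proof.
apply: (induced_ext (f := @ind_map J J (fun s j => j) D) (g := id)) => //; first exact: ind_mapD.
by move=> s j f; rewrite ind_map_gen.
Qed.

(** The counit and the comultiplication of the comonad
    [J |-> (fun s => induced J (yo (r s)))], tensored with [D]. *)
Definition counit J D : induced (fun s => induced J (yo (r s))) D -> induced J D :=
  ind_lift (J := fun s => induced J (yo (r s))) (fun s q t => act q t).
Definition comult J D : induced J D -> induced (fun s => induced J (yo (r s))) D :=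
  ind_lift (fun s j t =>
    gen (J := fun s => induced J (yo (r s))) (gen (D := yo (r s)) j (idm (r s))) t).

Lemma counit_gen J D s (q : induced J (yo (r s))) (t : D (r s)) :
  counit (gen (J := fun s => induced J (yo (r s))) q t) = act q t.
Proof.
by apply: (ind_lift_gen (J := fun s => induced J (yo (r s)))) => *; apply: actDr.
Qed.

Lemma counitD J D : addmorph (@counit J D).
Proof. by apply: ind_liftD => *; apply: actDr. Qed.

Lemma comult_gen J D s (j : J s) (t : D (r s)) :
  comult (gen j t) =
  gen (J := fun s => induced J (yo (r s))) (gen (D := yo (r s)) j (idm (r s))) t.
Proof. by apply: ind_lift_gen => *; apply: genD. Qed.

Lemma comultD J D : addmorph (@comult J D).
Proof. by apply: ind_liftD => *; apply: genD. Qed.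

Lemma counit_act J D z (q : induced _ (yo z)) (t : D z) :
  counit (act q t) = act (@counit J (yo z) q) t.
Proof.
apply: (induced_ext (f := fun q => counit (act q t)) (g := fun q => act (counit q) t)).
- by move=> p p'; rewrite actDl counitD.
- by move=> p p'; rewrite counitD actDl.
- by move=> s j f; rewrite act_gen !counit_gen actA.
Qed.

Lemma comult_act J D z (q : induced J (yo z)) (t : D z) :
  comult (act q t) = act (comult q) t.
Proof.
apply: (induced_ext (f := fun q => comult (act q t)) (g := fun q => act (comult q) t)).
- by move=> p p'; rewrite actDl comultD.
- by move=> p p'; rewrite comultD actDl.
- by move=> s j f; rewrite act_gen !comult_gen act_gen.
Qed.

Lemma counit_comult J D (x : induced J D) : counit (comult x) = x.
Proof.
apply: (induced_ext (f := fun x => counit (comult x)) (g := id)) => //.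
- by move=> p p'; rewrite comultD counitD.
- by move=> s j f; rewrite comult_gen counit_gen act_gen (@amap_id _ D).
Qed.

(** ** Faces and degeneracies *)

Context (H : addfun A).

(** The comonad resolution of [H]: [bar n (yo z)] is the group of [n]-simplices over
    [H z], and [level n.+1] consists of its values at the objects [r s], which
    index the direct sum in degree [n.+1]. *)
Fixpoint level n : S -> zmodType := match n with
  | 0%N => fun s => H (r s)
  | m.+1 => fun s => induced (level m) (yo (r s))
  end.

Definition bar n D : zmodType := induced (level n) D.

Definition aug z : bar 0 (yo z) -> H z :=
  ind_lift (J := level 0) (D := yo z) (fun s (h : H (r s)) (f : hom (r s) z) => amap f h).

(** The face 0 is the counit at the outermost stage and the face [i.+1] applies the
    face [i] inside.  At the innermost stage it is the augmentation. *)
Fixpoint lface n i : forall s, level n.+1 s -> level n s :=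
  match n return forall s, level n.+1 s -> level n s with
  | 0%N => fun s => @aug (r s)
  | m.+1 => match i with
    | 0%N => fun s => @counit (level m) (yo (r s))
    | j.+1 => fun s => @ind_map (level m.+1) (level m) (@lface m j) (yo (r s))
    end
  end.

Definition face n i D : bar n.+1 D -> bar n D := match i with
  | 0%N => @counit (level n) D
  | j.+1 => @ind_map (level n.+1) (level n) (@lface n j) D
  end.

(** The degeneracies of degree [n] are those with index at most [n]. *)
Fixpoint ldeg n i : forall s, level n.+1 s -> level n.+2 s :=
  match n return forall s, level n.+1 s -> level n.+2 s with
  | 0%N => fun s => @comult (level 0) (yo (r s))
  | m.+1 => match i with
    | 0%N => fun s => @comult (level m.+1) (yo (r s))
    | j.+1 => fun s => @ind_map (level m.+1) (level m.+2) (@ldeg m j) (yo (r s))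
    end
  end.

Definition deg n i D : bar n D -> bar n.+1 D :=
  match n return bar n D -> bar n.+1 D with
  | 0%N => @comult (level 0) D
  | m.+1 => match i with
    | 0%N => @comult (level m.+1) D
    | j.+1 => @ind_map (level m.+1) (level m.+2) (@ldeg m j) D
    end
  end.

Lemma lfaceE n i s : @lface n.+1 i s = @face n i (yo (r s)).
Proof. by case: i. Qed.
Lemma ldegE n i s : @ldeg n i s = @deg n i (yo (r s)).
Proof. by case: n i => [|n] [|i]. Qed.

Lemma faceS n i D (x : bar n.+1 D) : face i.+1 x = ind_map (@lface n i) x.
Proof. by []. Qed.
Lemma degS n i D (x : bar n.+1 D) : deg i.+1 x = ind_map (@ldeg n i) x.
Proof. by []. Qed.
Lemma faceD n i D : addmorph (@face n i D).
Proof. by case: i => [|i]; [apply: counitD | apply: ind_mapD]. Qed.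
Lemma face_act n i D z (q : bar n.+1 (yo z)) (t : D z) :
  face i (act q t) = act (face i q) t.
Proof. by case: i => [|i]; [apply: counit_act | apply: ind_map_act]. Qed.
Lemma degD n i D : addmorph (@deg n i D).
Proof. by case: n i => [|n] [|i]; [apply: comultD .. | apply: ind_mapD]. Qed.
Lemma deg_act n i D z (q : bar n (yo z)) (t : D z) :
  deg i (act q t) = act (deg i q) t.
Proof. by case: n i q => [|n] [|i] q; [apply: comult_act .. | apply: ind_map_act]. Qed.

Lemma augD z : addmorph (@aug z).
Proof. by apply: ind_liftD => s h f g; apply: (amapDl (h : H (r s))). Qed.
Lemma aug_gen z s (h : H (r s)) (f : hom (r s) z) :
  aug (gen (J := level 0) (D := yo z) h f) = amap f h.
Proof.
apply: (ind_lift_gen (J := level 0) (D := yo z)).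
by move=> s' h' g g'; apply: (amapDl (h' : H (r s'))).
Qed.
Lemma aug_act y z (q : bar 0 (yo y)) (f : hom y z) :
  aug (act (D := yo z) q f) = amap f (aug q).
Proof.
apply: (induced_ext (f := fun q => aug (act (D := yo z) q f))
                    (g := fun q => amap f (@aug y q))).
- by move=> p p'; rewrite actDl augD.
- by move=> p p'; rewrite augD amapDr.
- by move=> s j g; rewrite act_gen !aug_gen /= amap_comp.
Qed.

Lemma aug_face z i (q : bar 1 (yo z)) : aug (face i q) = aug (face 0 q).
Proof.
case: i => // i; apply: (induced_ext (f := fun q => aug (face i.+1 q))
  (g := fun q => @aug z (face 0 q))).
- by move=> p p'; rewrite faceD augD.
- by move=> p p'; rewrite faceD augD.
- move=> s q' f; rewrite /face ind_map_gen counit_gen.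
  by rewrite aug_gen aug_act.
Qed.

Lemma face_face n (i j : nat) D (x : bar n.+2 D) : (i < j)%N ->
  face i (face j x) = face j.-1 (face i x).
Proof.
elim: n i j D x => [|n IHn] [|i] [|j] // D x ij.
- apply: (induced_ext (f := fun x => face 0 (face j.+1 x))
    (g := fun x => face j (face 0 x))); do ?by move=> p p'; rewrite !faceD.
  move=> s q t; rewrite /= ind_map_gen !counit_gen -[RHS]/(@face 0 j D (act (J := level 1) q t)).
  by rewrite face_act -lfaceE.
- rewrite /= !ind_map_comp; case: j ij => // j ij; rewrite /= ind_map_comp.
  apply: eq_ind_map => s q.
  have := etrans (@aug_face (r s) j.+1 q) (esym (@aug_face (r s) i q)).
  by rewrite -(@lfaceE 0 i); apply.
- apply: (induced_ext (f := fun x => face 0 (face j.+1 x))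
    (g := fun x => face j (face 0 x))); do ?by move=> p p'; rewrite !faceD.
  move=> s q t; rewrite /= ind_map_gen !counit_gen -[RHS]/(@face n.+1 j D (act (J := level n.+2) q t)).
  by rewrite face_act -lfaceE.
- case: j ij => // j ij; rewrite [j.+2.-1]/= !faceS !ind_map_comp.
  by apply: eq_ind_map => s q; rewrite !lfaceE IHn.
Qed.

Lemma face_deg_id n (i j : nat) D (x : bar n D) : (j <= n)%N -> (i == j) || (i == j.+1) ->
  face i (deg j x) = x.
Proof.
elim: n i j D x => [|n IHn] i [|j] // D x jn.
- case/orP => /eqP ->; first exact: counit_comult.
  apply: (induced_ext (f := fun x => face 1 (deg 0 x)) (g := id)) => //.
    by move=> p p'; rewrite degD faceD.
  move=> s q t; rewrite /= comult_gen ind_map_gen; congr gen.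
  by rewrite /= aug_gen amap_id.
- case/orP => /eqP ->; first exact: counit_comult.
  apply: (induced_ext (f := fun x => face 1 (deg 0 x)) (g := id)) => //.
    by move=> p p'; rewrite degD faceD.
  move=> s q t; rewrite /= comult_gen ind_map_gen; congr gen.
  by rewrite /= counit_gen act1.
- case: i => // i ij; rewrite faceS degS ind_map_comp -[RHS]ind_map_id.
  by apply: eq_ind_map => s q; rewrite lfaceE ldegE IHn.
Qed.

Lemma face_deg_lt n (i j : nat) D (x : bar n.+1 D) : (i < j <= n.+1)%N ->
  face i (deg j x) = deg j.-1 (face i x).
Proof.
elim: n i j D x => [|n IHn] [|i] [|j] // D x ij.
- apply: (induced_ext (f := fun x => face 0 (deg j.+1 x))
    (g := fun x => deg j (face 0 x))); do ?by move=> p p'; rewrite degD faceD.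
    by move=> p p'; rewrite faceD degD.
  move=> s q t; rewrite /= ind_map_gen !counit_gen -[RHS]/(@deg 0 j D (act (J := level 0) q t)).
  by rewrite deg_act -ldegE.
- by case: j ij => // j; rewrite andbF.
- apply: (induced_ext (f := fun x => face 0 (deg j.+1 x))
    (g := fun x => deg j (face 0 x))); do ?by move=> p p'; rewrite degD faceD.
    by move=> p p'; rewrite faceD degD.
  move=> s q t; rewrite /= ind_map_gen !counit_gen -[RHS]/(@deg n.+1 j D (act (J := level n.+1) q t)).
  by rewrite deg_act -ldegE.
- case: j ij => // j ij; rewrite [j.+2.-1]/= !(faceS, degS) !ind_map_comp.
  by apply: eq_ind_map => s q; rewrite !lfaceE !ldegE IHn.
Qed.

Lemma face_deg_gt n (i j : nat) D (x : bar n.+1 D) : (j.+1 < i <= n.+2)%N ->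
  face i (deg j x) = deg j (face i.-1 x).
Proof.
have deg0 D' m (q : bar m.+1 D') k : face k.+2 (deg 0 q) = deg 0 (face k.+1 q).
  apply: (induced_ext (f := fun x => face k.+2 (deg 0 x))
    (g := fun x => deg 0 (face k.+1 x))).
  - by move=> p p'; rewrite degD faceD.
  - by move=> p p'; rewrite faceD degD.
  move=> s p t; case: m q p => [|m] q p;
    rewrite /= comult_gen !ind_map_gen comult_gen; congr gen; exact: ind_map_gen.
elim: n i j D x => [|n IHn] [|[|i]] [|j] // D x ij.
- by case/andP: ij; rewrite !ltnS; case: i.
- rewrite [i.+2.-1]/= !(faceS, degS) !ind_map_comp.
  by apply: eq_ind_map => s q; rewrite !lfaceE !ldegE IHn.
Qed.
End Comonad.

(** * Homology of simplicial torsion groups in characteristic zero *)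

Section Push.
Context (k : fieldType).

Definition fpush (X Y : choiceType) (f : X -> Y) :
    {linear {freeg X / k} -> {freeg Y / k}} :=
  flift (fun x => << f x >> : {freeg Y / k}).

Lemma fpushE (X Y : choiceType) (f : X -> Y) x : fpush f << x >> = << f x >>.
Proof. exact: fliftE. Qed.

Lemma fpush_comp (X Y Z : choiceType) (f : X -> Y) (g : Y -> Z) u :
  fpush g (fpush f u) = fpush (fun x => g (f x)) u.
Proof.
by apply: (free_ext (f := fpush g \o fpush f)) => x; rewrite /= !fpushE.
Qed.

Lemma eq_fpush (X Y : choiceType) (f g : X -> Y) u : f =1 g -> fpush f u = fpush g u.
Proof. by move=> fg; apply: (free_ext (g := fpush g)) => x; rewrite !fpushE fg. Qed.
End Push.

Section Average.
Context (k : fieldType) (N : nat) (N_neq0 : N%:R != 0 :> k).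

Section Group.
Context (B : zmodType) (torsion : forall b : B, b *+ N = 0).
Local Notation kB := {freeg B / k}.

Definition avg_fun (x : B) (u : kB) : kB :=
  N%:R^-1 *: \sum_(c < N) fpush k (fun b => b + x *+ c) u.
Lemma avg_linear x : linear (avg_fun x).
Proof.
move=> a u v; rewrite /avg_fun scalerA mulrC -scalerA -scalerDr; congr (_ *: _).
by rewrite scaler_sumr -big_split; apply: eq_bigr => c _; rewrite linearP.
Qed.
(** The average over the translations by the multiples of [x]. *)
Definition avg x : {linear kB -> kB} := locked (mklinear (avg_linear x)).

Lemma avgE x b : avg x << b >> = N%:R^-1 *: \sum_(c < N) << b + x *+ c >>.
Proof.
rewrite /avg -lock; congr (_ *: _).
by apply: eq_bigr => c _; rewrite fpushE.
Qed.

Lemma avg_comm x y u : avg x (avg y u) = avg y (avg x u).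
Proof.
apply: (free_ext (f := avg x \o avg y) (g := avg y \o avg x)) => b /=.
rewrite !avgE !linearZ !linear_sum /=; congr (_ *: _).
under eq_bigr do rewrite avgE; rewrite -scaler_sumr.
under [RHS]eq_bigr do rewrite avgE; rewrite -scaler_sumr.
rewrite exchange_big; congr (_ *: _); apply: eq_bigr => c _.
by apply: eq_bigr => d _; rewrite addrAC.
Qed.

Lemma avg_shift x b : avg x << b + x >> = avg x << b >>.
Proof.
rewrite !avgE; congr (_ *: _).
case: N torsion => [|m] Bm; first by rewrite !big_ord0.
rewrite big_ord_recr big_ord_recl /= addrC mulr0n addr0; congr (_ + _).
  by rewrite -addrA -mulrS Bm addr0.
by apply: eq_bigr => c _; rewrite -addrA -mulrS.
Qed.

Lemma avg_idem x u : avg x (avg x u) = avg x u.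
Proof.
apply: (free_ext (f := avg x \o avg x) (g := avg x)) => b /=.
rewrite {1}avgE linearZ linear_sum /=.
have sh c : avg x << b + x *+ c >> = avg x << b >>.
  by elim: c => [|c <-]; rewrite ?addr0 // mulrSr addrA avg_shift.
under eq_bigr do rewrite sh.
by rewrite sumr_const card_ord -scaler_nat scalerA mulVf ?scale1r.
Qed.

Lemma avg0 u : avg 0 u = u.
Proof.
apply: (free_ext (f := avg 0) (g := idfun)) => b /=.
rewrite avgE; under eq_bigr do rewrite mul0rn addr0.
by rewrite sumr_const card_ord -scaler_nat scalerA mulVf ?scale1r.
Qed.

(** The projection onto the invariants under the group generated by [s]. *)
Definition avgs (s : seq B) (u : kB) : kB := foldr (fun x v => avg x v) u s.

Lemma avgs_avg s x u : avgs s (avg x u) = avg x (avgs s u).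
Proof. by elim: s => //= y s ->; rewrite avg_comm. Qed.

Lemma avgs_comm s t u : avgs s (avgs t u) = avgs t (avgs s u).
Proof. by elim: t => //= x t IH; rewrite avgs_avg IH. Qed.

Lemma avg_avgs s x u : x \in s -> avg x (avgs s u) = avgs s u.
Proof.
elim: s => //= y s IH; rewrite inE => /orP[/eqP ->|/IH xs]; first exact: avg_idem.
by rewrite avg_comm xs.
Qed.

(** The averages are commuting projections, so repetitions do not matter. *)
Lemma eq_avgs s t u : s =i t -> avgs s u = avgs t u.
Proof.
have sub v w : {subset v <= w} -> avgs v (avgs w u) = avgs w u.
  elim: v => //= x v IH vw; rewrite IH ?avg_avgs ?vw ?mem_head //.
  by move=> y yv; rewrite vw // inE yv orbT.
move=> st; rewrite -(sub s t) 1?avgs_comm ?sub //.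
  by move=> x; rewrite st.
by move=> x; rewrite st.
Qed.

Lemma avgs_shift s x b : x \in s -> avgs s << b + x >> = avgs s << b >>.
Proof.
by move=> xs; rewrite -(avg_avgs _ xs) -avgs_avg avg_shift avgs_avg avg_avgs.
Qed.

Lemma avgs_id s u : (forall x, x \in s -> x = 0) -> avgs s u = u.
Proof.
elim: s => //= x s IH s0; have -> : x = 0 by apply: s0; rewrite mem_head.
rewrite avg0 IH //.
by move=> y ys; apply: s0; rewrite inE ys orbT.
Qed.
End Group.

Lemma fpush_avgs (B C : zmodType) (f : B -> C) s (u : {freeg B / k}) :
  addmorph f -> fpush k f (avgs s u) = avgs (map f s) (fpush k f u).
Proof.
move=> fD; have fM x c : f (x *+ c) = f x *+ c.
  by elim: c => [|c IH]; rewrite ?mulr0n ?addmorph0 // !mulrS fD IH.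
have push1 x v : fpush k f (avg x v) = avg (f x) (fpush k f v).
  apply: (free_ext (f := fpush k f \o avg x) (g := avg (f x) \o fpush k f)) => b.
  rewrite /= avgE fpushE avgE linearZ linear_sum /=; congr (_ *: _).
  by apply: eq_bigr => c _; rewrite fpushE fD fM.
by elim: s => //= x s <-; apply: push1.
Qed.
End Average.

Section Boundary.
Context (k : fieldType) (A : precat) (S : Type) (r : S -> A) (H : addfun A).
Context (D : addfun (opcat A)).
Local Notation bar n := (bar r H n D).
Local Notation kbar n := {freeg (bar n) / k}.

Definition bound_fun n (u : kbar n.+1) : kbar n :=
  \sum_(i < n.+2) (-1) ^+ i *: fpush k (face (r := r) (H := H) i (D := D)) u.
Lemma bound_linear n : linear (@bound_fun n).
Proof.
move=> a u v; rewrite /bound_fun scaler_sumr -big_split; apply: eq_bigr => i _.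
by rewrite linearP scalerDr !scalerA mulrC.
Qed.
(** The boundary operator of the linearized simplicial group [bar n]. *)
Definition bound n : {linear kbar n.+1 -> kbar n} := locked (mklinear (@bound_linear n)).

Lemma bound_push n u : bound n u =
  \sum_(i < n.+2) (-1) ^+ i *: fpush k (face (r := r) (H := H) i (D := D)) u.
Proof. by rewrite /bound -lock. Qed.
Lemma boundE n (x : bar n.+1) :
  bound n << x >> = \sum_(i < n.+2) (-1) ^+ i *: << face i x >>.
Proof. by rewrite /bound -lock; apply: eq_bigr => i _; rewrite fpushE. Qed.
End Boundary.

Section Torsion.
Context (k : fieldType) (N : nat) (N_neq0 : N%:R != 0 :> k).
Context (A : precat) (S : Type) (r : S -> A) (H : addfun A) (T : addfun (opcat A)).
Hypothesis torsion : forall a (t : T a), t *+ N = 0.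
Local Notation bar n := (bar r H n T).

Lemma bar_torsion n (x : bar n) : x *+ N = 0.
Proof.
apply: dsumP => i; rewrite -[RHS](torsion (x i)).
by elim: (N) => [|m IH]; rewrite ?mulr0n // !mulrS -IH.
Qed.

Let ker0 n (x : bar n.+1) := face 0 x = 0.

Let ker0_face n i (x : bar n.+2) : ker0 x -> ker0 (face i.+1 x).
Proof.
by move=> x0; rewrite /ker0 face_face // x0 (addmorph0 (@faceD _ _ _ _ _ _ _)).
Qed.
Let ker0_deg n j (x : bar n.+1) : (j <= n)%N -> ker0 x -> ker0 (deg j.+1 x).
Proof.
by move=> jn x0; rewrite /ker0 face_deg_lt // x0 (addmorph0 (@degD _ _ _ _ _ _ _)).
Qed.

(** By [face_face] the faces other than 0 preserve the kernel of the face 0, and a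
    finite set has finitely many iterated faces. *)
Lemma face_closure n (G : seq (bar n.+1)) : (forall x, x \in G -> ker0 x) ->
  exists X : forall p, seq (bar p.+1),
  [/\ {subset G <= X n}, forall p x, x \in X p -> ker0 x &
      forall p (i : nat) x, (i <= p.+1)%N -> x \in X p.+1 -> face i.+1 x \in X p].
Proof.
elim: n G => [|n IHn] G G0.
  exists (fun p => match p with 0%N => G | _ => [::] end).
  by split=> // -[|p] x //; apply: G0.
pose G' := [seq face i.+1 x | i <- iota 0 n.+2, x <- G].
have [|X [GX X0 Xf]] := IHn G'.
  by move=> _ /allpairsP[[i x] [/= _ /G0 x0 ->]]; apply: ker0_face.
pose Y p : seq (bar p.+1) := match n.+1 =P p with
  | ReflectT e => eq_rect _ (fun p => seq (bar p.+1)) G p e ++ X p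
  | _ => X p end.
have XY p : {subset X p <= Y p}.
  by move=> x xX; rewrite /Y; case: eqP => // e; rewrite mem_cat xX orbT.
have YX p x : x \in Y p -> x \in X p \/
    exists e : n.+1 = p, x \in eq_rect _ (fun p => seq (bar p.+1)) G p e.
  rewrite /Y; case: eqP => [e|_]; last by left.
  by rewrite mem_cat => /orP[xG|xX]; [right; exists e | left].
exists Y; split.
- move=> x xG; rewrite /Y; case: eqP => // e.
  by rewrite (eq_irrelevance e erefl) mem_cat xG.
- by move=> p x /YX[/X0 //|[e]]; move: x; case: _ / e => x; apply: G0.
- move=> p i x ip /YX[xX|[e]]; first exact/XY/Xf.
  have ep : n = p by case: e.
  move: i x ip e; rewrite -{p}ep => i x ip e; rewrite (eq_irrelevance e erefl) /= => xG.
  by apply/XY/GX/allpairsP; exists (i, x); rewrite mem_iota.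
Qed.

Let degs n (C : seq (bar n.+1)) : seq (bar n.+2) :=
  [seq deg j.+1 x | j <- iota 0 n.+1, x <- C].

Let degsP n (C : seq (bar n.+1)) x :
  x \in degs C <-> exists (j : nat) y, [/\ (j <= n)%N, y \in C & x = deg j.+1 y].
Proof.
split=> [/allpairsP[[j y] []]|[j [y [jn yC ->]]]].
  by rewrite mem_iota => jn yC ->; exists j, y.
by apply/allpairsP; exists (j, y); rewrite mem_iota.
Qed.

(** The sets [C p], which close [X p] under degeneracies, are stable under the
    faces other than 0, and each of these maps the degenerate elements [F] of the
    next degree onto [C n], as it has a degeneracy as a section. *)
Lemma simplicial_closure n (G : seq (bar n.+1)) : (forall x, x \in G -> ker0 x) ->
  exists (G' : seq (bar n.+1)) (F : seq (bar n.+2)),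
  [/\ {subset G <= G'}, forall x, x \in F -> ker0 x &
      forall i, (i <= n.+1)%N -> [seq face i.+1 x | x <- F] =i G'].
Proof.
move=> /face_closure[X [GX X0 Xf]].
pose C := fix C p : seq (bar p.+1) := match p with
  | 0%N => X 0%N
  | q.+1 => X q.+1 ++ degs (C q) end.
have C0 p x : x \in C p -> ker0 x.
  elim: p x => [|p IH] x; first exact: X0.
  rewrite mem_cat => /orP[/X0 //|/degsP[j [y [jp /IH y0 ->]]]].
  exact: ker0_deg.
have XC p : {subset X p <= C p}.
  by case: p => // p x xX; rewrite mem_cat xX.
have degC p (j : nat) x : (j <= p)%N -> x \in C p -> deg j.+1 x \in C p.+1.
  by move=> jp xC; rewrite mem_cat; apply/orP; right; apply/degsP; exists j, x.
have face_degC q (j : nat) (y : bar q.+1) : (j <= q)%N -> y \in C q ->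
    (forall i' q' (e : q = q'.+1), (i' <= q)%N ->
       face i'.+1 (eq_rect _ (fun q => bar q.+1) y _ e) \in C q') ->
    forall i, (i <= q.+1)%N -> face i.+1 (deg j.+1 y) \in C q.
  move=> jq yC fC i iq.
  have [ij|ij|ij] : [\/ (i < j)%N, (i == j) || (i == j.+1) | (j.+1 < i)%N].
  - case: (ltngtP i j) => ij; [by constructor 1| |by constructor 2].
    by case: (ltngtP i j.+1) => ij'; [lia | constructor 3 | constructor 2].
  - rewrite face_deg_lt ?ltnS ?ij //=.
    case: q j y jq yC fC iq ij => [|q] [|j] // y jq yC fC iq ij.
    apply: degC => //; apply: (fC i q erefl).
    by lia.
  - by rewrite face_deg_id // ?eqSS.
  - rewrite face_deg_gt ?ltnS ?ij //=.
    case: i iq ij => [|i] // iq ij.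
    case: q j y jq yC fC iq ij => [|q] j y jq yC fC iq ij.
      by lia.
    apply: degC; last exact: (fC i q erefl).
    by lia.
have face_degs p (i : nat) x : (i <= p.+1)%N -> x \in degs (C p) -> face i.+1 x \in C p.
  elim: p i x => [|p IH] i x ip /degsP[j [y [jp yC ->]]]; apply: face_degC => //.
  move=> i' q' e i'p; have ep : p = q' by case: e.
  move: e; rewrite -{q'}ep => e; rewrite (eq_irrelevance e erefl) /=.
  by move: yC; rewrite mem_cat => /orP[yX|yD]; [apply/XC/Xf | apply: IH].
exists (C n), (degs (C n)); split=> [x /GX/XC //|x /degsP[j [y [jp yC ->]]]|i ip x].
  by apply: ker0_deg => //; apply: C0 yC.
apply/mapP/idP => [[y yD ->]|xC]; first exact: face_degs.
case: (leqP i n) => [le_in|lt_ni].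
  exists (deg i.+1 x); last by rewrite face_deg_id // eqxx.
  by apply/degsP; exists i, x.
exists (deg n.+1 x); first by apply/degsP; exists n, x.
by rewrite face_deg_id // !eqSS (eqn_leq i n.+1) ip lt_ni orbT.
Qed.

(** A section of the face 0 is [deg 0] translated by an element of its kernel.
    No single section is compatible with the other faces, but the average over
    the whole kernel would be: it would be a contracting homotopy up to terms
    that vanish on cycles.  As the kernel may be infinite, the average runs over
    the subgroup generated by a finite set, which [simplicial_closure] makes large
    enough for the given cycle [c]. *)
Lemma bar_acyclic n (c : {freeg (bar n.+1) / k}) :
  bound k r H T n c = 0 -> exists e, bound k r H T n.+1 e = c.
Proof.
move=> c0; pose G := [seq b - deg 0 (face 0 b) | b <- dom c].
have [x /mapP[b _ ->]|G' [F [GG' F0 FG]]] := @simplicial_closure n G.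
  by rewrite /ker0 (addmorphB (@faceD _ _ _ _ _ _ _)) face_deg_id // subrr.
pose h (b : bar n.+1) := avgs N F (<< deg 0 b >> : {freeg (bar n.+2) / k}).
pose h' := flift (fun b : bar n => avgs N G' (<< deg 0 b >> : {freeg (bar n.+1) / k})).
have hP b : b \in dom c -> bound k r H T n.+1 (h b) = << b >> - h' (bound k r H T n << b >>).
  move=> bc; rewrite bound_push big_ord_recl expr0 scale1r boundE linear_sum -sumrN.
  have push i (f := fun x : bar n.+2 => face (r := r) (H := H) i x) :
      fpush k f (h b) = avgs N (map f F) << face i (deg 0 b) >>.
    by rewrite fpush_avgs ?fpushE //; apply: faceD.
  congr (_ + _).
    rewrite push avgs_id // => [|_ /mapP[x /F0 x0 ->]] //.
    by rewrite face_deg_id.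
  apply: eq_bigr => i _; rewrite push lift0 linearZZ.
  rewrite exprS mulN1r scaleNr; congr (- (_ *: _)); rewrite fliftE.
  move: (ltn_ord i); case: (nat_of_ord i) => {i} [|i] ip.
    rewrite (eq_avgs N_neq0 (@bar_torsion _) _ (FG 0%N isT)) face_deg_id //.
    have bG : b - deg 0 (face 0 b) \in G' by apply/GG'/mapP; exists b.
    by rewrite -[RHS](avgs_shift N_neq0 (@bar_torsion _) _ bG) addrC subrK.
  by rewrite (eq_avgs N_neq0 (@bar_torsion _) _ (FG i.+1 _)) // face_deg_gt.
(* The correction [h'] of [hP] is applied to the boundary of [c], which is 0. *)
exists (\sum_(b <- dom c) coeff b c *: h b).
rewrite linear_sum /=.
under eq_big_seq => b bc do rewrite linearZ /= hP // scalerBr.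
rewrite sumrB.
have cE : \sum_(b <- dom c) coeff b c *: << b >> = c.
  by rewrite -[RHS]freeg_sumE; apply: eq_bigr => b _; rewrite [RHS]freegZU.
rewrite cE -[RHS]subr0; congr (_ - _).
have -> : \sum_(b <- dom c) coeff b c *: h' (bound k r H T n << b >>) = h' (bound k r H T n c).
  rewrite -[in RHS]cE !linear_sum; apply: eq_bigr => b _.
  by rewrite !linearZ.
by rewrite c0 linear0.
Qed.
End Torsion.

(** * Projectivity of the linearized direct sums of representable functors *)

Lemma finite_biproduct (A : precat) (I : choiceType) (x : I -> A) (s : seq I) :
  additive_category A -> uniq s ->
  exists (b : A) (io : forall i, hom (x i) b) (p : forall i, hom b (x i)),
  [/\ forall i, i \in s -> comp (p i) (io i) = idm (x i),
      forall i j, i \in s -> j \in s -> i != j -> comp (p i) (io j) = 0 &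
      \sum_(i <- s) comp (io i) (p i) = idm b].
Proof.
move=> [[z z0] Abi];
elim: s => [_|i0 s IH /= /andP[i0s su]].
  by exists z, (fun=> 0), (fun=> 0); split=> //; rewrite big_nil z0.
have {IH su}[b [io [p [pio pio0 bE]]]] := IH su.
have [c [i1 [i2 [p1 [p2 [p1i1 p2i2 p2i1 p1i2 cE]]]]]] := Abi (x i0) b.
pose io' i : hom (x i) c := match pselect (i0 = i) with
  | left e => eq_rect i0 (fun i => hom (x i) c) i1 i e
  | right _ => comp i2 (io i) end.
pose p' i : hom c (x i) := match pselect (i0 = i) with
  | left e => eq_rect i0 (fun i => hom c (x i)) p1 i e
  | right _ => comp (p i) p2 end.
have io'0 : io' i0 = i1.
  by rewrite /io'; case: pselect => // e; rewrite (Prop_irrelevance e erefl).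
have p'0 : p' i0 = p1.
  by rewrite /p'; case: pselect => // e; rewrite (Prop_irrelevance e erefl).
have ne i : i \in s -> i0 <> i by move=> si e; move: i0s; rewrite e si.
have io's i : i \in s -> io' i = comp i2 (io i).
  by move=> /ne ii0; rewrite /io'; case: pselect.
have p's i : i \in s -> p' i = comp (p i) p2.
  by move=> /ne ii0; rewrite /p'; case: pselect.
exists c, io', p'; split.
- move=> i; rewrite inE => /predU1P[->|si]; first by rewrite io'0 p'0.
  by rewrite io's // p's // -compA (compA p2) p2i2 comp1m pio.
- move=> i j; rewrite !inE => /predU1P[->|si] /predU1P[->|sj]; rewrite ?eqxx // => ij.
  + by rewrite p'0 io's // compA p1i2 comp0m.
  + by rewrite p's // io'0 -compA p2i1 compm0.
  + by rewrite p's // io's // -compA (compA p2) p2i2 comp1m pio0.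
- rewrite big_cons io'0 p'0 -cE; congr (_ + _).
  rewrite -[in RHS](comp1m p2) -bE.
  rewrite (addmorph_sum (fun g g' => compDl g g' p2)) (addmorph_sum (compDr i2)).
  by apply: eq_big_seq => i si; rewrite io's // p's // !compA.
Qed.

Lemma sum_transpose3 (V : zmodType) (a1 a2 a3 b1 b2 b3 c1 c2 c3 : V) :
  (a1 - a2 + a3) - (b1 - b2 + b3) + (c1 - c2 + c3) =
  (a1 - b1 + c1) - (a2 - b2 + c2) + (a3 - b3 + c3).
Proof.
rewrite !opprD !opprK [a1 - a2 + a3 + _]addrACA [a1 - a2 + _]addrACA.
by rewrite [LHS]addrACA [X in X + _]addrACA.
Qed.

Section InducedLift.
Context (k : fieldType) (A : precat) (A_additive : additive_category A).
Context (S : Type) (r : S -> A) (J : S -> zmodType).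
Local Notation I := (idx J).
Local Notation ind z := (induced r J (yo z)).
Let x (i : I) : A := r (projT1 i).
Let inc z (i : I) (f : hom (x i) z) : ind z :=
  @dinc I (fun i => hom (x i) z) i f.
Local Open Scope fset_scope.

Context (X Y : kfunctor k A) (p : nattrans X Y).
Context (f : forall z, ind z -> Y z).
Hypothesis f_natural : forall z z' (g : hom z z') q,
  f (act (D := yo z') q g) = kmap Y g (f q).

Context (b : {fset I} -> A).
Context (io : forall s i, hom (x i) (b s)) (pr : forall s i, hom (b s) (x i)).
Hypothesis biP : forall s : {fset I},
  [/\ forall i, i \in s -> comp (pr s i) (io s i) = idm (x i),
      forall i j, i \in s -> j \in s -> i != j -> comp (pr s i) (io s j) = 0 &
      \sum_(i <- s) comp (io s i) (pr s i) = idm (b s)].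
Let univ s : ind (b s) := \sum_(i <- s) inc (io s i).
Context (w : forall s, X (b s)) (wP : forall s, p (b s) (w s) = f (univ s)).

(** The coordinates of [q] with index in [t], as a morphism out of [b s]. *)
Let coord z (q : ind z) s (t : seq I) : hom (b s) z :=
  \sum_(i <- t) comp (q i : hom (x i) z) (pr s i).

(** The alternating sum of [kmap X (coord q s t) (w s)] over all [t <= s <= l]:
    each element of [l] is put in neither, in [s] only (with a sign), or in
    both of the sets accumulated so far. *)
Let Fixpoint cross z (q : ind z) (l : seq I) (s : {fset I}) (t : seq I) : X z :=
  match l with
  | [::] => kmap X (coord q s t) (w s)
  | i :: l' => cross q l' s t - cross q l' (i |` s) t + cross q l' (i |` s) (i :: t)
  end.

Let cross_ext z (q : ind z) l s t t' : (forall s, coord q s t = coord q s t') ->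
  cross q l s t = cross q l s t'.
Proof.
elim: l s t t' => [|i l IH] s t t' tt' /=; first by rewrite tt'.
have tt1 s' : coord q s' (i :: t) = coord q s' (i :: t').
  by rewrite /coord !big_cons -!/(coord q s' _) tt'.
by rewrite (IH s t t') // (IH _ t t') // (IH _ (i :: t) (i :: t')).
Qed.

(** The terms with [i] in both sets and in [s] only cancel, so that the sum depends
    only on the support of [q]. *)
Let cross_zero z (q : ind z) i l s t : q i = 0 -> cross q (i :: l) s t = cross q l s t.
Proof.
move=> q0 /=; rewrite (@cross_ext _ _ _ _ (i :: t) t) ?subrK // => s'.
by rewrite /coord big_cons q0 (addmorph0 (fun g g' => compDl g g' _)) add0r.
Qed.

Let cross_swap z (q : ind z) i j l s t :
  cross q (i :: j :: l) s t = cross q (j :: i :: l) s t.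
Proof.
rewrite /= (fsetUCA [fset j]).
rewrite (@cross_ext _ _ _ _ (j :: i :: t) (i :: j :: t)); last first.
  by move=> s'; rewrite /coord !big_cons addrCA.
exact: sum_transpose3.
Qed.

Let cross_move z (q : ind z) i l1 l2 s t :
  cross q (l1 ++ i :: l2) s t = cross q (i :: l1 ++ l2) s t.
Proof.
elim: l1 s t => // j l1 IH s t; rewrite -[RHS]/(cross q (i :: j :: l1 ++ l2) s t) cross_swap.
by rewrite /= !IH.
Qed.

Let cross_perm z (q : ind z) l l' s t : perm_eq l l' -> cross q l s t = cross q l' s t.
Proof.
elim: l l' s t => [|i l IH] l' s t ll'.
  by move: (perm_size ll') => /esym /size0nil ->.
have e : l' = take (index i l') l' ++ i :: drop (index i l').+1 l'.
  have il' : i \in l' by rewrite -(perm_mem ll') mem_head.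
  by rewrite -[in LHS](cat_take_drop (index i l') l') (drop_nth i) ?index_mem // nth_index.
move: ll'; rewrite e; set l1 := take _ _; set l2 := drop _ _ => ll'.
rewrite cross_move; have {}ll' : perm_eq l (l1 ++ l2).
  by rewrite -(perm_cons i) (perm_trans ll') // perm_catC /= perm_cons perm_catC.
by rewrite /= !(IH (l1 ++ l2)).
Qed.

Let cross_support z (q : ind z) l : uniq l -> (forall i, i \notin l -> q i = 0) ->
  cross q l fset0 [::] = cross q (dsupp q) fset0 [::].
Proof.
have drop0 (u v : seq I) s t : (forall i, i \notin v -> q i = 0) ->
    cross q u s t = cross q [seq i <- u | i \in v] s t.
  move=> qv; elim: u s t => // i u IH s t.
  rewrite [filter _ _]/=; case: ifP => iv; last by rewrite cross_zero ?IH // qv ?iv.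
  by rewrite /= !IH.
move=> lu ql; rewrite (drop0 l _ _ _ (@dsuppP _ _ q)) (drop0 (dsupp q) _ _ _ ql).
apply: cross_perm; apply: uniq_perm; rewrite ?filter_uniq ?dsupp_uniq // => i.
by rewrite !mem_filter andbC.
Qed.

Let coord_natural z z' (g : hom z z') (q : ind z) s t :
  comp g (coord q s t) = coord (act (D := yo z') q g) s t.
Proof.
rewrite /coord (addmorph_sum (compDr g)); apply: eq_bigr => i _.
by rewrite compA.
Qed.

Let cross_natural z z' (g : hom z z') (q : ind z) l s t :
  kmap X g (cross q l s t) = cross (act (D := yo z') q g) l s t.
Proof.
elim: l s t => [|i l IH] s t /=; first by rewrite -kmap_comp coord_natural.
by rewrite linearD linearB !IH.
Qed.

Let act_univ z (q : ind z) s t : uniq t -> {subset t <= s} ->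
  act (D := yo z) (univ s) (coord q s t) = \sum_(i <- t) inc (q i).
Proof.
move=> tu ts; have [pio pio0 _] := biP s.
rewrite /univ (addmorph_sum (fun q q' => actDl (D := yo z) _ q q')).
pose F i : ind z := if i \in t then inc (q i) else 0.
have -> : \sum_(i <- t) inc (q i) = \sum_(i <- t) F i.
  by apply: eq_big_seq => i it; rewrite /F it.
rewrite -(big_support (s := s)) //; first last.
- by move=> i /negbTE it; rewrite /F it.
- by move=> i; rewrite /F; case: ifP => // /ts ->.
apply: eq_big_seq => -[s0 j] si; set i : I := existT _ s0 j in si *.
rewrite [LHS](act_gen (D := yo z) j (io s i : hom (r s0) (b s))).
have -> : @amap (opcat A) (yo z) _ _ (io s i) (coord q s t)
    = if i \in t then q i else 0.
  rewrite /= /coord (addmorph_sum (fun g g' => compDl g g' (io s i))).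
  have [it|it] := boolP (i \in t).
    rewrite (bigD1_seq i) //= -compA pio // compm1 big1_seq ?addr0 // => i' /andP[ii' i't].
    by rewrite -compA pio0 ?ts // (addmorph0 (compDr _)).
  rewrite big1_seq // => i' /andP[_ i't]; rewrite -compA pio0 ?(ts i') //.
    by rewrite (addmorph0 (compDr _)).
  by apply/eqP => e; move: it; rewrite -[i in i \notin _]e i't.
by rewrite /F; case: ifP => // _; apply: (addmorph0 (@genD _ _ _ _ (yo z) _ j)).
Qed.

(** The image under [p] of a term depends on [t] only, so that the terms with [i] in
    neither set and in [s] only cancel. *)
Let cross_lift z (q : ind z) l s t : uniq (l ++ t) -> {subset t <= s} ->
  p z (cross q l s t) = f (\sum_(i <- l ++ t) inc (q i)).
Proof.
elim: l s t => [|i l IH] s t.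
  by move=> tu ts; rewrite /= natural wP -f_natural act_univ.
rewrite cat_cons cons_uniq => /andP[ilt ltu] ts; rewrite /= linearD linearB.
have ts' : {subset t <= i |` s} by move=> j jt; rewrite inE ts ?orbT.
rewrite !IH // ?subrr ?add0r; last first.
- by move=> j; rewrite !inE => /predU1P[->|/ts ->]; rewrite ?eqxx ?orbT.
- by rewrite (perm_uniq (introT permPl (perm_catCA l [:: i] t))) /= ilt.
by congr f; apply: perm_big; rewrite (perm_catCA l [:: i] t).
Qed.

Lemma cross_natural_lift : exists g : forall z, ind z -> X z,
  (forall z z' (h : hom z z') q, g z' (act (D := yo z') q h) = kmap X h (g z q)) /\
  (forall z q, p z (g z q) = f q).
Proof.
exists (fun z q => cross q (dsupp q) fset0 [::]); split=> [z z' h q|z q].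
  rewrite cross_natural -[LHS](@cross_support _ _ (dsupp q)) ?dsupp_uniq // => i iq.
  by rewrite /= dsuppP // (addmorph0 (compDr h)).
rewrite cross_lift ?cats0 ?dsupp_uniq //; congr f; exact/esym/dsum_supp.
Qed.
End InducedLift.

(** The functor [z |-> k[induced r J (yo z)]] is projective although it
    linearizes an infinite direct sum: it is the direct sum, over the finite sets
    [s] of indices, of the cross effects of the functors [k[hom (b s) z]], where
    [b s] is the biproduct of the objects indexed by [s]. *)
Lemma induced_lift (k : fieldType) (A : precat) (S : Type) (r : S -> A)
    (J : S -> zmodType) (X Y : kfunctor k A) (p : nattrans X Y)
    (f : forall z, induced r J (yo z) -> Y z) :
  additive_category A -> nat_epi p ->
  (forall z z' (h : hom z z') q, f z' (act (D := yo z') q h) = kmap Y h (f z q)) ->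
  exists g : forall z, induced r J (yo z) -> X z,
  (forall z z' (h : hom z z') q, g z' (act (D := yo z') q h) = kmap X h (g z q)) /\
  (forall z q, p z (g z q) = f z q).
Proof.
move=> Aadd pS fN.
have bi (s : {fset idx J}) := finite_biproduct (fun i : idx J => r (projT1 i)) Aadd (fset_uniq s).
pose b s := projT1 (cid (bi s)).
pose io s := projT1 (cid (projT2 (cid (bi s)))).
pose pr s := projT1 (cid (projT2 (cid (projT2 (cid (bi s)))))).
have biP s := projT2 (cid (projT2 (cid (projT2 (cid (bi s)))))).
pose univ s : induced r J (yo (b s)) :=
  \sum_(i <- s) @dinc (idx J) (fun i => hom (r (projT1 i)) (b s)) i (io s i).
have lu s := cid (pS (b s) (f (b s) (univ s))).
apply: (@cross_natural_lift k A S r J X Y p f fN b io pr biP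
  (fun s => projT1 (lu s)) (fun s => projT2 (lu s))).
Qed.

(** * Ext into functors coinduced from torsion groups *)

Section FreeFunctor.
Context (k : fieldType) (A : precat).

Section Def.
Context (I : Type) (F : I -> addfun A).

Definition fgen x : choiceType := {classic {i : I & F i x}}.
Definition mkfgen x i (u : F i x) : fgen x := existT _ i u.

Definition free_map x y (f : hom x y) : {linear {freeg (fgen x) / k} -> {freeg (fgen y) / k}} :=
  fpush k (fun c : fgen x => mkfgen (amap f (projT2 c))).

(** The direct sum of the functors [k[F i]]. *)
Definition freefun : kfunctor k A.
Proof.
refine (@KFunctor k A (fun x => {freeg (fgen x) / k}) free_map _ _).
- move=> x v; apply: (free_ext (f := free_map (idm x)) (g := idfun)) => -[i u].
  by rewrite fpushE /= amap_id.
- move=> x y z g f v; rewrite /free_map fpush_comp; apply: eq_fpush => -[i u].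
  by rewrite /= amap_comp.
Defined.

Definition bas x i (u : F i x) : freefun x := << mkfgen u >>.

Lemma kmap_bas x y (f : hom x y) i (u : F i x) :
  kmap freefun f (bas u) = bas (amap f u).
Proof. exact: fpushE. Qed.

Definition free_lift x (M : lmodType k) (g : forall i, F i x -> M) :
  {linear freefun x -> M} := 
  locked (flift (fun c : fgen x => g (projT1 c) (projT2 c))).
Lemma free_lift_bas x (M : lmodType k) (g : forall i, F i x -> M) i (u : F i x) :
  free_lift g (bas u) = g i u.
Proof. by rewrite /free_lift -lock; apply: fliftE. Qed.

Lemma freefun_ext x (M : lmodType k) (f g : {linear freefun x -> M}) :
  (forall i (u : F i x), f (bas u) = g (bas u)) -> f =1 g.
Proof. by move=> fg; apply: (free_ext (f := f)) => -[i u]; apply: fg. Qed.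

Lemma free_nat (G : kfunctor k A) (g : forall x i, F i x -> G x) :
  (forall x y (f : hom x y) i (u : F i x), g y i (amap f u) = kmap G f (g x i u)) ->
  exists t : nattrans freefun G, forall x i (u : F i x), t x (bas u) = g x i u.
Proof.
move=> gN.
have tN x y (f : hom x y) (v : freefun x) :
    free_lift (g y) (kmap freefun f v) = kmap G f (free_lift (g x) v).
  apply: (freefun_ext (f := free_lift (g y) \o kmap freefun f)
                      (g := kmap G f \o free_lift (g x))) => i u.
  by rewrite /= kmap_bas !free_lift_bas gN.
by exists (NatTrans tN) => x i u; apply: free_lift_bas.
Qed.
End Def.

Section Resolution.
Context (S : Type) (r : S -> A) (rP : forall x : A, exists s : S, isomorphic (r s) x).
Context (A_additive : additive_category A).
Context (I : Type) (H : I -> addfun A).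

Definition barfun (H0 : addfun A) (n : nat) : addfun A.
Proof.
refine (@AddFun A (fun z => bar r H0 n (yo z))
  (fun x y f q => act (D := yo y) q f) _ _ _ _).
- by move=> x y f p q; rewrite actDl.
- by move=> x y q f g; rewrite actDr.
- by move=> x q; rewrite act1.
- by move=> x y z g f q; rewrite (actA (D := yo z)).
Defined.

Definition barres (n : nat) : kfunctor k A := freefun (fun i => barfun (H i) n).

Local Notation barbas n i q := (@bas I (fun i => barfun (H i) n) _ i q).

Lemma barres_proj n : projective_functor (barres n).
Proof.
move=> X Y p f pS.
have lft i := @induced_lift k A S r (level r (H i) n) X Y p
  (fun z q => f z (barbas n i q)) A_additive pS.
have {}lft i : exists g : forall z, bar r (H i) n (yo z) -> X z,
    (forall z z' (h : hom z z') q, g z' (act (D := yo z') q h) = kmap X h (g z q)) /\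
    (forall z q, p z (g z q) = f z (barbas n i q)).
  apply: lft => z z' h q.
  by rewrite -natural (@kmap_bas _ (fun i => barfun (H i) n) z z' h).
pose g i := projT1 (cid (lft i)).
have [gN gp] : (forall i z z' (h : hom z z') q, g i z' (act (D := yo z') q h) = kmap X h (g i z q)) /\
    (forall i z q, p z (g i z q) = f z (barbas n i q)).
  by split=> i; have [] := projT2 (cid (lft i)).
have [t tE] := @free_nat I (fun i => barfun (H i) n) X (fun x i => g i x)
  (fun x y f i u => gN i x y f u).
exists t => a; apply: (freefun_ext (f := p a \o t a) (g := f a)) => i u.
by rewrite /= tE gp.
Qed.

Lemma barres_d_exists n : exists d : nattrans (barres n.+1) (barres n),
  forall x i (q : barfun (H i) n.+1 x), d x (barbas n.+1 i q) =
    \sum_(j < n.+2) (-1) ^+ j *: barbas n i (face j q).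
Proof.
apply: free_nat => x y f i q; rewrite linear_sum; apply: eq_bigr => j _.
by rewrite linearZZ kmap_bas /= face_act.
Qed.
Definition barres_d n := projT1 (cid (barres_d_exists n)).
Lemma barres_dE n x i (q : barfun (H i) n.+1 x) : barres_d n x (barbas n.+1 i q) =
    \sum_(j < n.+2) (-1) ^+ j *: barbas n i (face j q).
Proof. exact: (projT2 (cid (barres_d_exists n))). Qed.

Lemma barres_aug_exists : exists e : nattrans (barres 0) (freefun H),
  forall x i (q : barfun (H i) 0 x), e x (barbas 0%N i q) = bas (F := H) (i := i) (aug q).
Proof. by apply: free_nat => x y f i q; rewrite kmap_bas -aug_act. Qed.
Definition barres_aug := projT1 (cid barres_aug_exists).
Lemma barres_augE x i (q : barfun (H i) 0 x) :
  barres_aug x (barbas 0%N i q) = bas (F := H) (i := i) (aug q).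
Proof. exact: (projT2 (cid barres_aug_exists)). Qed.

(** The terms of index [(i, j)] and [(j.-1, i)] cancel. *)
Lemma simplicial_dd (V : lmodType k) n (a : nat -> nat -> V) :
  (forall i j : nat, (i < j)%N -> a i j = a j.-1 i) ->
  \sum_(j < n.+2) (-1) ^+ j *: (\sum_(i < n.+1) (-1) ^+ i *: a i j) = 0.
Proof.
move=> aE.
under eq_bigr do (rewrite scaler_sumr; under eq_bigr do rewrite scalerA -exprD).
under eq_bigr => j _ do rewrite (bigID (fun i : 'I_n.+1 => (i < j)%N)) /=.
rewrite big_split /=; apply/eqP; rewrite addr_eq0; apply/eqP.
rewrite [LHS]big_ord_recl [X in X + _]big1 // add0r.
rewrite [in RHS]big_ord_recr /= [X in _ = - (_ + X)]big1 ?addr0; last first.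
  by move=> i; rewrite ltn_ord.
under [in RHS]eq_bigr do rewrite big_mkcond.
rewrite [in RHS]exchange_big -sumrN; apply: eq_bigr => j _.
rewrite -sumrN [LHS]big_mkcond; apply: eq_bigr => i _.
rewrite /bump /= add1n ltnS -leqNgt; case: ifP => [ij|_]; last by rewrite oppr0.
by rewrite aE ?ltnS // addSn exprS mulN1r scaleNr addnC.
Qed.

Lemma barres_dd n x u : barres_d n x (barres_d n.+1 x u) = 0.
Proof.
pose z : {linear barres n.+2 x -> barres n x} := \0.
apply: (freefun_ext (f := barres_d n x \o barres_d n.+1 x) (g := z)) => i q.
rewrite /= barres_dE linear_sum.
rewrite -[RHS](@simplicial_dd _ n.+1 (fun i0 j => barbas n i (face i0 (face j q)))); last by move=> i' j ij; rewrite face_face.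
by apply: eq_bigr => j _; rewrite linearZZ barres_dE.
Qed.

Lemma barres_aug_d x u : barres_aug x (barres_d 0 x u) = 0.
Proof.
pose z : {linear barres 1 x -> freefun H x} := \0.
apply: (freefun_ext (f := barres_aug x \o barres_d 0 x) (g := z)) => i q.
rewrite /= barres_dE linear_sum big_ord_recl big_ord1 linearZZ linearZZ !barres_augE.
by rewrite (aug_face 1) expr0 expr1 scale1r scaleN1r subrr.
Qed.

(** The extra degeneracy: every element of degree [n], carried over to the object
    [r s] isomorphic to [x], becomes an index of the direct sum of degree [n.+1]
    at [x].  This is a map of sets, which is enough after linearization, and it is
    not natural in [x]. *)
Lemma barres_contraction x :
  exists (e0 : {linear freefun H x -> barres 0 x})
         (e : forall n, {linear barres n x -> barres n.+1 x}),
  [/\ forall u, barres_aug x (e0 u) = u,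
      forall u, barres_d 0 x (e 0%N u) = u - e0 (barres_aug x u) &
      forall n u, barres_d n.+1 x (e n.+1 u) = u - e n (barres_d n x u)].
Proof.
have [s [f [g [_ fg]]]] := rP x.
pose h i n (q : level r (H i) n s) : bar r (H i) n (yo x) := gen (D := yo x) q f.
pose e0 := free_lift (fun i (u : H i x) =>
  barbas 0%N i (h i 0%N (amap g u))).
pose e n := @free_lift I (fun i => barfun (H i) n) x (barres n.+1 x) (fun i q =>
  barbas n.+1 i (h i n.+1 (act (D := yo (r s)) q g))).
have h0 i n q : face 0 (h i n.+1 (act (D := yo (r s)) q g)) = q.
  by rewrite /h /face counit_gen (actA (D := yo x)) /= fg act1.
have h1 i q : face 1 (h i 1%N (act (D := yo (r s)) q g)) = h i 0%N (amap g (aug q)).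
  by rewrite faceS /h ind_map_gen -aug_act.
have hS i n j q : face j.+1 (h i n.+2 (act (D := yo (r s)) q g)) =
    h i n.+1 (act (D := yo (r s)) (face j q) g).
  by rewrite faceS /h ind_map_gen lfaceE face_act.
exists e0, e; split.
- move=> u; apply: (freefun_ext (f := barres_aug x \o e0) (g := idfun)) => i v.
  rewrite /= free_lift_bas barres_augE; congr bas.
  by rewrite aug_gen -amap_comp fg amap_id.
- move=> u; apply: (freefun_ext (f := barres_d 0 x \o e 0%N)
    (g := idfun \- (e0 \o barres_aug x))) => i q.
  rewrite /= free_lift_bas barres_dE big_ord_recl big_ord1 expr0 expr1 scale1r scaleN1r.
  by rewrite h0 h1 barres_augE free_lift_bas.
- move=> n u; apply: (freefun_ext (f := barres_d n.+1 x \o e n.+1)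
    (g := idfun \- (e n \o barres_d n x))) => i q.
  rewrite /= free_lift_bas barres_dE big_ord_recl expr0 scale1r h0; congr (_ + _).
  rewrite barres_dE linear_sum -sumrN; apply: eq_bigr => j _.
  by rewrite linearZZ free_lift_bas lift0 hS exprS mulN1r scaleNr.
Qed.

Definition bar_resolution : projective_resolution (freefun H).
Proof.
refine (@ProjRes k A (freefun H) barres barres_d barres_aug barres_proj _ _ _).
- by move=> x u; have [e0 [e [E _ _]]] := barres_contraction x; exists (e0 u).
- move=> x u; have [e0 [e [_ E _]]] := barres_contraction x.
  split=> [u0|[v <-]]; last exact: barres_aug_d.
  by exists (e 0%N u); rewrite E u0 linear0 subr0.
- move=> n x u; have [e0 [e [_ _ E]]] := barres_contraction x.
  split=> [u0|[v <-]]; last exact: barres_dd.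
  by exists (e n.+1 u); rewrite E u0 linear0 subr0.
Defined.
End Resolution.
End FreeFunctor.

(** ** Functors coinduced from contravariant additive functors *)

Definition funfam (S : Type) (T : S -> Type) (k : fieldType) (M : S -> lmodType k) : Type :=
  forall s, T s -> M s.

Section FunFamily.
Context (S : Type) (T : S -> Type) (k : fieldType) (M : S -> lmodType k).
Local Notation fam := (funfam T M).

Lemma funfamP (u v : fam) : (forall s t, u s t = v s t) -> u = v.
Proof.
move=> uv; apply: functional_extensionality_dep => s.
by apply: functional_extensionality_dep => t.
Qed.

Definition fam0 : fam := fun s t => 0.
Definition famD (u v : fam) : fam := fun s t => u s t + v s t.
Definition famN (u : fam) : fam := fun s t => - u s t.
Definition famZ (a : k) (u : fam) : fam := fun s t => a *: u s t.

Lemma famDA : associative famD.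
Proof. by move=> u v w; apply: funfamP => s t; rewrite /famD addrA. Qed.
Lemma famDC : commutative famD.
Proof. by move=> u v; apply: funfamP => s t; rewrite /famD addrC. Qed.
Lemma fam0D : left_id fam0 famD.
Proof. by move=> u; apply: funfamP => s t; rewrite /famD add0r. Qed.
Lemma famND : left_inverse fam0 famN famD.
Proof. by move=> u; apply: funfamP => s t; rewrite /famD addNr. Qed.

HB.instance Definition _ := gen_eqMixin fam.
HB.instance Definition _ := gen_choiceMixin fam.
HB.instance Definition _ := GRing.isZmodule.Build fam famDA famDC fam0D famND.

Lemma famZA a b u : famZ a (famZ b u) = famZ (a * b) u.
Proof. by apply: funfamP => s t; rewrite /famZ scalerA. Qed.
Lemma famZ1 : left_id 1 famZ.
Proof. by move=> u; apply: funfamP => s t; rewrite /famZ scale1r. Qed.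
Lemma famZDr : right_distributive famZ +%R.
Proof. by move=> a u v; apply: funfamP => s t; apply: scalerDr. Qed.
Lemma famZDl u : {morph famZ^~ u : a b / a + b}.
Proof. by move=> a b; apply: funfamP => s t; apply: scalerDl. Qed.
HB.instance Definition _ := GRing.Zmodule_isLmodule.Build k fam famZA famZ1 famZDr famZDl.

Lemma fam_eval_linear s t : linear (fun u : fam => u s t).
Proof. by []. Qed.
Definition fam_eval s t : {linear fam -> M s} := mklinear (@fam_eval_linear s t).
End FunFamily.

Section Coinduced.
Context (k : fieldType) (A : precat) (Z : Type).
Context (T : Z -> addfun (opcat A)) (M : Z -> lmodType k).

Definition coind_map (x y : A) (f : @hom A x y) (u : funfam (fun s => T s x) M) :
  funfam (fun s => T s y) M := fun s t => u s (@amap _ (T s) y x f t).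
Lemma coind_map_linear (x y : A) (f : @hom A x y) : linear (coind_map f).
Proof. by []. Qed.

(** The product over [s] of the functors [x |-> Map(T s x, M s)]. *)
Definition coind : kfunctor k A.
Proof.
refine (@KFunctor k A (fun x => funfam (fun s => T s x) M)
  (fun x y f => mklinear (coind_map_linear f)) _ _).
- by move=> x u; apply: funfamP => s t; rewrite /= /coind_map (@amap_id _ (T s)).
- move=> x y z g f u; apply: funfamP => s t.
  by rewrite /= /coind_map (@amap_comp _ (T s) _ _ _ f g).
Defined.
End Coinduced.

Section Cochains.
Context (A : precat) (A_additive : additive_category A) (S : Type) (r : S -> A).
Context (J : S -> zmodType) (T : addfun (opcat A)).
Local Notation ind := (induced r J).

(** Take for [z] a biproduct indexed by the support of [b], and for [q] the sum of
    its structural morphisms. *)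
Lemma act_surj (b : ind T) : exists z (q : ind (yo z)) (t : T z), act q t = b.
Proof.
have [z [io [p [pio pio0 zE]]]] :=
  finite_biproduct (fun i : idx J => r (projT1 i)) A_additive (dsupp_uniq b).
exists z, (\sum_(i <- dsupp b) @dinc (idx J) (fun i => hom (r (projT1 i)) z) i (io i)).
exists (\sum_(i <- dsupp b) @amap _ T (r (projT1 i)) z (p i) (b i)).
rewrite (addmorph_sum (fun q q' => actDl (D := T) _ q q')) [RHS]dsum_supp.
apply: eq_big_seq => -[s j] ib; rewrite [LHS]act_gen; congr dinc.
rewrite (addmorph_sum (@amapDr _ T z (r s) (io (mkidx j)))) (bigD1_seq _ ib (dsupp_uniq b)) /=.
rewrite -(@amap_comp _ T (r s) z (r s)) /= (pio _ ib) (@amap_id _ T) big1_seq ?addr0 //.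
move=> i /andP[ij i_b]; rewrite -(@amap_comp _ T (r (projT1 i)) z (r s)) /= (pio0 i (mkidx j)) //.
exact: addmorph0 (amapDl _).
Qed.

(** The group [ind T] is the coend of the sets [ind (yo z) * T z].  Two pairs with
    the same image are compared through the sum [univ] of the structural morphisms
    of one biproduct that is large enough for both. *)
Lemma cochain_descent (M : Type) (phi : forall z, ind (yo z) -> T z -> M) :
  (forall y z (f : hom y z) q t,
     phi z (act (D := yo z) q f) t = phi y q (@amap _ T z y f t)) ->
  exists psi : ind T -> M, forall z (q : ind (yo z)) t, psi (act q t) = phi z q t.
Proof.
move=> phiN.
have eq_phi y z q (t : T y) q' (t' : T z) : act q t = act q' t' -> phi y q t = phi z q' t'.
  move=> e; pose l := undup (dsupp q ++ dsupp q').
  have [b [io [p [pio pio0 bE]]]] :=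
    finite_biproduct (fun i : idx J => r (projT1 i)) A_additive (undup_uniq (dsupp q ++ dsupp q')).
  pose univ : ind (yo b) :=
    \sum_(i <- l) @dinc (idx J) (fun i => hom (r (projT1 i)) b) i (io i).
  suff phiE x (v : ind (yo x)) (u : T x) : {subset dsupp v <= l} ->
      phi x v u = phi b univ (\sum_(i <- l) @amap _ T (r (projT1 i)) b (p i) (act v u i)).
    rewrite (phiE y q t) ?(phiE z q' t') ?e // => i ii;
    by rewrite mem_undup mem_cat ii ?orbT.
  move=> vl; pose c : hom b x := \sum_(i <- l) comp (v i : hom (r (projT1 i)) x) (p i).
  have cio i : i \in l -> comp c (io i) = v i.
    move=> il; rewrite /c (addmorph_sum (fun g g' => compDl g g' (io i))).
    rewrite (bigD1_seq i) ?undup_uniq //= -compA pio // compm1 big1_seq ?addr0 //.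
    move=> j /andP[ji jl]; rewrite -compA pio0 //.
    exact: (addmorph0 (compDr _)).
  have {1}-> : v = act (D := yo x) univ c.
    rewrite /univ (addmorph_sum (fun q q' => actDl (D := yo x) _ q q')).
    rewrite (@dsumE _ _ l v) ?undup_uniq //; last first.
      by move=> i il; apply: dsuppP; apply: contra il; apply: vl.
    apply: eq_big_seq => -[s j] il; rewrite [RHS]act_gen; congr dinc.
    exact/esym/(cio (mkidx j)).
  rewrite phiN; congr phi.
  apply: etrans (addmorph_sum (@amapDl _ T x b u) _ _) _.
  apply: eq_bigr => i _; exact: (@amap_comp _ T x (r (projT1 i)) b (p i) (v i) u).
have desc b : exists m, exists z (q : ind (yo z)) t, act q t = b /\ phi z q t = m.
  by have [z [q [t e]]] := act_surj b; exists (phi z q t), z, q, t.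
exists (fun b => projT1 (cid (desc b))) => z q t.
by have [z' [q' [t' [e <-]]]] := projT2 (cid (desc (act q t))); apply: eq_phi.
Qed.
End Cochains.

Section ExtVanishing.
Context (k : fieldType) (N : nat) (N_neq0 : N%:R != 0 :> k).
Context (A : precat) (S : Type) (r : S -> A) (rP : forall x : A, exists s : S, isomorphic (r s) x).
Context (A_additive : additive_category A).
Context (I : Type) (H : I -> addfun A).
Context (Z : Type) (T : Z -> addfun (opcat A)) (M : Z -> lmodType k).
Hypothesis torsion : forall s a (t : T s a), t *+ N = 0.
Local Notation R := (bar_resolution k rP A_additive H).
Local Notation barbas n i q := (@bas k A I (fun i => barfun r (H i) n) _ i q).

(** Cochains on the simplicial resolution are the functions on the simplicial
    torsion groups [bar r (H i) n (T s)].  A cocycle vanishes on boundaries, hence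
    on the kernel of the boundary operator by [bar_acyclic], so it factors through
    this operator. *)
Lemma bar_coboundary n (z : nattrans (R n.+1) (coind T M)) : cocycle z -> coboundary z.
Proof.
move=> zc; pose ev a s t : {linear coind T M a -> M s} := @fam_eval Z (fun s => T s a) k M s t.
have desc i s := @cochain_descent A A_additive S r (level r (H i) n.+1) (T s) (M s)
  (fun a q t => z a (barbas n.+1 i q) s t).
have {}desc i s : exists psi : bar r (H i) n.+1 (T s) -> M s,
    forall a (q : bar r (H i) n.+1 (yo a)) t, psi (act q t) = z a (barbas n.+1 i q) s t.
  apply: desc => x y f q t.
  have := natural z f (barbas n.+1 i q); rewrite [kmap _ _ _]kmap_bas => e.
  exact: (congr1 (fun u : coind T M y => u s t) e).
pose psi i s := projT1 (cid (desc i s)).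
have psiE i s a (q : bar r (H i) n.+1 (yo a)) (t : T s a) :
    psi i s (act q t) = z a (barbas n.+1 i q) s t.
  exact: (projT2 (cid (desc i s))).
have psic i s u : flift (psi i s) (bound k r (H i) (T s) n.+1 u) = 0.
  pose z0 : {linear {freeg (bar r (H i) n.+2 (T s)) / k} -> M s} := \0.
  apply: (free_ext (f := flift (psi i s) \o bound k r (H i) (T s) n.+1) (g := z0)) => b.
  have [a [q [t <-]]] := act_surj A_additive b.
  rewrite /= boundE linear_sum.
  have := zc a (barbas n.+2 i q) => /(congr1 (ev a s t)).
  rewrite linear0 => {2}<-; rewrite [res_d _ _ _ _]barres_dE !linear_sum.
  by apply: eq_bigr => j _; rewrite !linearZZ fliftE face_act psiE.
have fct i s : exists y : {linear {freeg (bar r (H i) n (T s)) / k} -> M s},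
    forall u, y (bound k r (H i) (T s) n u) = flift (psi i s) u.
  apply: lin_factor => u u0.
  have [v <-] := bar_acyclic N_neq0 (@torsion s) u0; exact: psic.
pose y i s := projT1 (cid (fct i s)).
have yE i s u : y i s (bound k r (H i) (T s) n u) = flift (psi i s) u.
  exact: (projT2 (cid (fct i s))).
pose y0 a i (q : barfun r (H i) n a) : coind T M a := fun s t => y i s << act q t >>.
have [a b f i q|Y YE] := @free_nat k A I (fun i => barfun r (H i) n) (coind T M) y0.
  by apply: funfamP => s t; rewrite /y0 /= /coind_map actA.
exists Y => a u.
apply: (freefun_ext (f := z a) (g := Y a \o res_d R n a)) => i q.
rewrite -[RHS]/(Y a (res_d R n a (barbas n.+1 i q))) [res_d _ _ _ _]barres_dE linear_sum.
apply: funfamP => s t.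
rewrite -psiE -fliftE -yE boundE linear_sum.
rewrite -[RHS]/(ev a s t (\sum_j _)) [RHS]linear_sum.
by apply: eq_bigr => j _; rewrite !linearZZ YE /= /y0 face_act.
Qed.
End ExtVanishing.

(** * Functors on a finite von Neumann regular category *)

Definition finite_homs (B : precat) := forall x y : B,
  exists s : seq (hom x y), forall f, f \in s.
Definition regular_cat (B : precat) := forall (x y : B) (f : hom x y),
  exists g, comp f (comp g f) = f.
Definition idempotents_split (B : precat) := forall (x : B) (e : hom x x),
  comp e e = e -> exists u (a : hom u x) (b : hom x u), comp b a = idm u /\ comp a b = e.

(** What is used of the finitely generated projective modules over a finite
    semisimple ring. *)
Record regular_finite (B : precat) : Prop := RegularFinite {
  rf_fin : finite_homs B;
  rf_reg : regular_cat B;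
  rf_split : idempotents_split B
}.

Lemma regular_finite_op B : regular_finite B -> regular_finite (opcat B).
Proof.
case=> fin reg split; split=> [x y|x y f|x e ee].
- exact: fin y x.
- by have [g fg] := reg _ _ f; exists g; rewrite /= -compA.
- by have [u [a [b [ba ab]]]] := split x e ee; exists u, b, a.
Qed.

(** [hom x y] with a structure of finite type, for which [rf] is recorded. *)
Definition fhom (B : precat) (rf : regular_finite B) (x y : B) : Type := hom x y.

Section FiniteHom.
Context (B : precat) (rf : regular_finite B) (x y : B).
Local Notation T := (fhom rf x y).

HB.instance Definition _ := GRing.Zmodule.on T.

Let enumT : seq T := undup (projT1 (cid (rf_fin rf x y))).
Let mem_enumT (f : T) : f \in enumT.
Proof. by rewrite mem_undup; apply: (projT2 (cid (rf_fin rf x y))). Qed.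
Let enumK : pcancel (fun f : T => seq.index f enumT) (fun n => nth None (map Some enumT) n).
Proof.
by move=> f; rewrite (nth_map f) ?index_mem ?mem_enumT // nth_index ?mem_enumT.
Qed.
HB.instance Definition _ := PCanIsCountable enumK.
Let enumP : Finite.axiom enumT.
Proof. by move=> f; rewrite count_uniq_mem ?undup_uniq // mem_enumT. Qed.
HB.instance Definition _ := isFinite.Build T enumP.
End FiniteHom.

Section Category.
Context (B : precat).

Definition smono (x y : B) (f : hom x y) : Prop := exists r, comp r f = idm x.
Definition sepi (x y : B) (f : hom x y) : Prop := exists s, comp f s = idm y.

Context (rf : regular_finite B).

(** Finite monoids are Dedekind finite. *)
Lemma endo_inv (x : B) (f g : hom x x) : comp g f = idm x -> comp f g = idm x.
Proof.
move=> gf; have fI : injective (fun a : fhom rf x x => comp f a : fhom rf x x).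
  by move=> a b /(congr1 (comp g)); rewrite !compA gf !comp1m.
have /codomP[a fa] := injF_onto fI (idm x : fhom rf x x).
suff -> : g = a by rewrite -fa.
by rewrite -[a]comp1m -gf -compA -fa compm1.
Qed.

Lemma smono_sepi (x : B) (f : hom x x) : smono f <-> sepi f.
Proof. by split=> -[g /endo_inv]; exists g. Qed.

Lemma smono_endo (x y : B) (f : hom x y) (g : hom x x) : smono (comp f g) -> smono f.
Proof.
move=> [r rfg]; exists (comp g r).
by rewrite -compA; apply: endo_inv; rewrite -compA.
Qed.

(** A measure of the size of [x]: it decreases strictly on proper retracts. *)
Definition csize (x : B) : nat := #|{: fhom rf x x}|.

Lemma csize_retract (u v : B) (a : hom u v) (b : hom v u) :
  comp b a = idm u -> (csize u <= csize v)%N /\ (comp a b <> idm v -> (csize u < csize v)%N).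
Proof.
move=> ba; pose f (x : fhom rf u u) : fhom rf v v := comp a (comp x b).
have fI : injective f.
  move=> x y /(congr1 (fun z => comp b (comp z a))).
  by rewrite /f -!compA ba !compm1 !compA ba !comp1m.
split=> [|ab]; first exact: leq_card fI.
rewrite /csize -(card_codom fI).
have sub : codom f \subset predC1 (idm v : fhom rf v v).
  apply/subsetP => _ /codomP[x ->]; rewrite !inE; apply/eqP => fx; apply: ab.
  by rewrite -[comp a b]comp1m -fx /f -!compA (compA b) ba comp1m.
apply: leq_ltn_trans (subset_leq_card sub) _.
by rewrite cardC1 prednK //; apply/card_gt0P; exists (idm v : fhom rf v v).
Qed.

Lemma isomorphic_sym (x y : B) : isomorphic x y -> isomorphic y x.
Proof. by move=> [f [g [gf fg]]]; exists g, f. Qed.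
Lemma isomorphic_trans (x y z : B) : isomorphic x y -> isomorphic y z -> isomorphic x z.
Proof.
move=> [f [g [gf fg]]] [f' [g' [gf' fg']]]; exists (comp f' f), (comp g g').
split; first by rewrite -compA (compA g') gf' comp1m.
by rewrite -compA (compA f) fg comp1m.
Qed.
Lemma smono_sepi_iso (x y : B) (f : hom x y) : smono f -> sepi f -> isomorphic x y.
Proof.
move=> [r rf1] [s fs]; exists f, r; split=> //.
by rewrite -[r]compm1 -fs (compA r) rf1 comp1m.
Qed.
End Category.

Section CosingularCoefficients.
Context (k : fieldType) (char0 : forall n, n.+1%:R != 0 :> k).
Context (B : precat) (rf : regular_finite B).
Local Notation H x y := (fhom rf x y).

(** The element [\sum_a c a *: a] of [k[hom u u]] is congruent to [idm u] modulo
    the ideal spanned by the non-invertible endomorphisms and annihilates this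
    ideal on both sides: it is [idm u] minus the identity element of the ideal.
    More generally it is annihilated by every morphism out of [u] that is not a
    split monomorphism and by every morphism into [u] that is not a split
    epimorphism. *)
Record cosingular (u : B) (c : hom u u -> k) : Prop := Cosingular {
  cosingular_l : forall w (f : hom u w), ~ smono f ->
    forall h, \sum_(a : H u u | (comp f a : H u w) == h) c a = 0;
  cosingular_r : forall w (g : hom w u), ~ sepi g ->
    forall h, \sum_(a : H u u | (comp a g : H w u) == h) c a = 0;
  cosingular_iso : forall a : H u u, smono a -> c a = (a == idm u :> H u u)%:R
}.

Section Retractions.
Context (u v : B) (c : hom u u -> k) (cP : cosingular c).
Context (a0 : hom u v) (b0 : hom v u) (ba0 : comp b0 a0 = idm u).

(** The number of retractions of [a0], by [retr_cardE]. *)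
Definition retr_card : nat := #|[pred x : H v u | (comp x a0 : H u u) == 0]|.

Lemma sum_retractions (F : H v u -> k) (g : hom u u) :
  \sum_(b : H v u | (comp b a0 : H u u) == g) F b =
  \sum_(x : H v u | (comp x a0 : H u u) == 0) F (comp g b0 + x).
Proof.
rewrite (reindex_inj (addrI (comp g b0 : H v u))); apply: eq_bigl => x.
by rewrite [comp (_ + _) _]compDl -compA ba0 compm1 -subr_eq0 [g + _]addrC addrK.
Qed.

(** If [al] factors through [a0], then [comp b al] does not depend on [b].
    Otherwise let [d] be the difference of [al] and [comp a0 (comp b0 al)], with
    [d d' d = d] and [e = 1 - d' d], which is not a split epimorphism as [d e = 0].
    The sum is unchanged when the argument of [c] is translated by any [y] with
    [y e = 0].  Averaged over these translations it becomes a combination of sums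
    of [c] over cosets of the kernel of composition with [e], and these vanish. *)
Lemma cosingular_retractions (g : hom u u) (al : hom u v) :
  \sum_(b : H v u | (comp b a0 : H u u) == g) c (comp b al) =
  if (al : H u v) == comp a0 (comp b0 al)
  then retr_card%:R * c (comp g (comp b0 al)) else 0.
Proof.
rewrite sum_retractions; case: eqP => [al_f|al_d].
  rewrite (eq_bigr (fun=> c (comp g (comp b0 al)))) => [|x /eqP x0]; last first.
    congr c; rewrite [in LHS]al_f compDl [comp x _]compA x0 comp0m addr0.
    by rewrite -compA (compA b0) ba0 comp1m.
  by rewrite sumr_const mulr_natl.
pose d := al - comp a0 (comp b0 al); have [d' dd'] := rf_reg rf d.
have b0d : comp b0 d = 0 by rewrite compBr (compA b0) ba0 comp1m subrr.
pose e : hom u u := idm u - comp d' d.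
have de : comp d e = 0 by rewrite compBr compm1 dd' subrr.
have e_sepi : ~ sepi e.
  move=> [s es]; apply: al_d; apply/eqP; rewrite -subr_eq0; apply/eqP.
  by rewrite -[LHS]/d -[d]compm1 -es compA de comp0m.
have alE x : comp x a0 = 0 -> comp (comp g b0 + x) al = comp g (comp b0 al) + comp x d.
  by move=> x0; rewrite compDl -compA compBr [comp x (comp a0 _)]compA x0 comp0m subr0.
(* Translating [x] by [comp y (comp d' (idm v - comp a0 b0))] translates
   [comp x d] by [y], provided [comp y e = 0]. *)
pose Y := [pred y : H u u | (comp y e : H u u) == 0].
pose Sx := \sum_(x : H v u | (comp x a0 : H u u) == 0) c (comp (comp g b0 + x) al).
have shift y : y \in Y ->
    \sum_(x : H v u | (comp x a0 : H u u) == 0) c (comp g (comp b0 al) + comp x d + y) = Sx.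
  rewrite inE => /eqP ye; pose xy : H v u := comp (comp y d') (idm v - comp a0 b0).
  have xy0 : comp xy a0 = 0.
    by rewrite -(compA (comp y d')) compBl comp1m -(compA a0) ba0 compm1 subrr compm0.
  have xyd : comp xy d = y.
    rewrite -(compA (comp y d')) compBl comp1m -(compA a0) b0d compm0 subr0.
    have ed : idm u = e + comp d' d by rewrite /e subrK.
    by rewrite -[RHS]compm1 ed compDr ye add0r compA.
  rewrite /Sx [RHS](reindex_inj (addIr xy)).
  apply: eq_big => [x|x /eqP x0]; first by rewrite [comp (_ + _) _]compDl xy0 addr0.
  rewrite [in RHS]alE; last by rewrite [LHS]compDl x0 xy0 addr0.
  by rewrite [comp (x + xy) _]compDl xyd addrA.
have : \sum_(y in Y) Sx = 0.
  rewrite -(eq_bigr _ shift) exchange_big big1 // => x x0.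
  rewrite -[RHS](cosingular_r cP e_sepi (comp (comp g (comp b0 al) + comp x d) e)).
  rewrite [RHS](reindex_inj (addrI (comp g (comp b0 al) + comp x d : H u u))).
  apply: eq_bigl => y; rewrite inE -[RHS]subr_eq0 [comp (_ + y) _]compDl.
  by rewrite [X in X - _]addrC addrK.
have Y0 : 0 \in Y by rewrite inE comp0m.
rewrite sumr_const -mulr_natl (cardD1 0) Y0 => /eqP.
by rewrite mulf_eq0 (negbTE (char0 _)) => /eqP.
Qed.

Lemma retr_cardE (g : hom u u) :
  #|[pred x : H v u | (comp x a0 : H u u) == g]| = retr_card.
Proof.
rewrite /retr_card -!sum1_card.
rewrite (reindex_inj (addrI (comp g b0 : H v u))); apply: eq_bigl => x; rewrite !inE.
by rewrite [comp (_ + _) _]compDl -compA ba0 compm1 -subr_eq0 [g + _]addrC addrK.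
Qed.

Lemma card_hom_retr : #|{: H v u}| = (csize rf u * retr_card)%N.
Proof.
rewrite -sum1_card (partition_big (fun x : H v u => comp x a0 : H u u) xpredT) //=.
under eq_bigr => g _ do rewrite sum1_card retr_cardE.
by rewrite sum_nat_const.
Qed.
End Retractions.
End CosingularCoefficients.

(** ** Primitive elements *)

Lemma sum_fibers (k : fieldType) (V : lmodType k) (I J : finType) (f : I -> J)
    (c : I -> k) (G : J -> V) :
  \sum_i c i *: G (f i) = \sum_j (\sum_(i | f i == j) c i) *: G j.
Proof.
rewrite (partition_big f xpredT) //=; apply: eq_bigr => j _.
by rewrite scaler_suml; apply: eq_bigr => i /eqP ->.
Qed.

Section Primitive.
Context (k : fieldType) (char0 : forall n, n.+1%:R != 0 :> k).
Context (B : precat) (rf : regular_finite B).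
Local Notation H x y := (fhom rf x y).

Section Projector.
Context (Y : kfunctor k B) (u : B) (c : hom u u -> k).

Lemma eps_linear : linear (fun y : Y u => \sum_(a : H u u) c a *: kmap Y a y).
Proof.
move=> l x y; rewrite scaler_sumr -big_split; apply: eq_bigr => a _.
by rewrite linearP scalerDr !scalerA mulrC.
Qed.
(** The action of [\sum_a c a *: a] on [Y u].  If [c] is cosingular, this is the
    projection onto the primitive elements that kills the images of all morphisms
    which are not split epimorphisms. *)
Definition eps : {linear Y u -> Y u} := locked (mklinear eps_linear).
Lemma epsE y : eps y = \sum_(a : H u u) c a *: kmap Y a y.
Proof. by rewrite /eps -lock. Qed.
End Projector.

Lemma eps_nat (X Y : kfunctor k B) (t : nattrans X Y) u c (x : X u) :
  t u (eps X c x) = eps Y c (t u x).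
Proof.
by rewrite !epsE linear_sum; apply: eq_bigr => a _; rewrite linearZZ natural.
Qed.

Definition primitive (Y : kfunctor k B) u (w : Y u) : Prop :=
  forall v (f : hom u v), ~ smono f -> kmap Y f w = 0.

Lemma primitive_map (Y : kfunctor k B) u v (w : Y u) (f : hom u v) (g : hom v u) :
  comp f g = idm v -> primitive w -> primitive (kmap Y f w).
Proof.
move=> fg wP x h hS; rewrite -kmap_comp wP // => -[r rhf]; apply: hS.
exists (comp f r).
have -> : comp (comp f r) h = comp f (comp (comp r (comp h f)) g).
  by rewrite -!compA fg compm1.
by rewrite rhf comp1m.
Qed.

Section CosingularProjector.
Context (Y : kfunctor k B) (u : B) (c : hom u u -> k) (cP : cosingular rf c).

Lemma eps_primitive y : primitive (eps Y c y).
Proof.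
move=> v f fS; rewrite epsE linear_sum.
under eq_bigr do rewrite linearZZ -kmap_comp.
rewrite (sum_fibers (fun a : H u u => comp f a : H u v) c (fun h => kmap Y h y)).
by rewrite big1 // => h _; rewrite (cosingular_l cP fS) scale0r.
Qed.

Lemma eps_kill v (g : hom v u) y : ~ sepi g -> eps Y c (kmap Y g y) = 0.
Proof.
move=> gS; rewrite epsE; under eq_bigr do rewrite -kmap_comp.
rewrite (sum_fibers (fun a : H u u => comp a g : H v u) c (fun h => kmap Y h y)).
by rewrite big1 // => h _; rewrite (cosingular_r cP gS) scale0r.
Qed.

Lemma eps_id w : primitive w -> eps Y c w = w.
Proof.
move=> wP; rewrite epsE (bigD1 (idm u : H u u)) //= big1 ?addr0 => [|a a1].
  rewrite (cosingular_iso cP) ?eqxx ?scale1r ?kmap_id //.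
  by exists (idm u); rewrite comp1m.
have [aS|/wP ->] := pselect (smono a); last by rewrite scaler0.
by rewrite (cosingular_iso cP aS) (negbTE a1) scale0r.
Qed.

Lemma eps_endo (g : hom u u) w : primitive w -> smono g ->
  eps Y c (kmap Y g w) = kmap Y g w.
Proof. by move=> wP [h hg]; apply: eps_id; apply: primitive_map (endo_inv rf hg) wP. Qed.
End CosingularProjector.

(** The number of automorphisms of [u]. *)
Definition aut_card u : nat :=
  \sum_(g : H u u) #|[pred h : H u u | (comp g h : H u u) == idm u]|.

Lemma aut_card_gt0 u : (0 < aut_card u)%N.
Proof.
rewrite /aut_card (bigD1 (idm u : H u u)) //= addn_gt0; apply/orP; left.
by apply/card_gt0P; exists (idm u : H u u); rewrite inE comp1m.
Qed.

Lemma natr_neq0 n : (0 < n)%N -> n%:R != 0 :> k.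
Proof. by case: n. Qed.

Section Component.
Context (X Y : kfunctor k B) (u : B) (c : hom u u -> k) (cP : cosingular rf c).
Context (sg : {linear Y u -> X u}).

Definition comp_coef (v : B) : k :=
  (csize rf u)%:R / (#|{: H v u}|%:R * (aut_card u)%:R).

Lemma component_linear v : linear (fun y : Y v =>
  comp_coef v *: \sum_(al : H u v) \sum_(b : H v u)
    c (comp b al) *: kmap X al (eps X c (sg (eps Y c (kmap Y b y))))).
Proof.
move=> l x y; rewrite /= scalerA [l * _]mulrC -(scalerA (comp_coef v)) -scalerDr; congr (_ *: _).
rewrite scaler_sumr -big_split; apply: eq_bigr => al _.
rewrite scaler_sumr -big_split; apply: eq_bigr => b _.
rewrite (linearP (kmap Y b)) (linearP (eps Y c)) (linearP sg) (linearP (eps X c)).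
by rewrite (linearP (kmap X al)) scalerDr !scalerA mulrC.
Qed.
(** The map [sg] cut down to primitive elements and spread over all objects.  By
    [component_gen] and [component_other] it is the only extension of the average
    of [sg] over the automorphisms of [u] that is natural and vanishes on what
    comes from primitive elements at objects not isomorphic to [u]. *)
Definition component v : {linear Y v -> X v} := locked (mklinear (@component_linear v)).
Lemma componentE v y : component v y =
  comp_coef v *: \sum_(al : H u v) \sum_(b : H v u)
    c (comp b al) *: kmap X al (eps X c (sg (eps Y c (kmap Y b y)))).
Proof. by rewrite /component -lock. Qed.

Definition averaged (w : Y u) : X u := (aut_card u)%:R^-1 *:
  \sum_(g : H u u) \sum_(h : H u u | (comp g h : H u u) == idm u)
    kmap X h (eps X c (sg (kmap Y g w))).

(** By [cosingular_retractions] only the morphisms [al = comp a0 h] contribute, and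
    the weights [c (comp g h)] that remain select the pairs of inverse
    automorphisms [g] and [h]. *)
Lemma component_gen v (a0 : hom u v) w : primitive w ->
  component v (kmap Y a0 w) = kmap X a0 (averaged w).
Proof.
move=> wP; have [[b0 ba0]|aS] := pselect (smono a0); last first.
  rewrite wP // linear0 /averaged linearZZ linear_sum big1 ?scaler0 // => g _.
  rewrite linear_sum big1 // => h _; rewrite -kmap_comp (eps_primitive cP) //.
  by move/(smono_endo rf).
pose G g := eps X c (sg (eps Y c (kmap Y g w))).
pose K := retr_card rf a0.
rewrite componentE; under eq_bigr => al _.
  under eq_bigr do rewrite -kmap_comp -/(G _).
  rewrite (sum_fibers (fun b : H v u => comp b a0 : H u u)
    (fun b : H v u => c (comp b al)) (fun g => kmap X al (G g))).
  under eq_bigr do rewrite (cosingular_retractions char0 cP ba0).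
over.
rewrite exchange_big /=.
under eq_bigr => g _.
  rewrite (eq_bigr (fun al : H u v => if al == comp a0 (comp b0 al) :> H u v then
     (K%:R * c (comp g (comp b0 al))) *: kmap X al (G g) else 0)); last first.
    by move=> al _; case: ifP => // _; rewrite scale0r.
  rewrite -big_mkcond /=.
  rewrite (reindex_onto (fun h : H u u => comp a0 h : H u v)
             (fun al : H u v => comp b0 al : H u u)) /=; last first.
    by move=> al /eqP <-.
  rewrite (eq_bigl xpredT); last first.
    by move=> h; rewrite !(compA b0) ba0 !comp1m !eqxx.
  under eq_bigr do rewrite (compA b0) ba0 comp1m -scalerA kmap_comp -(linearZZ (kmap X a0)).
  rewrite -scaler_sumr -(linear_sum (kmap X a0)).
over.
rewrite -scaler_sumr -(linear_sum (kmap X a0)) scalerA /averaged linearZZ.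
have -> : comp_coef v * K%:R = (aut_card u)%:R^-1.
  rewrite /comp_coef (card_hom_retr rf ba0) natrM.
  have Kn : K%:R != 0 :> k.
    by apply: natr_neq0; apply/card_gt0P; exists 0; rewrite inE comp0m.
  have cn : (csize rf u)%:R != 0 :> k.
    by apply: natr_neq0; apply/card_gt0P; exists (idm u : H u u).
  have an : (aut_card u)%:R != 0 :> k by apply/natr_neq0/aut_card_gt0.
  by field; rewrite Kn cn an.
congr (_ *: kmap X a0 _); apply: eq_bigr => g _; rewrite [RHS]big_mkcond.
apply: eq_bigr => h _; case: eqP => gh.
  have gS : smono g by apply/(smono_sepi rf); exists h.
  rewrite (cosingular_iso cP) gh; last by exists (idm u); rewrite comp1m.
  by rewrite eqxx scale1r /G (eps_endo cP).
have [hS|hS] := pselect (smono h); last by rewrite (eps_primitive cP) // scaler0.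
have [gS|gS] := pselect (smono g); last first.
  by rewrite /G wP // !linear0 ?scaler0.
rewrite (cosingular_iso cP); last first.
  move: gS hS => [g' gg'] [h' hh']; exists (comp h' g').
  by rewrite -compA (compA g') gg' comp1m.
by move/eqP/negbTE: gh => ->; rewrite scale0r.
Qed.

Lemma component_other v u' (a0 : hom u' v) w : primitive w -> ~ isomorphic u' u ->
  component v (kmap Y a0 w) = 0.
Proof.
move=> wP uu'; rewrite componentE big1 ?scaler0 // => al _; rewrite big1 // => b _.
rewrite -kmap_comp; have [fS|/wP ->] := pselect (smono (comp b a0)); last first.
  by rewrite !linear0 ?scaler0.
have [gS|gS] := pselect (sepi (comp b a0)).
  by case: uu'; apply: smono_sepi_iso fS gS.
by rewrite (eps_kill cP) // !linear0 ?scaler0.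
Qed.
End Component.

Lemma averaged_id (Y : kfunctor k B) u (c : hom u u -> k) (cP : cosingular rf c) (w : Y u) :
  primitive w -> averaged c idfun w = w.
Proof.
move=> wP; rewrite /averaged.
rewrite (eq_bigr (fun g : H u u => \sum_(h : H u u | (comp g h : H u u) == idm u) w)).
  under eq_bigr do rewrite sumr_const.
  by rewrite sumrMnr -scaler_nat scalerA mulVf ?scale1r ?natr_neq0 ?aut_card_gt0.
move=> g _; apply: eq_bigr => h /eqP /(endo_inv rf) hg.
have gS : smono g by exists h.
by rewrite /= (eps_endo cP) // -kmap_comp hg kmap_id.
Qed.

Lemma component_post (X X' Y : kfunctor k B) (t : nattrans X X') u c
    (sg : {linear Y u -> X u}) (sg' : {linear Y u -> X' u}) v y :
  (forall x, sg' x = t u (sg x)) ->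
  t v (component c sg v y) = component c sg' v y.
Proof.
move=> e; rewrite !componentE linearZZ linear_sum; congr (_ *: _).
apply: eq_bigr => al _; rewrite linear_sum; apply: eq_bigr => b _.
by rewrite linearZZ natural eps_nat e.
Qed.

Lemma component_pre (X Y Y' : kfunctor k B) (t : nattrans Y' Y) u c
    (sg : {linear Y u -> X u}) (sg' : {linear Y' u -> X u}) v y :
  (forall x, sg' x = sg (t u x)) ->
  component c sg v (t v y) = component c sg' v y.
Proof.
move=> e; rewrite !componentE; congr (_ *: _).
apply: eq_bigr => al _; apply: eq_bigr => b _.
by rewrite e eps_nat natural.
Qed.
End Primitive.

(** ** Kovacs' theorem *)

Section Coefficients.
Context (k : fieldType).

Lemma coeff_linear (X : choiceType) (x : X) : linear (coeff x : {freeg X / k} -> k^o).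
Proof. by move=> a u v; rewrite coeffD coeffZ. Qed.
Definition coeffl (X : choiceType) (x : X) : {linear {freeg X / k} -> k^o} :=
  mklinear (coeff_linear x).

Lemma coeff_fpush (X : finType) (Y : choiceType) (f : X -> Y) y u :
  coeff y (fpush k f u) = \sum_(x | f x == y) coeff x u.
Proof.
pose g v : k^o := \sum_(x | f x == y) coeff x v.
have gl : linear g.
  move=> a v w; rewrite /g scaler_sumr -big_split; apply: eq_bigr => x _.
  by rewrite coeffD coeffZ.
apply: (free_ext (f := coeffl y \o fpush k f) (g := mklinear gl)) => x.
rewrite /= /g fpushE coeffU mul1r; under eq_bigr do rewrite coeffU mul1r.
have [fx|fx] := eqVneq (f x) y.
  rewrite (bigD1 x) ?fx //= eqxx big1 ?addr0 // => x' /andP[_ xx'].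
  by rewrite eq_sym (negbTE xx').
by rewrite big1 // => x' /eqP fx'; case: eqP => // xx'; rewrite -fx' xx' eqxx in fx.
Qed.
End Coefficients.

Section Corepresentable.
Context (k : fieldType) (B : precat).

(** The linearization of the functor [hom w -]. *)
Definition corep (w : B) : kfunctor k B.
Proof.
refine (@KFunctor k B (fun x => {freeg (hom w x) / k})
  (fun x y f => fpush k (fun a : hom w x => comp f a)) _ _).
- move=> x v; apply: (free_ext (f := fpush k (fun a : hom w x => comp (idm x) a))
    (g := idfun)) => a.
  by rewrite fpushE comp1m.
- move=> x y z g f v; rewrite fpush_comp; apply: eq_fpush => a.
  by rewrite compA.
Defined.

Definition precomp (w v : B) (g : hom w v) : nattrans (corep v) (corep w).
Proof.
exists (fun x => fpush k (fun a : hom v x => comp a g)) => x y f u.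
by rewrite /= !fpush_comp; apply: eq_fpush => a; rewrite compA.
Defined.
End Corepresentable.

Section Semisimple.
Context (k : fieldType) (char0 : forall n, n.+1%:R != 0 :> k).
Context (B : precat) (rf : regular_finite B).
Context (S : Type) (r : S -> B) (rP : forall x : B, exists s : S, isomorphic (r s) x).
Local Notation H x y := (fhom rf x y).

(** The chosen index of the isomorphism class of [x]. *)
Definition canon (x : B) : {classic S} := projT1 (cid (rP x)).
Lemma canonP x : isomorphic (r (canon x)) x.
Proof. exact: projT2 (cid (rP x)). Qed.
Lemma eq_canon x y : isomorphic x y -> canon x = canon y.
Proof.
have cidE (P Q : S -> Prop) (p : exists s, P s) (q : exists s, Q s) :
    P = Q -> projT1 (cid p) = projT1 (cid q).
  by move=> PQ; subst Q; rewrite (Prop_irrelevance p q).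
move=> xy; apply: cidE; apply/funext => s; apply/propext.
split=> [sx|sy]; first exact: isomorphic_trans sx xy.
exact: isomorphic_trans sy (isomorphic_sym xy).
Qed.

(** The object [u] is the image of the idempotent [comp g g'], where [g g' g = g]. *)
Lemma not_sepi_factor (v w : B) (g : hom w v) : ~ sepi g ->
  exists u (al : hom u v) (be : hom v u),
    [/\ comp be al = idm u, comp al be <> idm v & comp al (comp be g) = g].
Proof.
move=> gS; have [g' gg'] := rf_reg rf g.
have [|u [al [be [ba ab]]]] := rf_split rf (e := comp g g').
  by rewrite (compA (comp g g')) -(compA g g' g) gg'.
exists u, al, be; split=> //; first by rewrite ab => gg; apply: gS; exists g'.
by rewrite compA ab -compA gg'.
Qed.

(** Every element of [Y v] is the sum of its primitive part and of images of
    non-invertible endomorphisms of [v].  These factor through proper retracts, to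
    which induction applies. *)
Lemma primitive_ext m (Y : kfunctor k B) (Z : lmodType k) v (L L' : {linear Y v -> Z}) :
  (forall u, (csize rf u <= m)%N -> exists c : hom u u -> k, cosingular rf c) ->
  (csize rf v <= m)%N ->
  (forall u (al : hom u v) (w : Y u), (csize rf u <= csize rf v)%N -> primitive w ->
     L (kmap Y al w) = L' (kmap Y al w)) -> L =1 L'.
Proof.
move=> smaller; have [n] := ubnP (csize rf v).
elim: n v L L' => // n IH v L L' vn vm LL' y.
have [c cP] := smaller v vm.
have Lp u := LL' v (idm v) (eps rf Y c u) (leqnn _) (eps_primitive cP _).
have yE : y - eps rf Y c y =
    \sum_(a : H v v) ((a == idm v :> H v v)%:R - c a) *: kmap Y a y.
  rewrite epsE; under [RHS]eq_bigr do rewrite scalerBl.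
  rewrite sumrB; congr (_ - _); rewrite (bigD1 (idm v : H v v)) //= eqxx scale1r.
  by rewrite kmap_id big1 ?addr0 // => a /negbTE ->; rewrite scale0r.
rewrite -[y](subrK (eps rf Y c y)) [LHS]linearD [RHS]linearD.
congr (_ + _); last by move: (Lp y); rewrite kmap_id.
rewrite yE !linear_sum; apply: eq_bigr => a _.
rewrite !linearZZ; have [aS|aS] := pselect (smono a).
  by rewrite (cosingular_iso cP aS) subrr !scale0r.
congr (_ *: _).
have [|u [al [be [ba ab <-]]]] := @not_sepi_factor v v a.
  by move/(smono_sepi rf).
have [_ /(_ ab) uv] := csize_retract rf ba.
rewrite kmap_comp.
apply: (IH u (L \o kmap Y al) (L' \o kmap Y al)).
- exact: leq_trans uv vn.
- exact: leq_trans (ltnW uv) vm.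
- move=> u' al' w uu' wP; rewrite /= -!kmap_comp; apply: LL' => //.
  exact: leq_trans uu' (ltnW uv).
Qed.

(** The retracts of [v] correspond to the idempotents in the finite monoid
    [hom v v].  Each isomorphism class of retracts is listed once. *)
Lemma retract_list v (P : hom v v -> Prop) : exists L : seq {classic S},
  [/\ uniq L, forall s, s \in L -> canon (r s) = s,
      forall s, s \in L -> exists (al : hom (r s) v) (be : hom v (r s)),
        comp be al = idm (r s) /\ P (comp al be) &
      forall u (al : hom u v) (be : hom v u),
        comp be al = idm u -> P (comp al be) -> canon u \in L].
Proof.
pose U (e : hom v v) : B := match pselect (comp e e = e) with
  | left ee => projT1 (cid (rf_split rf ee)) | right _ => v end.
have UP e : comp e e = e -> exists (a : hom (U e) v) (b : hom v (U e)),
    comp b a = idm (U e) /\ comp a b = e.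
  by move=> ee; rewrite /U; case: pselect => // ee'; exact: projT2 (cid (rf_split rf ee')).
pose L := undup [seq canon (U e) | e <- enum {: H v v} & `[< comp e e = e /\ P e >]].
have LP s : s \in L -> exists2 e, comp e e = e /\ P e & s = canon (U e).
  by rewrite mem_undup => /mapP[e]; rewrite mem_filter => /andP[/asboolP eP _]; exists e.
exists L; split; first exact: undup_uniq.
- by move=> s /LP[e _ ->]; apply: eq_canon; apply: canonP.
- move=> s /LP[e [ee eP] ->].
  have [a [b [ba ab]]] := UP e ee; have [f [g [gf fg]]] := canonP (U e).
  exists (comp a f), (comp g b); split; first by rewrite -compA (compA b) ba comp1m gf.
  by rewrite -compA (compA f) fg comp1m ab.
- move=> u al be ba abP; have ee : comp (comp al be) (comp al be) = comp al be.
    by rewrite -compA (compA be) ba comp1m.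
  have [a [b [ba' ab']]] := UP _ ee.
  rewrite mem_undup; apply/mapP; exists (comp al be).
    rewrite mem_filter; apply/andP; split; first exact/asboolP.
    by rewrite (@mem_enum (H v v)).
  apply: eq_canon; move: (U _) a b ba' ab' => w a b ba' ab'.
  exists (comp b al), (comp be a); split.
    by rewrite -compA (compA a) ab' -(compA al) ba compm1 ba.
  by rewrite -compA (compA al) -ab' -(compA a) ba' compm1 ba'.
Qed.

Section ComponentSum.
Context (X Y : kfunctor k B) (cc : forall s : S, hom (r s) (r s) -> k).
Context (sg : forall s, {linear Y (r s) -> X (r s)}).

Lemma component_sum_gen (L : seq {classic S}) v u (a0 : hom u v) (w : Y u)
    (f : hom (r (canon u)) u) (g : hom u (r (canon u))) :
  uniq L -> (forall s, s \in L -> cosingular rf (@cc s) /\ canon (r s) = s) ->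
  canon u \in L -> comp g f = idm _ -> comp f g = idm u -> primitive w ->
  \sum_(s <- L) component rf (@cc s) (sg s) v (kmap Y a0 w) =
  kmap X (comp a0 f) (averaged rf (@cc (canon u)) (sg (canon u)) (kmap Y g w)).
Proof.
move=> Lu LP uL gf fg wP.
have -> : kmap Y a0 w = kmap Y (comp a0 f) (kmap Y g w).
  by rewrite -kmap_comp -compA fg compm1.
have gwP : primitive (kmap Y g w) by apply: primitive_map wP; exact: gf.
rewrite (bigD1_seq (canon u)) //= (component_gen char0 (LP _ uL).1) //.
rewrite big1_seq ?addr0 // => s /andP[su sL]; have [cP cs] := LP s sL.
apply: (component_other cP) => // uS.
by move: su; rewrite -cs -(eq_canon uS) (LP _ uL).2 eqxx.
Qed.
End ComponentSum.

(** A left identity [e] of the ideal spanned by the non-invertible endomorphisms of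
    [v]: by Yoneda it is the value at [idm v] of an endomorphism [E] of the functors
    [Y |-> Y v], natural in [Y], which is the identity on the images of the
    morphisms that are not split epimorphisms.  The sum of the components of the
    identity over the proper retracts of [v] is such an [E]. *)
Lemma left_identity v :
  (forall u, (csize rf u < csize rf v)%N -> exists c : hom u u -> k, cosingular rf c) ->
  exists e : hom v v -> k, (forall a, smono a -> e a = 0) /\
    forall w (g : hom w v), ~ sepi g -> forall h : H w v,
      \sum_(a : H v v | (comp a g : H w v) == h) e a = (h == g)%:R.
Proof.
move=> smaller.
have [L [Lu Lc Lr LP]] := retract_list (fun e : hom v v => e <> idm v).
have Lsize s : s \in L -> (csize rf (r s) < csize rf v)%N.
  by move=> /Lr[a [b [ba ab]]]; apply: (csize_retract rf ba).2.
pose cc s : hom (r s) (r s) -> k :=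
  match pselect (exists c : hom (r s) (r s) -> k, cosingular rf c) with
  | left ex => projT1 (cid ex) | right _ => fun=> 0 end.
have ccP s : s \in L -> cosingular rf (cc s) /\ canon (r s) = s.
  move=> sL; split; last exact: Lc.
  rewrite /cc; case: pselect => [ex|]; first exact: projT2 (cid ex).
  by case; apply/smaller/Lsize.
pose E (Y : kfunctor k B) (y : Y v) : Y v :=
  \sum_(s <- L) component rf (cc s) (idfun : {linear Y (r s) -> Y (r s)}) v y.
have El Y : linear (E Y).
  by move=> a x y; rewrite /E scaler_sumr -big_split; apply: eq_bigr => s _; rewrite linearP.
have Enat (Y Y' : kfunctor k B) (t : nattrans Y Y') y : t v (E Y y) = E Y' (t v y).
  rewrite /E linear_sum; apply: eq_bigr => s _.
  rewrite (@component_post _ _ rf _ _ _ t _ _ _ (t (r s))) //.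
  by rewrite (@component_pre _ _ rf _ _ _ t _ _ _ (t (r s))).
have Egen w (g : hom w v) : ~ sepi g -> E (corep k w) << g >> = << g >>.
  move=> /not_sepi_factor[u [al [be [ba ab gE]]]].
  have [_ /(_ ab) uv] := csize_retract rf ba.
  have -> : << g >> = kmap (corep k w) al << comp be g >> by rewrite /= fpushE gE.
  apply: (@primitive_ext (csize rf u) (corep k w) _ u
    (mklinear (El (corep k w)) \o kmap (corep k w) al) (kmap (corep k w) al)) => //.
    by move=> u' u'u; apply: smaller; apply: leq_ltn_trans uv.
  move=> u' al' w' u'u w'P.
  rewrite -[LHS]/(E _ (kmap (corep k w) al (kmap (corep k w) al' w'))) -kmap_comp.
  have [[b' ba']|aS] := pselect (smono (comp al al')); last first.
    by rewrite w'P // -[LHS]/(mklinear (El (corep k w)) 0) linear0.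
  have ab' : comp (comp al al') b' <> idm v.
    move=> /(csize_retract rf)[vu' _].
    by move: (leq_trans uv (leq_trans vu' u'u)); rewrite ltnn.
  have [f [g' [gf fg]]] := canonP u'.
  rewrite /E (component_sum_gen _ _ Lu ccP (LP _ _ _ ba' ab') gf fg w'P).
  rewrite (averaged_id char0 (ccP _ (LP _ _ _ ba' ab')).1); last first.
    by apply: primitive_map w'P; exact: gf.
  by rewrite -kmap_comp -compA fg compm1.
exists (fun a => coeff (a : hom v v) (E (corep k v) << idm v >>)); split.
  move=> a aS; rewrite /E -[LHS]/(coeffl k a _) linear_sum big1_seq // => s /andP[_ /Lsize sv].
  rewrite componentE linearZZ linear_sum big1 ?scaler0 // => al _.
  rewrite linear_sum big1 // => b _; rewrite linearZZ.
  rewrite [coeffl _ _ _]/= (coeff_fpush (X := fhom rf v (r s))).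
  rewrite big1 ?scaler0 // => x /eqP alx.
  case: aS => a'; rewrite -alx compA => a'al.
  have [vs _] := csize_retract rf a'al.
  by move: (leq_trans sv vs); rewrite ltnn.
move=> w g gS h.
rewrite -(coeff_fpush (X := fhom rf v v) (fun a : hom v v => comp a g : hom w v)).
have /= := Enat _ _ (precomp k g) << idm v >>; rewrite fpushE comp1m => ->.
by rewrite Egen // coeffU mul1r eq_sym.
Qed.
End Semisimple.

Section Opposite.
Context (k : fieldType) (B : precat) (rf : regular_finite B).
Local Notation rf_op := (regular_finite_op rf).

Lemma sum_op (V : nmodType) (x y : B) (P : pred (hom y x)) (F : hom y x -> V) :
  \sum_(a : fhom rf_op x y | P a) F a = \sum_(a : fhom rf y x | P a) F a.
Proof.
pose f (a : fhom rf y x) : fhom rf_op x y := a.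
by rewrite (reindex f) //; exists (id : fhom rf_op x y -> fhom rf y x).
Qed.

Lemma csize_op (x : B) : csize rf_op x = csize rf x.
Proof. by rewrite /csize -!sum1_card (sum_op xpredT (fun=> 1%N)). Qed.

Lemma cosingular_op (u : B) (c : hom u u -> k) : cosingular rf c -> @cosingular k _ rf_op u c.
Proof.
move=> cP; split=> [w f fS h|w f fS h|a aS].
- by rewrite (sum_op (fun a : hom u u => @comp B w u u a f == h)); apply: (cosingular_r cP fS).
- by rewrite (sum_op (fun a : hom u u => @comp B u u w f a == h)); apply: (cosingular_l cP fS).
- by apply: (cosingular_iso cP); apply/(smono_sepi rf).
Qed.
End Opposite.

Section Decomposition.
Context (k : fieldType) (char0 : forall n, n.+1%:R != 0 :> k).
Context (B : precat) (rf : regular_finite B).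
Context (S : Type) (r : S -> B) (rP : forall x : B, exists s : S, isomorphic (r s) x).
Local Notation H x y := (fhom rf x y).

(** By induction on the size of [v] the ideal spanned by the non-invertible
    endomorphisms has a left identity [e] and, by passing to the opposite category,
    a right identity [e'].  They agree, and [idm v - e] is the required element. *)
Lemma cosingular_exists v : exists c : hom v v -> k, cosingular rf c.
Proof.
have [m] := ubnP (csize rf v); elim: m v => // m IH v vm.
have [|e [e_iso eE]] := left_identity char0 (rf := rf) rP (v := v).
  by move=> u uv; apply: IH; apply: leq_trans uv vm.
have rP' (x : opcat B) : exists s, @isomorphic (opcat B) (r s) x.
  have [s [f [g [gf fg]]]] := rP x; exists s, g, f; split; [exact: gf|exact: fg].
have [|e' [e'_iso e'E]] := left_identity char0 (rf := regular_finite_op rf) rP' (v := v).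
  move=> u; rewrite !csize_op => uv.
  have [c cP] := IH u (leq_trans uv vm); exists c; exact: cosingular_op.
have {}e'E w (g : hom v w) : ~ smono g -> forall h : H v w,
    \sum_(a : H v v | (comp g a : H v w) == h) e' a = (h == g)%:R.
  move=> gS h; rewrite -(e'E w g gS h); symmetry.
  exact: (sum_op rf (fun a : hom v v => comp g a == h) e').
(* Both are the product of [e] and [e']. *)
have ee' x : e x = e' x.
  transitivity (\sum_(a : H v v) \sum_(a' : H v v | (comp a a' : H v v) == x) e a * e' a').
    rewrite (bigD1 (x : H v v)) //= -mulr_sumr.
    rewrite [X in _ + X]big1 ?addr0 => [|a ax].
      have [xS|xS] := pselect (smono x); first by rewrite e_iso // mul0r.
      by rewrite e'E // eqxx mulr1.
    rewrite -mulr_sumr; have [aS|aS] := pselect (smono a); first by rewrite e_iso // mul0r.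
    by rewrite e'E // eq_sym (negbTE ax) mulr0.
  rewrite (exchange_big_dep xpredT) //= (bigD1 (x : H v v)) //= -mulr_suml.
  rewrite [X in _ + X]big1 ?addr0 => [|a ax].
    have [xS|xS] := pselect (sepi x); first by rewrite e'_iso // mulr0.
    by rewrite eE // eqxx mul1r.
  rewrite -mulr_suml; have [aS|aS] := pselect (sepi a); first by rewrite e'_iso // mulr0.
  by rewrite eE // eq_sym (negbTE ax) mul0r.
have idsum (P : pred (H v v)) :
    \sum_(a | P a) ((a == idm v :> H v v)%:R : k) = (P (idm v))%:R.
  rewrite big_mkcond (bigD1 (idm v : H v v)) //= eqxx big1 ?addr0; first by case: (P _).
  by move=> a /negbTE ->; case: (P a).
exists (fun a => (a == idm v :> H v v)%:R - e a); split=> [w f fS h|w g gS h|a aS].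
- rewrite sumrB idsum compm1; under [X in _ - X]eq_bigr do rewrite ee'.
  by rewrite e'E // [in X in X - _]eq_sym subrr.
- by rewrite sumrB idsum comp1m eE // [in X in X - _]eq_sym subrr.
- by rewrite e_iso // subr0.
Qed.

Definition cosingular_coef v : hom v v -> k := projT1 (cid (cosingular_exists v)).
Lemma cosingular_coefP v : cosingular rf (@cosingular_coef v).
Proof. exact: projT2 (cid (cosingular_exists v)). Qed.
Local Notation cc s := (@cosingular_coef (r s)).

(** ** Splitting of natural transformations *)

(** The isomorphism classes of retracts of [v]. *)
Definition retracts v : seq {classic S} :=
  projT1 (cid (retract_list rf rP (fun _ : hom v v => True))).

Lemma retracts_uniq v : uniq (retracts v).
Proof. by rewrite /retracts; case: cid => L []. Qed.
Lemma retracts_canon v s : s \in retracts v -> canon rP (r s) = s.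
Proof. by rewrite /retracts; case: cid => L [] /= _ + _ _ => /[apply]. Qed.
Lemma mem_retracts v u (al : hom u v) (be : hom v u) :
  comp be al = idm u -> canon rP u \in retracts v.
Proof. by rewrite /retracts; case: cid => L [] /= _ _ _ LP /LP; apply. Qed.

Section Transformation.
Context (X Y : kfunctor k B) (sg : forall s, {linear Y (r s) -> X (r s)}).

Lemma transformation_linear v :
  linear (fun y => \sum_(s <- retracts v) component rf (cc s) (sg s) v y).
Proof.
by move=> a x y; rewrite scaler_sumr -big_split; apply: eq_bigr => s _; rewrite linearP.
Qed.
(** The other isomorphism classes do not contribute to the value at [v]. *)
Definition transformation v : {linear Y v -> X v} :=
  locked (mklinear (@transformation_linear v)).
Lemma transformationE v y :
  transformation v y = \sum_(s <- retracts v) component rf (cc s) (sg s) v y.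
Proof. by rewrite /transformation -lock. Qed.

Lemma transformation_gen v u (a0 : hom u v) (w : Y u)
    (f : hom (r (canon rP u)) u) (g : hom u (r (canon rP u))) :
  comp g f = idm _ -> comp f g = idm u -> primitive w ->
  transformation v (kmap Y a0 w) = kmap X (comp a0 f)
    (averaged rf (cc (canon rP u)) (sg (canon rP u)) (kmap Y g w)).
Proof.
move=> gf fg wP; rewrite transformationE.
have [[b0 ba0]|aS] := pselect (smono a0); last first.
  rewrite wP // big1 => [|s _]; last by rewrite linear0.
  have gwP : primitive (kmap Y g w) by apply: primitive_map wP; exact: gf.
  rewrite -(component_gen char0 (cosingular_coefP _) _ _ gwP) -kmap_comp -compA fg compm1.
  by rewrite wP // linear0.
apply: (component_sum_gen char0 _ _ (retracts_uniq v) _ (mem_retracts ba0) gf fg wP).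
by move=> s sv; split; [exact: cosingular_coefP|exact: retracts_canon sv].
Qed.

(** By [primitive_ext] it suffices to consider the images of primitive elements. *)
Lemma transformation_nat v v' (h : hom v v') (y : Y v) :
  transformation v' (kmap Y h y) = kmap X h (transformation v y).
Proof.
apply: (@primitive_ext k B rf (csize rf v) Y _ v (transformation v' \o kmap Y h)
  (kmap X h \o transformation v)) => // [u _|u al w _ wP]; first exact: cosingular_exists.
have [f [g [gf fg]]] := canonP rP u.
rewrite [LHS]/= -kmap_comp (transformation_gen _ gf fg wP).
by rewrite [RHS]/= (transformation_gen _ gf fg wP) -kmap_comp compA.
Qed.

Definition transform : nattrans Y X := NatTrans transformation_nat.
End Transformation.

Lemma transform_post (X X' Y : kfunctor k B) (t : nattrans X X')
    (sg : forall s, {linear Y (r s) -> X (r s)})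
    (sg' : forall s, {linear Y (r s) -> X' (r s)}) v y :
  (forall s x, sg' s x = t (r s) (sg s x)) ->
  t v (@transform X Y sg v y) = @transform X' Y sg' v y.
Proof.
move=> e; rewrite /= !transformationE linear_sum; apply: eq_bigr => s _.
by rewrite (@component_post _ _ rf _ _ _ t _ _ _ (sg' s)).
Qed.

Lemma transform_pre (X Y Y' : kfunctor k B) (t : nattrans Y' Y)
    (sg : forall s, {linear Y (r s) -> X (r s)})
    (sg' : forall s, {linear Y' (r s) -> X (r s)}) v y :
  (forall s x, sg' s x = sg s (t (r s) x)) ->
  @transform X Y sg v (t v y) = @transform X Y' sg' v y.
Proof.
move=> e; rewrite /= !transformationE; apply: eq_bigr => s _.
by rewrite (@component_pre _ _ rf _ _ _ t _ _ _ (sg' s)).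
Qed.

Lemma transform_id (Y : kfunctor k B) v y : @transform Y Y (fun=> idfun) v y = y.
Proof.
apply: (@primitive_ext k B rf (csize rf v) Y _ v (transform _ v) idfun) => //.
  by move=> u _; apply: cosingular_exists.
move=> u al w _ wP; have [f [g [gf fg]]] := canonP rP u.
rewrite /= (transformation_gen _ _ gf fg wP) (averaged_id char0 (cosingular_coefP _)); last first.
  by apply: primitive_map wP; exact: gf.
by rewrite -kmap_comp -compA fg compm1.
Qed.

(** Linear sections at the objects [r s] are averaged to a natural one; averaging is
    compatible with composition with [p] and preserves the identity. *)
Lemma nat_section (X Y : kfunctor k B) (p : nattrans X Y) : nat_epi p ->
  exists s : nattrans Y X, forall v y, p v (s v y) = y.
Proof.
move=> pS; have sgP s := lin_section (pS (r s)).
exists (transform (fun s => projT1 (cid (sgP s)))) => v y.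
rewrite (@transform_post _ _ _ p _ (fun=> idfun)) ?transform_id // => s x.
by rewrite (projT2 (cid (sgP s))).
Qed.

Lemma nat_retraction (X Y : kfunctor k B) (i : nattrans X Y) :
  (forall v, injective (i v)) ->
  exists s : nattrans Y X, forall v x, s v (i v x) = x.
Proof.
move=> iI; have sgP s := lin_retraction (@iI (r s)).
exists (transform (fun s => projT1 (cid (sgP s)))) => v x.
rewrite (@transform_pre _ _ _ i _ (fun=> idfun)) ?transform_id // => s y.
by rewrite (projT2 (cid (sgP s))).
Qed.
End Decomposition.

(** * Projective modules over a finite semisimple ring *)

Definition submodule (S : pzRingType) (V : lmodType S) (I : V -> Prop) :=
  I 0 /\ forall a x y, I x -> I y -> I (a *: x + y).

Definition submod_pred (S : pzRingType) (V : lmodType S) (I : V -> Prop)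
  (IP : submodule I) : {pred V} := fun x => `[< I x >].

Section SubmodulePredicate.
Context (S : pzRingType) (V : lmodType S) (I : V -> Prop) (IP : submodule I).
Lemma submod_pred_closed : submod_closed (submod_pred IP).
Proof.
case: (IP) => I0 IL; split=> [|a x y]; rewrite !unfold_in; first exact/asboolP.
by move=> /asboolP Ix /asboolP Iy; apply/asboolP; apply: IL.
Qed.
HB.instance Definition _ :=
  GRing.isSubmodClosed.Build S V (submod_pred IP) submod_pred_closed.
End SubmodulePredicate.

Section Complement.
Context (S : pzRingType) (M : lmodType S).
Implicit Types (I C : M -> Prop).

Lemma submoduleZ I a x : submodule I -> I x -> I (a *: x).
Proof. by move=> [I0 IP] Ix; rewrite -[_ *: _]addr0; apply: IP. Qed.
Lemma submoduleD I x y : submodule I -> I x -> I y -> I (x + y).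
Proof. by move=> [I0 IP] Ix Iy; rewrite -[x]scale1r; apply: IP. Qed.
Lemma submoduleB I x y : submodule I -> I x -> I y -> I (x - y).
Proof. by move=> [I0 IP] Ix Iy; rewrite addrC -scaleN1r; apply: IP. Qed.
Lemma submodule_sum I (J : eqType) (s : seq J) (F : J -> M) :
  submodule I -> (forall j, j \in s -> I (F j)) -> I (\sum_(j <- s) F j).
Proof.
move=> IP FI; rewrite big_seq; elim/big_rec: _ => [|j x js Ix]; first exact: IP.1.
by apply: submoduleD => //; apply: FI.
Qed.

Definition sum_submod I C x := exists y z, [/\ I y, C z & x = y + z].
Lemma sum_submodP I C : submodule I -> submodule C -> submodule (sum_submod I C).
Proof.
move=> [I0 IP] [C0 CP]; split; first by exists 0, 0; rewrite addr0.
move=> a _ _ [y [z [Iy Cz ->]]] [y' [z' [Iy' Cz' ->]]].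
by exists (a *: y + y'), (a *: z + z'); rewrite scalerDr addrACA; split; auto.
Qed.
Lemma sum_submodr I C x : submodule I -> C x -> sum_submod I C x.
Proof. by move=> [I0 _] Cx; exists 0, x; rewrite add0r. Qed.
Lemma sum_submodl I C x : submodule C -> I x -> sum_submod I C x.
Proof. by move=> [C0 _] Ix; exists x, 0; rewrite addr0. Qed.

(** By simplicity the elements [a] of [U] with [a *: x] in [I + C] are either all of
    [U], and [C] will do, or only 0, and [U x] can be added to [C]. *)
Lemma enlarge_complement I C (U : submodClosed S^o) (x : M) :
  submodule I -> submodule C -> (forall y, I y -> C y -> y = 0) -> simple_submodule U ->
  exists C', [/\ submodule C', forall y, C y -> C' y, forall y, I y -> C' y -> y = 0 &
    forall a : S, (a : S^o) \in U -> sum_submod I C' (a *: x)].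
Proof.
move=> IP CP IC [_ Usimple].
have SP := sum_submodP IP CP.
pose W (a : S^o) := a \in U /\ sum_submod I C ((a : S) *: x).
have WP : submodule W.
  split=> [|a u v [uU us] [vU vs]]; first by rewrite /W rpred0 scale0r; split=> //; exact: SP.1.
  rewrite /W rpredD ?rpredZ //; split=> //.
  have -> : (a *: u + v : S) *: x = a *: ((u : S) *: x) + (v : S) *: x.
    by rewrite scalerDl scalerA.
  exact: SP.2.
have [|W0|UW] := Usimple (submod_pred WP : submodClosed S^o).
- by move=> a /asboolP[].
- pose L y := exists2 a : S, (a : S^o) \in U & y = a *: x.
  have LP : submodule L.
    split=> [|a _ _ [u uU ->] [v vU ->]]; first by exists 0; rewrite ?rpred0 ?scale0r.
    by exists (a * u + v); rewrite ?scalerDl ?scalerA //; exact: rpredD (rpredZ a uU) vU.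
  exists (sum_submod C L); split; first exact: sum_submodP.
  + by move=> y; apply: sum_submodl.
  + move=> y Iy [c [_ [Cc [a aU ->] yE]]].
    have a0 : a = 0.
      apply: W0; apply/asboolP; split=> //; exists y, (- c); split=> //.
        by rewrite -scaleN1r; apply: submoduleZ.
      by rewrite yE addrC addKr.
    by apply: IC => //; rewrite yE a0 scale0r addr0.
  + move=> a aU; apply: sum_submodr => //; apply: sum_submodr => //; by exists a.
- exists C; split=> // a aU; have /asboolP[] // := UW a aU.
Qed.

(** The ring is a sum of simple left ideals and [M] is finitely generated, so [M] is
    covered by finitely many of the submodules treated in [enlarge_complement]. *)
Lemma complement I : semisimple_module S^o -> finitely_generated M -> submodule I ->
  exists C, [/\ submodule C, forall y, I y -> C y -> y = 0 & forall y, sum_submod I C y].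
Proof.
move=> /(_ 1)[s s1 sU] [n [e eP]] IP.
pose covered C (p : S * 'I_n) := forall a : S, sum_submod I C ((a * p.1) *: e p.2).
have [C [CP IC CL]] : exists C, [/\ submodule C, forall y, I y -> C y -> y = 0 &
    forall p, p \in [seq (u, i) | u <- s, i <- enum 'I_n] -> covered C p].
  have : forall p, p \in [seq (u, i) | u <- s, i <- enum 'I_n] -> p.1 \in s.
    by move=> _ /allpairsP[[u i] [us _ ->]].
  elim: [seq _ | _ <- _, _ <- _] => [|[u i] l IH] ls.
    exists (fun y => y = 0); split=> //; split=> // a x y -> ->; first by rewrite scaler0 addr0.
  have [|C [CP IC CL]] := IH; first by move=> p pl; apply: ls; rewrite inE pl orbT.
  have [|U Us uU] := sU u; first by apply: (ls (u, i)); rewrite inE eqxx.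
  have [C' [CP' CC' IC' CU']] := enlarge_complement (e i) IP CP IC Us.
  exists C'; split=> // p; rewrite inE => /predU1P[-> a|/CL pC a].
    by apply: CU'; rewrite -[_ * _]/(a *: (u : S^o)) rpredZ.
  have [y [z [Iy Cz ->]]] := pC a; exists y, z; split=> //; exact: CC'.
exists C; split=> // y; have [c ->] := eP y; have SP := sum_submodP IP CP.
apply: submodule_sum => // i _.
have -> : c i *: e i = \sum_(u <- s) (c i * u) *: e i.
  by rewrite -scaler_suml -mulr_sumr -[\sum_(u <- s) u]s1 mulr1.
apply: submodule_sum => // u us.
by apply: (CL (u, i)); apply/allpairsP; exists (u, i); rewrite mem_enum.
Qed.

Lemma image_projection I : semisimple_module S^o -> finitely_generated M -> submodule I ->
  exists q : {linear M -> M}, (forall y, I (q y)) /\ (forall y, I y -> q y = y).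
Proof.
move=> Sss Mfg IP; have [C [CP IC CS]] := complement Sss Mfg IP.
pose q y := projT1 (cid (CS y)).
have qP y : I (q y) /\ C (y - q y).
  rewrite /q; case: cid => x /= [z [Ix Cz ->]]; split=> //.
  by rewrite addrC addKr.
have quniq y z : I z -> C (y - z) -> q y = z.
  move=> Iz Cz; apply/eqP; rewrite -subr_eq0; apply/eqP; have [Iq Cq] := qP y.
  apply: IC; first exact: submoduleB.
  have -> : q y - z = (y - z) - (y - q y) by rewrite opprB [y - z]addrC addrACA addrN addr0 addrC.
  exact: submoduleB.
have ql : linear q.
  move=> a x y; have [Ix Cx] := qP x; have [Iy Cy] := qP y.
  apply: quniq; first exact: IP.2.
  have -> : a *: x + y - (a *: q x + q y) = a *: (x - q x) + (y - q y).
    by rewrite scalerBr opprD addrACA.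
  exact: CP.2.
exists (mklinear ql); split=> y; first by have [] := qP y.
by move=> Iy; apply: quniq => //; rewrite subrr; exact: CP.1.
Qed.
End Complement.

Section ProjectiveModules.
Context (S : pzRingType).

(** Let [q] project [N] onto the image of [f].  The map [(x, y) |-> f x + (y - q y)]
    is onto; the first coordinate of a section of it is the required [g]. *)
Lemma linear_regular (M N : lmodType S) (f : {linear M -> N}) :
  semisimple_module S^o -> finitely_generated N -> projective_module N ->
  exists g : {linear N -> M}, forall x, f (g (f x)) = f x.
Proof.
move=> Sss Nfg Np.
have [|q [qI qid]] := @image_projection S N (fun y => exists x, f x = y) Sss Nfg.
  split=> [|a _ _ [x <-] [y <-]]; first by exists 0; rewrite linear0.
  by exists (a *: x + y); rewrite linearP.
have pl : linear (fun z : (M * N)%type => f z.1 + (z.2 - q z.2)).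
  move=> a [x y] [x' y'].
  rewrite -[LHS]/(f (a *: x + x') + (a *: y + y' - q (a *: y + y'))) /=.
  by rewrite (linearP f) (linearP q) scalerDr scalerBr opprD (addrACA (a *: y)) [LHS]addrACA.
have [|s sP] := Np _ _ (mklinear pl) idfun.
  move=> y; have [x xE] := qI y; exists (x, y); rewrite /= xE.
  by rewrite addrC subrK.
have gl : linear (fun y => (s y).1) by move=> a x y; rewrite linearP.
exists (mklinear gl) => x /=.
have qf z : q (f z) = f z by apply: qid; exists z.
have /= := congr1 q (sP (f x)).
by rewrite linearD linearB [q (q _)]qid // subrr addr0 !qf.
Qed.

(** The image of [e] is represented by the kernel of [1 - e]. *)
Lemma idempotent_image (M : lmodType S) (e : {linear M -> M}) :
  (forall x, e (e x) = e x) -> finitely_generated M -> projective_module M ->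
  exists (U : lmodType S) (a : {linear U -> M}) (b : {linear M -> U}),
    [/\ forall u, b (a u) = u, forall x, a (b x) = e x,
        finitely_generated U & projective_module U].
Proof.
move=> ee [n [g gP]] Mp.
have cl : linear (fun x => x - e x).
  by move=> a x y; rewrite linearP opprD addrACA scalerBr.
pose c : {linear M -> M} := mklinear cl.
have eK x : e x \in lker_pred c by rewrite unfold_in /= ee subrr.
pose a : {linear lkernel c -> M} := val.
have bl : linear (fun x => LKernel (eK x)).
  by move=> l x y; apply: val_inj; rewrite /= linearP.
pose b : {linear M -> lkernel c} := mklinear bl.
have ba u : b (a u) = u.
  apply: val_inj; case: u => x xc /=.
  by move: xc; rewrite unfold_in /= subr_eq0 => /eqP <-.
exists (lkernel c), a, b; split=> //.
  exists n, (fun i => b (g i)) => u; have [d dE] := gP (a u); exists d.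
  by rewrite -[LHS]ba dE linear_sum; apply: eq_bigr => i _; rewrite linearZZ.
move=> X Y p f pS; have [h hP] := Mp X Y p (f \o b) pS.
by exists (h \o a) => u; rewrite [LHS]hP -[in RHS](ba u).
Qed.
End ProjectiveModules.

Section FiniteSemisimple.
Context (R : finPzRingType) (R_ss : semisimple_ring R).

Lemma finite_elements (M : projmod R) : exists s : seq M, forall x, x \in s.
Proof.
have [n [e eP]] := projmod_fg M.
exists [seq \sum_(i < n) (c i : R^c) *: e i | c : {ffun 'I_n -> R}] => x.
have [c ->] := eP x; apply/mapP; exists [ffun i => c i]; first by rewrite mem_enum.
by apply: eq_bigr => i _; rewrite ffunE.
Qed.

Lemma projcat_finite_homs : finite_homs (projcat R).
Proof.
move=> M N; have [n [e eP]] := projmod_fg M; have [s sP] := finite_elements N.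
pose ext (t : {ffun 'I_n -> 'I_(size s)}) : modhom M N :=
  match pselect (exists f : {linear M -> N}, forall i, f (e i) = nth 0 s (t i)) with
  | left ex => projT1 (cid ex) | right _ => 0 end.
exists [seq ext t | t : {ffun 'I_n -> 'I_(size s)}] => f.
have sz i : (seq.index ((f : {linear M -> N}) (e i)) s < size s)%N by rewrite index_mem.
apply/mapP; exists [ffun i => Ordinal (sz i)]; first by rewrite mem_enum.
rewrite /ext; case: pselect => [ex|]; last first.
  by case; exists f => i; rewrite ffunE nth_index.
case: cid => g /= gP; apply: linear_ext => x; have [c ->] := eP x.
rewrite !linear_sum; apply: eq_bigr => i _.
by rewrite !linearZZ gP ffunE nth_index.
Qed.

Lemma projcat_regular_finite : regular_finite (projcat R).
Proof.
split; first exact: projcat_finite_homs.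
  move=> M N f; have [g gP] := linear_regular (f : {linear M -> N}) R_ss
    (projmod_fg N) (@projmod_proj _ N).
  by exists g; apply: linear_ext.
move=> M e ee.
have [|U [a [b [ba ab Ufg Up]]]] := @idempotent_image R^c M e _ (projmod_fg M) (@projmod_proj _ M).
  by move=> x; rewrite -[in RHS]ee.
by exists (ProjMod Ufg Up), a, b; split; apply: linear_ext.
Qed.

Lemma projcat_torsion : exists2 N : nat, (0 < N)%N &
  forall (x y : projcat R) (t : hom x y), t *+ N = 0.
Proof.
exists #|R|; first by apply/card_gt0P; exists 0.
have R0 : #|R|%:R = 0 :> R.
  (* Translation by 1 permutes the summands of the sum of all elements. *)
  apply: (addIr (\sum_(x : R) x)); rewrite add0r -sumr_const -big_split /=.
  exact: esym (reindex_inj (addrI (1 : R))).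
move=> M N t; apply: linear_ext => x.
have tE n : ((t *+ n : modhom M N) : {linear M -> N}) x = ((t : {linear M -> N}) x) *+ n.
  by elim: n => [|n IH]; rewrite ?mulr0n ?mulrS //= -IH.
rewrite tE -scaler_nat.
have -> : (#|R|%:R : R^c) = 0 by exact: R0.
by rewrite scale0r.
Qed.
End FiniteSemisimple.

(** * Functors pulled back from a finite regular category *)

Definition corepfun (B : precat) (u : B) : addfun B.
Proof.
refine (@AddFun B (fun x => hom u x) (fun x y f g => comp f g) _ _ _ _).
- by move=> x y f g g'; rewrite compDr.
- by move=> x y g f f'; rewrite compDl.
- by move=> x g; rewrite comp1m.
- by move=> x y z g f h; rewrite compA.
Defined.

Definition addfun_pull (A B : precat) (pi : functor A B) (pi_add : additive_functor pi)
  (D : addfun B) : addfun A.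
Proof.
refine (@AddFun A (fun x => D (pi x)) (fun x y f u => amap (fmap pi f) u) _ _ _ _).
- by move=> x y f; apply: amapDr.
- by move=> x y u f g; rewrite pi_add; apply: amapDl.
- by move=> x u; rewrite fmap_id amap_id.
- by move=> x y z g f u; rewrite fmap_comp amap_comp.
Defined.

Lemma additive_opfunctor (A B : precat) (pi : functor A B) :
  additive_functor pi -> additive_functor (opfunctor pi).
Proof. by move=> pi_add x y f g; apply: pi_add. Qed.

Section Pullback.
Context (k : fieldType) (char0 : forall n, n.+1%:R != 0 :> k).
Context (B : precat) (rf : regular_finite B).
Context (N : nat) (N_gt0 : (0 < N)%N).
Context (torsion : forall (x y : B) (t : hom x y), t *+ N = 0).
Context (A : precat) (A_additive : additive_category A).
Context (S : Type) (r : S -> A) (rP : forall x : A, exists s : S, isomorphic (r s) x).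
Context (pi : functor A B) (pi_add : additive_functor pi).
Context (pi_esurj : essentially_surjective pi).

Lemma represented (y : B) : exists s : S, isomorphic (pi (r s)) y.
Proof.
have [x xy] := pi_esurj y; have [s [f [g [gf fg]]]] := rP x; exists s.
apply: isomorphic_trans xy; exists (fmap pi f), (fmap pi g).
by rewrite -!fmap_comp gf fg !fmap_id.
Qed.

Section Corepresentables.
Context (F : kfunctor k B).
Definition elements : Type := {s : S & F (pi (r s))}.
Definition corep_of (i : elements) : addfun B := corepfun (pi (r (projT1 i))).

(** The Yoneda lemma, with [F] generated by its values at the objects [pi (r s)]. *)
Lemma free_cover : exists p : nattrans (freefun k corep_of) F, nat_epi p.
Proof.
have [x y f [s v] u|p pE] := @free_nat k B elements corep_of F
  (fun x i (u : corep_of i x) => kmap F u (projT2 i)); first exact: kmap_comp.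
exists p => b y; have [s [f [g [_ fg]]]] := represented b.
exists (bas k (F := corep_of) (i := existT _ s (kmap F g y)) f).
by rewrite pE /= -kmap_comp fg kmap_id.
Qed.
End Corepresentables.

Section Embedding.
Context (G : kfunctor k B).
Definition rep_of (s : S) : addfun (opcat B) := yo (pi (r s)).
Local Notation cG := (coind rep_of (fun s => G (pi (r s)))).

Lemma coind_embedding : exists j : nattrans G cG, forall b, injective (j b).
Proof.
pose j0 b (x : G b) : cG b := fun s t => kmap G t x.
have j0l b : linear (j0 b).
  by move=> a x y; apply: funfamP => s t; rewrite /j0 linearP.
have jn b b' (f : hom b b') (x : G b) : mklinear (j0l b') (kmap G f x) = kmap cG f (mklinear (j0l b) x).
  by apply: funfamP => s t; rewrite /= /j0 /coind_map /= kmap_comp.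
exists (NatTrans jn) => b x y xy; have [s [f [g [_ fg]]]] := represented b.
have /(congr1 (kmap G f)) := congr1 (fun u : cG b => u s g) xy.
by rewrite /= /j0 -!kmap_comp fg !kmap_id.
Qed.
End Embedding.

(** On [B], the functor [F] is a retract of a direct sum of linearized corepresentable
    functors and [G] is a retract of a coinduced functor.  The retractions are
    pulled back to [A], where [bar_coboundary] applies. *)
Lemma Ext_pullback_vanishes (F G : kfunctor k B) n :
  Ext_vanishes (pullback pi F) (pullback pi G) n.+1.
Proof.
have [p pS] := free_cover F; have [i iP] := nat_section char0 rf represented pS.
have [j jI] := coind_embedding G; have [q qP] := nat_retraction char0 rf represented jI.
pose H e := addfun_pull pi_add (corep_of (F := F) e).
pose T s := addfun_pull (additive_opfunctor pi_add) (rep_of s).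
pose C := coind T (fun s => G (pi (r s))).
pose iA : nattrans (pullback pi F) (freefun k H) :=
  @NatTrans k A (pullback pi F) (freefun k H) (fun a => i (pi a)) (fun a b f => natural i (fmap pi f)).
pose pA : nattrans (freefun k H) (pullback pi F) :=
  @NatTrans k A (freefun k H) (pullback pi F) (fun a => p (pi a)) (fun a b f => natural p (fmap pi f)).
pose jA : nattrans (pullback pi G) C :=
  @NatTrans k A (pullback pi G) C (fun a => j (pi a)) (fun a b f => natural j (fmap pi f)).
pose qA : nattrans C (pullback pi G) :=
  @NatTrans k A C (pullback pi G) (fun a => q (pi a)) (fun a b f => natural q (fmap pi f)).
have N0 : N%:R != 0 :> k by case: (N) N_gt0.
apply: (Ext_vanishes_retract (i := iA) (r := pA) (R := bar_resolution k rP A_additive H)).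
  by move=> a u; apply: iP.
move=> z zc.
have TN s a (t : T s a) : t *+ N = 0 by apply: torsion.
have [|y yE] := bar_coboundary N0 TN (z := nat_comp jA z).
  by move=> a u; rewrite /= [z a _]zc linear0.
exists (nat_comp qA y) => a u.
by rewrite /= -yE; apply/esym/qP.
Qed.
End Pullback.

(** * Tor from Ext *)

(** [{linear U -> V}] as a vector space. *)
Definition linhom (k : fieldType) (U V : lmodType k) : Type := modhom U V.

Section LinearMaps.
Context (k : fieldType) (U V : lmodType k).
Local Notation hom := (linhom U V).

HB.instance Definition _ := GRing.Zmodule.on hom.

Definition lmap (f : hom) : {linear U -> V} := f.

Lemma linhom_scale_linear (a : k) (f : hom) : linear (fun u => a *: lmap f u).
Proof. by move=> b u v; rewrite linearP scalerDr !scalerA mulrC. Qed.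
Definition linhom_scale (a : k) (f : hom) : hom := mklinear (linhom_scale_linear a f).

Lemma linhom_scaleA a b f : linhom_scale a (linhom_scale b f) = linhom_scale (a * b) f.
Proof. by apply: linear_ext => u; apply: scalerA. Qed.
Lemma linhom_scale1 : left_id 1 linhom_scale.
Proof. by move=> f; apply: linear_ext => u; apply: scale1r. Qed.
Lemma linhom_scaleDr : right_distributive linhom_scale +%R.
Proof. by move=> a f g; apply: linear_ext => u; apply: scalerDr. Qed.
Lemma linhom_scaleDl f : {morph linhom_scale^~ f : a b / a + b}.
Proof. by move=> a b; apply: linear_ext => u; apply: scalerDl. Qed.
HB.instance Definition _ := GRing.Zmodule_isLmodule.Build k hom
  linhom_scaleA linhom_scale1 linhom_scaleDr linhom_scaleDl.
End LinearMaps.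

Section Dual.
Context (k : fieldType) (B : precat) (F : kfunctor k (opcat B)) (M : lmodType k).

Lemma dual_map_linear (x y : B) (f : hom x y) :
  linear (fun phi : linhom (F x) M =>
    (lmap phi \o @kmap k (opcat B) F y x f : {linear F y -> M}) : linhom (F y) M).
Proof. by move=> a phi psi; apply: linear_ext. Qed.

Definition dual : kfunctor k B.
Proof.
refine (@KFunctor k B (fun x => linhom (F x) M)
  (fun x y f => mklinear (@dual_map_linear x y f)) _ _).
- by move=> x phi; apply: linear_ext => u; rewrite /= (@kmap_id k (opcat B) F).
- move=> x y z g f phi; apply: linear_ext => u.
  by rewrite /= (@kmap_comp k (opcat B) F _ _ _ f g).
Defined.
End Dual.

Section TorFromExt.
Context (k : fieldType) (A B : precat) (pi : functor A B).
Context (F : kfunctor k (opcat B)) (G : kfunctor k B).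
Local Notation Fpi := (pullback (opfunctor pi) F).
Local Notation Gpi := (pullback pi G).

(** Let [M] be the quotient of [T n.+1] by the boundaries.  The projection [q] to [M]
    is adjoint to a cocycle [z] with values in the dual of [F].  If [z] is a
    coboundary, then [q] factors through the differential, hence [q] kills every
    cycle [t], which means that [t] is a boundary. *)
Lemma Tor_vanishes_Ext n :
  (forall M : lmodType k, Ext_vanishes Gpi (pullback pi (dual F M)) n.+1) ->
  Tor_vanishes Fpi Gpi n.+1.
Proof.
move=> Ext0 P T t tc.
have bP : submodule (fun u => boundary (P := P) (T := T) (n := n.+1) u).
  split=> [|a _ _ [u <-] [v <-]]; first by exists 0; rewrite linear0.
  by exists (a *: u + v); rewrite linearP.
pose M := lquot (submod_pred bP).
pose q : {linear T n.+1 -> M} := @lquot_pi k (T n.+1) (submod_pred bP).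
have q0 u : q u = 0 <-> boundary (P := P) (T := T) (n := n.+1) u.
  rewrite -(linear0 q); split=> [/lquot_piP|ub].
    by rewrite subr0 => /asboolP.
  by apply/lquot_piP; rewrite subr0; apply/asboolP.
pose el m x (h : Fpi x) (u : P m x) := tensor_elt (T m) h u.
have elB m := tensor_balanced (T m).
have hl a (u : P n.+1 a) : linear (fun h : F (pi a) => q (el _ a h u)).
  by move=> c h h'; rewrite -linearP; congr (q _); apply: ((elB n.+1).1 a).1.
have zl a : linear (fun u : P n.+1 a => mklinear (hl a u) : linhom (F (pi a)) M).
  move=> c u v; apply: linear_ext => h.
  rewrite /= -[RHS]/(c *: q (el _ a h u) + q (el _ a h v)) -linearP; congr (q _).
  exact: ((elB n.+1).1 a).2.
have zn a b (f : hom a b) (u : P n.+1 a) :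
    mklinear (zl b) (kmap (P n.+1) f u) = kmap (pullback pi (dual F M)) f (mklinear (zl a) u).
  apply: linear_ext => h /=; congr (q _).
  exact/esym/((elB n.+1).2 a b f h u).
pose z : nattrans (P n.+1) (pullback pi (dual F M)) :=
  @NatTrans k A _ (pullback pi (dual F M)) (fun a => mklinear (zl a)) zn.
have [a u|y yE] := Ext0 M P z.
  apply: linear_ext => h /=; apply/q0; exists (el _ a h u).
  exact: tensor_lift_elt.
pose b x (h : Fpi x) (v : P n x) : M := lmap (y x v) h.
have bB : balanced b.
  split=> [x|x x' f h v].
    split=> [v|h] c u w; rewrite /b; first by rewrite linearP.
    by rewrite linearP.
  by rewrite /b natural.
have LE : tensor_lift (T n) bB \o tor_d T n =1 q.
  have qB : @balanced k A Fpi (P n.+1) M (fun x h u => q (el _ x h u)).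
    split=> [x|x x' f h v]; last by congr (q _); apply: (elB n.+1).2.
    split=> [v|h] c u w; first exact: hl.
    by rewrite -linearP; congr (q _); apply: ((elB n.+1).1 x).2.
  move=> u; rewrite (tensor_lift_uniq qB) ?[RHS](tensor_lift_uniq qB) // => x h v.
  rewrite /= /tor_d /tensor_map !tensor_lift_elt.
  by rewrite /b -yE.
by apply/q0; rewrite -LE /= [tor_d _ _ _]tc linear0.
Qed.
End TorFromExt.

(** * Vanishing of Ext and Tor *)

Local Close Scope ring_scope.

Theorem mainTheorem4
  (k : fieldType) (char_k : [pchar k]%R =i pred0)
  (R : finPzRingType) (R_semisimple : semisimple_ring R)
  (A : precat) (A_additive : additive_category A) (A_small : small_category A)
  (pi : functor A (projcat R))
  (pi_full : full pi) (pi_additive : additive_functor pi)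
  (pi_esurj : essentially_surjective pi)
  (F : kfunctor k (opcat (projcat R))) (F' G : kfunctor k (projcat R))
  (n : nat) (n_gt0 : 0 < n) :
  Ext_vanishes (pullback pi F') (pullback pi G) n /\
  Tor_vanishes (pullback (opfunctor pi) F) (pullback pi G) n.
Proof.
case: n n_gt0 => // n _.
have char0 m : (m.+1%:R != 0 :> k)%R by rewrite (proj1 (pcharf0P k) char_k).
have [S [r rP]] := A_small; have [N N_gt0 torsion] := projcat_torsion R.
have Ext0 (X Y : kfunctor k (projcat R)) : Ext_vanishes (pullback pi X) (pullback pi Y) n.+1.
  exact: (Ext_pullback_vanishes char0 (projcat_regular_finite R_semisimple)
    N_gt0 torsion A_additive rP pi_additive pi_esurj).
by split; [exact: Ext0|apply: Tor_vanishes_Ext => M; exact: Ext0].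
Qed.
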